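(* Suppose that (A)–(F) and the local error bound condition (EBC) with constants $\delta>0$, $\gamma>0$ and a fixed exponent $d\in[1,2]$ (see context) hold. Let $$\tau=\frac{p-L}{4B_g^2},\qquad C_d=\frac{\gamma^{1/d}K}{p-L},\qquad \hat\theta_d=\frac{\tau}{12pC_d}\Big(\frac{\tau}{12p}\Big)^{1-1/d},$$ $$\tilde\theta_d=\min\Big\{\frac{p-L}{18p},\;6p\tau,\;\frac{R^2(\delta)(p-L)^2\tau}{2\cdot 12^3p^3M_\lambda^2},\;\hat\theta_d\Big\}.$$ For a given target accuracy $\epsilon>0$ let $$\theta(\epsilon)=\min\Big\{\tilde\theta_d,\;\frac{6p\tau}{M_\lambda^2+1},\;\Big(\frac{\epsilon^2}{2A_d}\Big)^{d-1}\Big\},\qquad A_d=24p\Big(1-\frac1d\Big)\Big(\frac{2}{\tau d}\Big)^{\frac1{d-1}}(6pC_d)^{\frac d{d-1}},$$ where for $d=1$ the third term in the minimum is omitted. Let $c\in(0,1)$ be any constant and put $$\mathcal C_1(\theta)=\max\Big\{\frac{24p}{\theta},\frac{4(M_\lambda^2+1)}{\tau}\Big\},$$ $$\mathcal C_0(\theta)=\Big(1+\frac{(M_\lambda^2+1)B_g^2}{(p-L)^2}\Big)\frac{c\pi^2}{3}+\mathcal C_1(\theta)\Big(\phi^0-\underline f+\frac{cp\theta\pi^2}{72(p-L)^2}\Big),\qquad T=\Big\lceil\frac{2\mathcal C_0(\theta(\epsilon))}{\epsilon^2}\Big\rceil .$$ Run the iMELa algorithm for $T$ iterations with $\tau_t=\tau$,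 $\theta_t=\theta(\epsilon)$ and $\epsilon_t=\frac{c}{t+1}$ for all $t$, where each $x^{(t+1)}$ is computed by the APG procedure described in the context. Then the algorithm finds an $\epsilon$-KKT point of (P) (that is, at least one of $x^{(1)},\dots,x^{(T)}$ is an $\epsilon$-KKT point of (P)), with oracle complexity (total number of evaluations of gradients of $f$ and of the $g_i$) $O(\epsilon^{-2d}\ln(\epsilon^{-1}))$.
   Context: **Problem.** $\mathcal X=\{x\in\mathbb R^n: Ax\le b\}$ with $A\in\mathbb R^{l\times n}$, $b\in\mathbb R^l$; $f,g_1,\dots,g_m:\mathbb R^n\to\mathbb R$ are differentiable, $g=(g_1,\dots,g_m)^\top$, $\nabla g(x)=[\nabla g_1(x),\dots,\nabla g_m(x)]\in\mathbb R^{n\times m}$. Problem (P): minimize $f(x)$ over $x\in\mathcal X$ subject to $g_i(x)\le0$, $i\in[m]$. Here $[m]=\{1,\dots,m\}$, $[l]=\{1,\dots,l\}$. $\|\cdot\|$ is the Euclidean norm (spectral norm for matrices), $[\cdot]_+=\max\{\cdot,0\}$ componentwise, $\mathcal N_{\mathcal B}(x)$ is the normal cone of a closed convex set $\mathcal B$ at $x$, $\mathrm{dist}$ is Euclidean distance, $\mathrm{proj}_{\mathcal X}$ is Euclidean projection onto $\mathcal X$, $\mathbb B(x,\delta)$ is the Euclidean ball. **Standing assumptions.** (A) $\mathcal X$ is compact with diameter $D_{\mathcal X}<\infty$. (B) $\min_{x\in\mathcal X}f(x)\ge\underline f$ for some $\underline f\in\mathbb R$. (C) $f$ and all $g_i$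 are $L$-smooth (gradients $L$-Lipschitz on $\mathcal X$, $L\ge0$), and each $g_i$ is convex. (D) $\|\nabla f(x)\|\le B_f$ on $\mathcal X$. (E) $\max\{\|g(x)\|,\|\nabla g(x)\|\}\le B_g$ on $\mathcal X$. (F) There is $x_{\rm feas}\in\mathcal X$ with $g_i(x_{\rm feas})<0$ for all $i\in[m]$. Throughout, $p>L$ is a constant. **$\epsilon$-KKT point.** $x\in\mathcal X$ is an $\epsilon$-KKT point of (P) if there is $\lambda\ge0$ in $\mathbb R^m$ with $\mathrm{dist}(-\nabla f(x)-\sum_i\lambda_i\nabla g_i(x),\mathcal N_{\mathcal X}(x))\le\epsilon$, $\|[g(x)]_+\|\le\epsilon$ and $\sum_i|\lambda_ig_i(x)|\le\epsilon$. $\mathcal X^*$ denotes the set of KKT points (the case $\epsilon=0$). **EBC with exponent $d$.** For $I_g\subseteq[m]$, $I_A\subseteq[l]$ let $\mathcal S(I_g,I_A)=\{u\in\mathcal X: g_i(u)=0\ (i\in I_g),\ g_i(u)\le0\ (i\notin I_g),\ [Au-b]_j=0\ (j\in I_A),\ [Au-b]_j\le0\ (j\notin I_A)\}$. Let $J_g(x)=\{i: g_i(x)=0\}$, $J_A(x)=\{j:[Ax-b]_j=0\}$. The EBC: there are $\delta>0,\gamma>0,d\in[1,2]$ such that for all $x^*\in\mathcal X^*$, all $x\in\mathbb B(x^*,\delta)$, all $I_g\subseteq J_g(x^* )$, $I_A\subseteq J_A(x^* )$, $$\mathrm{dist}(x,\mathcal S(I_g,I_A))^{2d}\le\gamma\Big(\sum_{i\in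 I_g}|g_i(x)|^2+\sum_{i\in[m]\setminus I_g}([g_i(x)]_+)^2+\sum_{j\in I_A}|[Ax-b]_j|^2+\sum_{j\in[l]\setminus I_A}([[Ax-b]_j]_+)^2\Big).$$ **Functions.** $\mathcal L_p(x,z,\lambda)=f(x)+\sum_i\lambda_ig_i(x)+\frac p2\|x-z\|^2$; $\mathfrak d(\lambda,z)=\min_{x\in\mathcal X}\mathcal L_p(x,z,\lambda)$; $v(z)=\min\{f(x)+\frac p2\|x-z\|^2: x\in\mathcal X, g_i(x)\le0\ \forall i\}$, with (unique) minimizer $x(z)$. **iMELa algorithm.** Given step-sizes $\tau_t>0$, $\theta_t\in[0,1]$ and tolerances $\epsilon_t\in(0,1)$, start from $x^{(0)}=z^{(0)}\in\mathcal X$, $\lambda^{(0)}=0$; for $t=0,1,\dots$: $\lambda_i^{(t+1)}=[\lambda_i^{(t)}+\tau_tg_i(x^{(t)})]_+$ for $i\in[m]$; choose $x^{(t+1)}\in\mathcal X$ with $\mathrm{dist}(-\nabla_x\mathcal L_p(x^{(t+1)},z^{(t)},\lambda^{(t+1)}),\mathcal N_{\mathcal X}(x^{(t+1)}))\le\epsilon_t$ ( * ); $z^{(t+1)}=z^{(t)}+\theta_t(x^{(t+1)}-z^{(t)})$. Write $\tilde x^{(t+1)}=\arg\min_{x\in\mathcal X}\mathcal L_p(x,z^{(t)},\lambda^{(t+1)})$. The initial potential is $\phi^0=\mathcal L_p(x^{(0)},z^{(0)},\lambda^{(0)})-2\mathfrak d(\lambda^{(0)},z^{(0)})+2v(z^{(0)})$.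 **Constants.** With constant $\tau_t=\tau$: $M_\lambda=\max\Big\{2\tau B_g,\ \frac{2\tau(C_\lambda+\tau B_g^2)}{2\tau\min_{i\in[m]}[-g_i(x_{\rm feas})]}\Big\}$, $C_\lambda=(B_f+pD_{\mathcal X}+1)D_{\mathcal X}$, and $K=L+L\sqrt m\,M_\lambda+p$. $R(\delta)>0$ denotes a constant, independent of $t$ and of the iterates (and of $\epsilon$), with the following property (such a constant exists): for every run of iMELa with $\tau_t=\frac{p-L}{4B_g^2}$ and constant $\theta_t=\theta\in(0,\frac{p-L}{18p}]$ and every $t\ge0$, if $\mathrm{dist}(-\nabla f(\tilde x^{(t+1)})-\nabla g(\tilde x^{(t+1)})\lambda^{(t+1)},\mathcal N_{\mathcal X}(\tilde x^{(t+1)}))^2+\mathrm{dist}(g(\tilde x^{(t+1)}),\mathcal N_{\mathbb R^m_+}(\lambda^{(t+1)}))^2\le R^2(\delta)$, then $\|x(z^{(t)})-\tilde x^{(t+1)}\|^2\le\frac{\gamma^{1/d}K}{p-L}\mathrm{dist}(g(\tilde x^{(t+1)}),\mathcal N_{\mathbb R^m_+}(\lambda^{(t+1)}))^{2/d}$. **APG procedure (Nesterov's accelerated projected gradient method).** With $F(\cdot)=\mathcal L_p(\cdot,z^{(t)},\lambda^{(t+1)})$ and $q=(p-L)/K$, start from any $u^{(0)}=w^{(0)}\in\mathcal X$ and iterate $u^{(k+1)}=\mathrm{proj}_{\mathcal X}(w^{(k)}-\frac1K\nabla F(w^{(k)}))$, $w^{(k+1)}=u^{(k+1)}+\frac{1-\sqrt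 q}{1+\sqrt q}(u^{(k+1)}-u^{(k)})$. Stop at the first $k=k_t$ for which $x^{(t+1)}:=\mathrm{proj}_{\mathcal X}(u^{(k)}-\frac1K\nabla F(u^{(k)}))$ satisfies ( * ).
   Formalization: For APG termination and the oracle complexity, the gradients of f and g_i are also assumed L-Lipschitz on all points u+β(u−v), u,v∈X, β=(1−√q)/(1+√q), where APG evaluates them; with (C) on X only, APG may never stop. The ε-KKT claim needs no such assumption. *)

(* Defs.v *)
From HB Require Import structures.
From mathcomp Require Import all_boot all_order all_algebra.
From mathcomp Require Import all_classical all_reals all_analysis.
Import Order.TTheory GRing.Theory Num.Theory.
Import numFieldNormedType.Exports.

Set Implicit Arguments.
Unset Strict Implicit.
Unset Printing Implicit Defensive.

Local Open Scope classical_set_scope.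
Local Open Scope ring_scope.

(** * Euclidean geometry of 'cV[R]_n

    The norm [`|x|] that the library puts on matrices is the max norm, so
    Euclidean notions are defined here.  Topological notions ([compact],
    [differentiable]) do not depend on this choice and are the library's. *)

Section Euclidean.
Context {R : realType}.

Definition dotv n (u v : 'cV[R]_n) : R := \sum_i u i 0 * v i 0.

Definition enorm n (u : 'cV[R]_n) : R := Num.sqrt (dotv u u).

Definition spectral_norm n m (M : 'M[R]_(n, m)) : R :=
  sup [set enorm (M *m v) | v in [set v : 'cV[R]_m | enorm v <= 1]].

(* [inf set0 = 0] in the library: only meaningful for nonempty S. *)
Definition dist_to n (x : 'cV[R]_n) (S : set 'cV[R]_n) : R :=
  inf [set enorm (x - y) | y in S].

Definition diameter n (S : set 'cV[R]_n) : R :=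
  sup [set r | exists x y, [/\ S x, S y & r = enorm (x - y)]].

Definition normal_cone n (S : set 'cV[R]_n) (x : 'cV[R]_n) : set 'cV[R]_n :=
  [set v | S x /\ forall y, S y -> dotv v (y - x) <= 0].

Definition nonneg_orthant n : set 'cV[R]_n := [set v | forall i, 0 <= v i 0].

Definition is_argmin n (S : set 'cV[R]_n) (h : 'cV[R]_n -> R) (x : 'cV[R]_n) :=
  S x /\ forall y, S y -> h x <= h y.

(* For S nonempty, closed and convex this is the unique nearest point. *)
Definition eproj n (S : set 'cV[R]_n) (y : 'cV[R]_n) : 'cV[R]_n :=
  xget 0 [set x | is_argmin S (fun u => enorm (u - y)) x].

Definition grad n (h : 'cV[R]_n -> R) (x : 'cV[R]_n) : 'cV[R]_n :=
  \col_i ('D_(delta_mx i 0) h x).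

Definition grad_lipschitz_on n (S : set 'cV[R]_n) (L : R)
    (h : 'cV[R]_n -> R) :=
  forall x y, S x -> S y -> enorm (grad h x - grad h y) <= L * enorm (x - y).

Definition pospart (a : R) : R := Num.max a 0.

(* dist(- grad F(x), N_S(x)) <= eps, for the problem of minimizing F over S. *)
Definition approx_stationary n (S : set 'cV[R]_n) (F : 'cV[R]_n -> R)
    (eps : R) (x : 'cV[R]_n) :=
  S x /\ dist_to (- grad F x) (normal_cone S x) <= eps.

End Euclidean.

(** * Accelerated projected gradient *)

Section APG.
Context {R : realType} {n : nat}.
Variables (S : set 'cV[R]_n) (F : 'cV[R]_n -> R) (K q : R).

Definition apg_beta (r : R) : R := (1 - Num.sqrt r) / (1 + Num.sqrt r).

Definition proj_grad_step (w : 'cV[R]_n) : 'cV[R]_n :=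
  eproj S (w - K^-1 *: grad F w).

Definition apg_step (uw : 'cV[R]_n * 'cV[R]_n) : 'cV[R]_n * 'cV[R]_n :=
  let u' := proj_grad_step uw.2 in (u', u' + apg_beta q *: (u' - uw.1)).

(* The pair (u^(k), w^(k)). *)
Definition apg_iter (u0 : 'cV[R]_n) (k : nat) : 'cV[R]_n * 'cV[R]_n :=
  iter k apg_step (u0, u0).

Definition apg_candidate (u0 : 'cV[R]_n) (k : nat) : 'cV[R]_n :=
  proj_grad_step (apg_iter u0 k).1.

Definition apg_stops_at (eps : R) (u0 : 'cV[R]_n) (k : nat) :=
  approx_stationary S F eps (apg_candidate u0 k) /\
  forall j, (j < k)%N -> ~ approx_stationary S F eps (apg_candidate u0 j).

End APG.

(* Gradients of f and of the m functions g_i evaluated by an APG call that stops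
   at index k: grad F costs m + 1 of them, and is evaluated at
   w^(0), ..., w^(k-1), at u^(0), ..., u^(k) (to form the candidates) and at the
   k + 1 candidates (to test them). *)
Definition apg_oracle_calls (m k : nat) : nat := (m.+1 * (k + k.+1 + k.+1))%N.

Definition total_oracle_calls (m N : nat) (k : nat -> nat) : nat :=
  (\sum_(t < N) apg_oracle_calls m (k t))%N.

(** * The problem and the constants *)

Record setting (R : realType) (n m l : nat) := Setting {
  cA : 'M[R]_(l, n);              (* X = {x | A x <= b} *)
  cb : 'cV[R]_l;
  fobj : 'cV[R]_n -> R;
  gcon : 'I_m -> 'cV[R]_n -> R;
  cL : R;                         (* smoothness constant *)
  cp : R;                         (* proximal parameter *)
  cBf : R;
  cBg : R;
  flow : R;                       (* lower bound of f on X *)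
  xfeas : 'cV[R]_n;               (* Slater point *)
  cdelta : R;                     (* delta, gamma, d of the error bound *)
  cgamma : R;
  cd : R;
  cR : R;                         (* R(delta) *)
  cc : R                          (* eps_t = c / (t + 1) *)
}.

Section Problem.
Context {R : realType} {n m l : nat}.
Variable P : setting R n m l.
Implicit Types (x z : 'cV[R]_n) (lam : 'cV[R]_m).

Local Notation f := (fobj P).
Local Notation g := (gcon P).
Local Notation p := (cp P).
Local Notation L := (cL P).

Definition slack x (j : 'I_l) : R := (cA P *m x - cb P) j 0.

Definition Xset : set 'cV[R]_n := [set x | forall j, slack x j <= 0].

Definition gvec x : 'cV[R]_m := \col_i g i x.

Definition gpos x : 'cV[R]_m := \col_i pospart (g i x).

Definition jacg x : 'M[R]_(n, m) := \matrix_(i, j) grad (g j) x i 0.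

Definition feasible : set 'cV[R]_n := [set x | Xset x /\ forall i, g i x <= 0].

Definition eps_KKT (eps : R) x :=
  Xset x /\ exists lam, [/\ nonneg_orthant lam,
    dist_to (- grad f x - \sum_i lam i 0 *: grad (g i) x)
            (normal_cone Xset x) <= eps,
    enorm (gpos x) <= eps &
    \sum_i `|lam i 0 * g i x| <= eps].

Definition KKT : set 'cV[R]_n := [set x | eps_KKT 0 x].

(** ** Local error bound condition *)

Definition active_g x : {set 'I_m} := [set i | g i x == 0]%SET.
Definition active_A x : {set 'I_l} := [set j | slack x j == 0]%SET.

Definition Sset (Ig : {set 'I_m}) (IA : {set 'I_l}) : set 'cV[R]_n :=
  [set u | Xset u /\
    [/\ forall i, i \in Ig -> g i u = 0,
        forall i, i \notin Ig -> g i u <= 0,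
        forall j, j \in IA -> slack u j = 0 &
        forall j, j \notin IA -> slack u j <= 0]].

Definition EBC (delta gamma d : R) :=
  forall xs x (Ig : {set 'I_m}) (IA : {set 'I_l}),
    KKT xs -> enorm (x - xs) < delta ->
    (Ig \subset active_g xs)%SET -> (IA \subset active_A xs)%SET ->
    dist_to x (Sset Ig IA) `^ (2 * d) <=
      gamma * (\sum_(i in Ig) `|g i x| ^+ 2
             + \sum_(i | i \notin Ig) pospart (g i x) ^+ 2
             + \sum_(j in IA) `|slack x j| ^+ 2
             + \sum_(j | j \notin IA) pospart (slack x j) ^+ 2).

(** ** Lagrangian, dual function and Moreau envelope *)

Definition proxf z x : R := f x + p / 2 * enorm (x - z) ^+ 2.

Definition Lp x z lam : R :=
  f x + \sum_i lam i 0 * g i x + p / 2 * enorm (x - z) ^+ 2.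

Definition dualf lam z : R := inf [set Lp x z lam | x in Xset].

Definition envv z : R := inf [set proxf z x | x in feasible].

Definition phi0 x0 : R := Lp x0 x0 0 - 2 * dualf 0 x0 + 2 * envv x0.

(** ** The algorithm *)

Definition dual_step (tau : R) lam x : 'cV[R]_m :=
  \col_i pospart (lam i 0 + tau * g i x).

(* (x, z, lam) performs the iterations t = 0, ..., N - 1 of iMELa. *)
Definition imela_run (N : nat) (tau theta eps : nat -> R)
    (x z : nat -> 'cV[R]_n) (lam : nat -> 'cV[R]_m) :=
  [/\ Xset (x 0%N), z 0%N = x 0%N, lam 0%N = 0 &
    forall t, (t < N)%N ->
      [/\ lam t.+1 = dual_step (tau t) (lam t) (x t),
          approx_stationary Xset (fun y => Lp y (z t) (lam t.+1)) (eps t) (x t.+1) &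
          z t.+1 = z t + theta t *: (x t.+1 - z t)]].

(** ** Constants *)

Definition ctau : R := (p - L) / (4 * cBg P ^+ 2).

Definition Clam : R :=
  (cBf P + p * diameter Xset + 1) * diameter Xset.

Definition Mlam : R :=
  Num.max (2 * ctau * cBg P)
    (2 * ctau * (Clam + ctau * cBg P ^+ 2)
     / (2 * ctau * inf [set - g i (xfeas P) | i in [set: 'I_m]])).

Definition cK : R := L + L * Num.sqrt m%:R * Mlam + p.

Definition cq : R := (p - L) / cK.

Definition Cd : R := cgamma P `^ (cd P)^-1 * cK / (p - L).

(* The defining property of R(delta). *)
Definition R_property (r : R) :=
  forall (N t : nat) (theta : R) (eps : nat -> R)
         (x z : nat -> 'cV[R]_n) (lam : nat -> 'cV[R]_m) (xt xz : 'cV[R]_n),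
    0 < theta <= (p - L) / (18 * p) ->
    (forall s, 0 < eps s < 1) ->
    imela_run N (fun=> ctau) (fun=> theta) eps x z lam ->
    (t < N)%N ->
    is_argmin Xset (fun y => Lp y (z t) (lam t.+1)) xt ->
    is_argmin feasible (proxf (z t)) xz ->
    dist_to (- grad f xt - jacg xt *m lam t.+1) (normal_cone Xset xt) ^+ 2
      + dist_to (gvec xt) (normal_cone (@nonneg_orthant R m) (lam t.+1)) ^+ 2
      <= r ^+ 2 ->
    enorm (xz - xt) ^+ 2 <=
      Cd * dist_to (gvec xt) (normal_cone (@nonneg_orthant R m) (lam t.+1))
             `^ (2 / cd P).

Definition theta_hat : R :=
  ctau / (12 * p * Cd) * (ctau / (12 * p)) `^ (1 - (cd P)^-1).

Definition theta_tilde : R :=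
  Num.min ((p - L) / (18 * p))
    (Num.min (6 * p * ctau)
      (Num.min (cR P ^+ 2 * (p - L) ^+ 2 * ctau
                / (2 * 12 ^+ 3 * p ^+ 3 * Mlam ^+ 2))
               theta_hat)).

Definition cAd : R :=
  24 * p * (1 - (cd P)^-1) * (2 / (ctau * cd P)) `^ (cd P - 1)^-1
  * (6 * p * Cd) `^ (cd P / (cd P - 1)).

Definition theta_eps (eps : R) : R :=
  let th := Num.min theta_tilde (6 * p * ctau / (Mlam ^+ 2 + 1)) in
  if cd P == 1 then th
  else Num.min th ((eps ^+ 2 / (2 * cAd)) `^ (cd P - 1)).

Definition C1 (theta : R) : R :=
  Num.max (24 * p / theta) (4 * (Mlam ^+ 2 + 1) / ctau).

Definition C0 (theta : R) x0 : R :=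
  (1 + (Mlam ^+ 2 + 1) * cBg P ^+ 2 / (p - L) ^+ 2) * (cc P * pi ^+ 2 / 3)
  + C1 theta * (phi0 x0 - flow P
                + cc P * p * theta * pi ^+ 2 / (72 * (p - L) ^+ 2)).

Definition Titer (eps : R) x0 : nat :=
  `|Num.ceil (2 * C0 (theta_eps eps) x0 / eps ^+ 2)|%N.

Definition tol (t : nat) : R := cc P / t.+1%:R.

(** ** iMELa with APG as inner solver *)

(* As [imela_run], where moreover the t-th inner problem is solved by APG started
   at u0 t and stopped at index k t. *)
Definition imela_apg_run (N : nat) (theta : R)
    (x z : nat -> 'cV[R]_n) (lam : nat -> 'cV[R]_m)
    (u0 : nat -> 'cV[R]_n) (k : nat -> nat) :=
  imela_run N (fun=> ctau) (fun=> theta) tol x z lam /\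
  forall t, (t < N)%N ->
    let F y := Lp y (z t) (lam t.+1) in
    [/\ Xset (u0 t),
        apg_stops_at Xset F cK cq (tol t) (u0 t) (k t) &
        x t.+1 = apg_candidate Xset F cK cq (u0 t) (k t)].

(* The points u + beta (u - v), u, v in X: APG evaluates gradients only there.
   This set contains X, in general strictly. *)
Definition apg_domain : set 'cV[R]_n :=
  [set w | exists u v, [/\ Xset u, Xset v & w = u + apg_beta cq *: (u - v)]].

End Problem.

(* Main.v *)
Require Import Defs.
From mathcomp Require Import all_boot all_order all_algebra.
From mathcomp Require Import all_classical all_reals all_analysis.
From mathcomp Require Import ring lra zify.
Import Order.TTheory GRing.Theory Num.Theory.
Import numFieldNormedType.Exports.

Set Implicit Arguments.
Unset Strict Implicit.
Unset Printing Implicit Defensive.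

Local Open Scope classical_set_scope.
Local Open Scope ring_scope.

(** Write [mu = p - L], [d(lam, z)] for the dual function and [v(z)] for the
    Moreau envelope, [x(z)] for the minimizer in [v(z)] and [x~] for the
    minimizer over [X] of the proximal Lagrangian at the current centre and
    new multiplier. All the subproblems are [mu]-strongly convex.

    The multiplier step is a projected gradient step for [d(., z)], with the
    gradient [g(x~)] replaced by [g(x)]; it increases [d] by about
    [|lam' - lam|^2 / tau] ([dual_gain]). The step of the centre decreases
    [v] by about [p theta |x - z|^2] ([envv_step]) and changes the gap
    [v - d] by second-order terms ([gap_move]), except for a term in
    [|x - z| |x(z) - x~|]. The distance [|x(z) - x~|] is bounded by the dual
    residual: through the property that defines [R(delta)] when the residual
    is small, and through the Slater point when it is large
    ([center_drift]). The step size [theta] is such that what remains after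
    Young's inequality is a fraction of [theta eps^2]. Hence
    [v + (v - d) / 12] decreases by a multiple of [p theta |x - z|^2], up to
    the inner errors ([potential_step]).

    If [x] is not an [eps]-KKT point, then [eps^2] is at most a weighted sum
    of the squared tolerance, of [p^2 |x - z|^2] and of
    [|lam' - lam|^2 / tau] ([KKT_of_step]). If no iterate is one, summation
    over [T] iterations contradicts the size of [T]. The inner errors are
    the delicate point: a bound that merely adds them to the decrease of the
    potential is too large for the constant in [C_0]. So about the first
    [3 N / 20] iterations are discarded, where [N = mu / (p theta)]: the
    centre hardly moves during them, and [|lam|^2], which telescopes
    ([multiplier_growth]), bounds [|x - z|^2] and, when [N] is large, the
    gap. If [T] is small compared with [N], the telescoping of [|lam|^2]
    bounds [|x - z|^2] for the whole run. In each case the contradiction is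
    a system of linear inequalities between the quantities of the record
    [estimates], with rational coefficients ([estimates_absurd]).

    For the complexity, Nesterov's method contracts its energy by the factor
    [1 - sqrt q] ([energy_step]), and the projected gradient step from a
    nearly optimal point is approximately stationary
    ([candidate_stationary]). A call therefore stops after [O(ln (1 / tol))]
    iterations ([apg_stop_le]), where [tol >= c / T]. Since [theta(eps)] is
    of order [eps^(2 (d - 1))], the number [T] of calls, which is of order
    [1 / (theta eps^2)], is [O(eps^(- 2 d))] ([Titer_le]). *)

(** * Euclidean vectors *)

Section InnerProduct.
Context {R : realType} {n : nat}.
Implicit Types (u v w x y z : 'cV[R]_n) (a b : R).

Lemma dotvC u v : dotv u v = dotv v u.
Proof. by apply: eq_bigr => i _; rewrite mulrC. Qed.

Lemma dotvDl u v w : dotv (u + v) w = dotv u w + dotv v w.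
Proof. by rewrite -big_split; apply: eq_bigr => i _; rewrite mxE mulrDl. Qed.

Lemma dotvDr u v w : dotv u (v + w) = dotv u v + dotv u w.
Proof. by rewrite ![dotv u _]dotvC dotvDl. Qed.

Lemma dotvZl a u v : dotv (a *: u) v = a * dotv u v.
Proof. by rewrite mulr_sumr; apply: eq_bigr => i _; rewrite mxE mulrA. Qed.

Lemma dotvZr a u v : dotv u (a *: v) = a * dotv u v.
Proof. by rewrite dotvC dotvZl dotvC. Qed.

Lemma dotvNl u v : dotv (- u) v = - dotv u v.
Proof. by rewrite -scaleN1r dotvZl mulN1r. Qed.

Lemma dotvNr u v : dotv u (- v) = - dotv u v.
Proof. by rewrite dotvC dotvNl dotvC. Qed.

Lemma dotv0l u : dotv 0 u = 0.
Proof. by rewrite -(scale0r u) dotvZl mul0r. Qed.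

Lemma dotv0r u : dotv u 0 = 0.
Proof. by rewrite dotvC dotv0l. Qed.

Definition dotvE := (dotvDl, dotvDr, dotvNl, dotvNr, dotvZl, dotvZr).

Lemma dotv_ge0 u : 0 <= dotv u u.
Proof. by apply: sumr_ge0 => i _; rewrite -expr2 sqr_ge0. Qed.

Lemma enorm_sqr u : enorm u ^+ 2 = dotv u u.
Proof. by rewrite sqr_sqrtr ?dotv_ge0. Qed.

Lemma enorm_ge0 u : 0 <= enorm u.
Proof. exact: sqrtr_ge0. Qed.

Lemma enorm0 : enorm (0 : 'cV[R]_n) = 0.
Proof. by rewrite /enorm dotv0l sqrtr0. Qed.

Lemma enormN u : enorm (- u) = enorm u.
Proof. by rewrite /enorm dotvNl dotvNr opprK. Qed.

Lemma enormC u v : enorm (u - v) = enorm (v - u).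
Proof. by rewrite -enormN opprB. Qed.

Lemma enormZ a u : enorm (a *: u) = `|a| * enorm u.
Proof.
by rewrite /enorm dotvZl dotvZr mulrA -expr2 sqrtrM ?sqr_ge0// sqrtr_sqr.
Qed.

Lemma enorm_eq0 u : enorm u = 0 -> u = 0.
Proof.
move=> u0; have := enorm_sqr u; rewrite u0 expr0n /= => /esym/eqP.
rewrite psumr_eq0; last by move=> i _; rewrite -expr2 sqr_ge0.
move=> /allP uu0; apply/matrixP => i j; rewrite !mxE (ord1 j).
by have := uu0 i (mem_index_enum i); rewrite -expr2 sqrf_eq0 => /eqP.
Qed.

Lemma dotv_le_enorm u v : dotv u v <= enorm u * enorm v.
Proof.
have [u0|u0] := eqVneq (enorm u) 0.
  by rewrite (enorm_eq0 u0) dotv0l enorm0 mul0r.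
have [v0|v0] := eqVneq (enorm v) 0.
  by rewrite (enorm_eq0 v0) dotv0r enorm0 mulr0.
have up : 0 < enorm u by rewrite lt_neqAle eq_sym u0 enorm_ge0.
have vp : 0 < enorm v by rewrite lt_neqAle eq_sym v0 enorm_ge0.
have := dotv_ge0 (enorm v *: u - enorm u *: v).
suff -> : dotv (enorm v *: u - enorm u *: v) (enorm v *: u - enorm u *: v) =
    2 * (enorm u * enorm v) * (enorm u * enorm v - dotv u v).
  by rewrite pmulr_rge0 ?subr_ge0// mulr_gt0// mulr_gt0.
by rewrite !dotvE (dotvC v u) -!enorm_sqr; ring.
Qed.

Lemma normr_dotv_le u v : `|dotv u v| <= enorm u * enorm v.
Proof.
by rewrite ler_norml dotv_le_enorm lerNl -dotvNl -(enormN u) dotv_le_enorm.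
Qed.

Lemma dotv_ge_enorm u v : - (enorm u * enorm v) <= dotv u v.
Proof. by have := normr_dotv_le u v; rewrite ler_norml => /andP[]. Qed.

Lemma enormD u v : enorm (u + v) <= enorm u + enorm v.
Proof.
rewrite -(@ler_pXn2r _ 2) ?nnegrE ?addr_ge0 ?enorm_ge0//.
rewrite enorm_sqr !dotvE (dotvC v u) sqrrD -!enorm_sqr.
have := dotv_le_enorm u v; lra.
Qed.

Lemma enormB u v : enorm (u - v) <= enorm u + enorm v.
Proof. by rewrite -(enormN v) enormD. Qed.

Lemma enorm_triangle w u v : enorm (u - v) <= enorm (u - w) + enorm (w - v).
Proof. by rewrite -[u - v](subrKA w) enormD. Qed.

Lemma enormB_sqr u v : enorm (u - v) ^+ 2 =
  enorm u ^+ 2 - 2 * dotv u v + enorm v ^+ 2.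
Proof. by rewrite !enorm_sqr !dotvE (dotvC v u); ring. Qed.

Lemma enormD_sqr u v : enorm (u + v) ^+ 2 =
  enorm u ^+ 2 + 2 * dotv u v + enorm v ^+ 2.
Proof. by rewrite !enorm_sqr !dotvE (dotvC v u); ring. Qed.

Lemma enorm_coord_le u i : `|u i 0| <= enorm u.
Proof.
rewrite -sqrtr_sqr ler_wsqrtr// /dotv (bigD1 i)//= -expr2 lerDl.
by apply: sumr_ge0 => j _; rewrite -expr2 sqr_ge0.
Qed.

Lemma enorm_le_coord u v : (forall i, `|u i 0| <= `|v i 0|) ->
  enorm u <= enorm v.
Proof.
move=> uv; rewrite ler_wsqrtr//; apply: ler_sum => i _.
by rewrite -!expr2 -[leLHS]real_normK ?num_real// -[leRHS]real_normK ?num_real//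
  lerXn2r ?nnegrE.
Qed.

End InnerProduct.

Section DistTo.
Context {R : realType} {n : nat}.
Implicit Types (x y : 'cV[R]_n) (S : set 'cV[R]_n).

Let bounded_below x S : has_lbound [set enorm (x - y) | y in S].
Proof. by exists 0 => _ [y _ <-]; exact: enorm_ge0. Qed.

Lemma dist_to_le x S y : S y -> dist_to x S <= enorm (x - y).
Proof. by move=> Sy; apply: ge_inf => //; exists y. Qed.

Lemma dist_to_ge0 x S : 0 <= dist_to x S.
Proof.
have [[y Sy]|/nonemptyPn ->] := pselect (S !=set0); last first.
  by rewrite /dist_to image_set0 inf0.
by apply: lb_le_inf; [exists (enorm (x - y)), y|move=> _ [z _ <-]; exact: enorm_ge0].
Qed.

(** The infimum need not be attained, so a slack [eta] is spent to get a
    point of [S]. *)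
Lemma dist_to_approx x S (eps eta : R) : S !=set0 -> dist_to x S <= eps ->
  0 < eta -> exists2 y, S y & enorm (x - y) < eps + eta.
Proof.
move=> [y Sy] deps eta0.
have [] := @inf_adherent _ [set enorm (x - y) | y in S] eta eta0.
  by split; [exists (enorm (x - y)), y|].
move=> _ [z Sz <-] zlt; exists z => //; apply: lt_le_trans zlt _.
by rewrite lerD2r.
Qed.

Lemma dist_toD x v S : S !=set0 -> dist_to (x + v) S <= dist_to x S + enorm v.
Proof.
move=> S0; apply/ler_addgt0Pr => e e0.
have [y Sy ylt] := dist_to_approx S0 (lexx (dist_to x S)) e0.
apply: le_trans (dist_to_le _ Sy) _; rewrite addrAC.
by apply: le_trans (enormD _ _) _; lra.
Qed.

(** The cone contains 0. As the distance to the empty set is 0 by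
    convention, bounds on distances to the cone need this. *)
Lemma normal_cone0 S x : S x -> normal_cone S x !=set0.
Proof. by move=> Sx; exists 0; split=> // y _; rewrite dotv0l. Qed.

End DistTo.

(** * Calculus along segments *)

Section Calculus.
Context {R : realType} {n : nat}.
Implicit Types (h : 'cV[R]_n -> R) (u v x y : 'cV[R]_n).

Lemma derive_grad h x v : differentiable h x -> 'D_v h x = dotv (grad h x) v.
Proof.
move=> dh; rewrite deriveE//.
have {1}-> : v = \sum_i v i 0 *: delta_mx i 0.
  apply/matrixP => i j; rewrite summxE (ord1 j) (bigD1 i)//= !mxE !eqxx mulr1.
  by rewrite big1 ?addr0// => k ki; rewrite !mxE eq_sym (negbTE ki) mulr0.
rewrite linear_sum; apply: eq_bigr => i _.
by rewrite linearZ /= mxE deriveE// mulrC.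
Qed.

Lemma is_derive_line h x v (t : R) : (forall y, differentiable h y) ->
  is_derive t 1 (fun s : R => h (x + s *: v)) (dotv (grad h (x + t *: v)) v).
Proof.
move=> dh; have lineE : (fun k : R => k^-1 *: (((fun s : R => h (x + s *: v)) \o shift t) (k *: 1)
      - h (x + t *: v))) =
    (fun k : R => k^-1 *: ((h \o shift (x + t *: v)) (k *: v) - h (x + t *: v))).
  apply/funext => k /=; congr (_ *: (h _ - _)).
  by rewrite [k *: 1]mulr1 scalerDl addrCA.
have dv : derivable h (x + t *: v) v by apply: diff_derivable.
apply: DeriveDef; rewrite /derivable /derive lineE; first exact: dv.
exact: derive_grad.
Qed.

(** The mean value theorem for the difference between [h] along a segment
    and the quadratic [a s + b s^2 / 2]; one-sided bounds on the directional
    derivative thus integrate to second-order bounds, without integrals. *)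
Lemma line_mvt h x v (a b : R) : (forall y, differentiable h y) ->
  exists2 c : R, 0 < c < 1 & h (x + v) - h x - (a + b / 2) =
    dotv (grad h (x + c *: v)) v - (a + b * c).
Proof.
move=> dh.
pose k := (fun s : R => h (x + s *: v)) - ((fun s => a * s + b / 2 * s ^+ 2) : R -> R).
have dk (s : R) : is_derive s 1 k (dotv (grad h (x + s *: v)) v - (a + b * s)).
  apply: is_deriveB; first exact: is_derive_line.
  by apply: is_derive_eq; rewrite /= /GRing.scale /=; lra.
have kc : {within `[0, 1], continuous k}.
  apply: continuous_subspaceT => s.
  by apply/differentiable_continuous/derivable1_diffP; have [] := dk s.
have [c c01] := @MVT R k _ 0 1 ltr01 (fun s _ => dk s) kc.
have kE s : k s = h (x + s *: v) - (a * s + b / 2 * s ^+ 2) by [].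
rewrite subr0 mulr1 !kE scale1r scale0r addr0 => eq.
by exists c; [rewrite in_itv /= in c01|lra].
Qed.

Lemma line_le h x v (a b : R) : (forall y, differentiable h y) ->
  (forall c : R, 0 < c < 1 -> dotv (grad h (x + c *: v)) v <= a + b * c) ->
  h (x + v) - h x <= a + b / 2.
Proof.
move=> dh le_ab; have [c c01 eq] := line_mvt x v a b dh.
by have := le_ab c c01; lra.
Qed.

Lemma line_ge h x v (a b : R) : (forall y, differentiable h y) ->
  (forall c : R, 0 < c < 1 -> a + b * c <= dotv (grad h (x + c *: v)) v) ->
  a + b / 2 <= h (x + v) - h x.
Proof.
move=> dh ge_ab; have [c c01 eq] := line_mvt x v a b dh.
by have := ge_ab c c01; lra.
Qed.

(** Differentiability at [x] as two inequalities at one small step [k];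
    [k <= 1] keeps the point on a segment from [x]. *)
Lemma difference_quotient h x v (c d : R) : differentiable h x ->
  c < dotv (grad h x) v < d ->
  exists2 k : R, 0 < k <= 1 & h x + k * c < h (x + k *: v) < h x + k * d.
Proof.
move=> dh /andP[lt_c lt_d].
have dv : derivable h x v by apply: diff_derivable.
have := cvgr_gt _ dv; rewrite -/(derive h x v) derive_grad//.
move=> /(_ _ _ lt_c) /nbhs_ballP[e /= e0 near_e].
have := cvgr_lt _ dv; rewrite -/(derive h x v) derive_grad//.
move=> /(_ _ _ lt_d) /nbhs_ballP[e' /= e'0 near_e'].
pose k := Num.min (Num.min (e / 2) (e' / 2)) 1.
have k0 : 0 < k by rewrite !lt_min ltr01 andbT !divr_gt0.
have k1 : k <= 1 by rewrite ge_min lexx orbT.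
have kb : ball (0 : R) e k.
  rewrite /ball /= sub0r normrN gtr0_norm// /k !gt_min.
  by rewrite ltr_pdivrMr// mulr_natr mulr2n ltrDl e0.
have kb' : ball (0 : R) e' k.
  rewrite /ball /= sub0r normrN gtr0_norm// /k !gt_min.
  by rewrite [e' / 2 < e']ltr_pdivrMr// mulr_natr mulr2n ltrDl e'0 orbT.
have kn : k != 0 by rewrite gt_eqF.
exists k; first by rewrite k0.
have := near_e k kb kn; have := near_e' k kb' kn.
rewrite /= /GRing.scale /= (addrC x) ltr_pdivlMl// ltr_pdivrMl//.
by move=> h1 h2; apply/andP; split; lra.
Qed.

(** A difference quotient of a convex function decreases to the directional
    derivative, so the graph lies above its tangent planes. *)
Lemma convex_grad_le h x y : differentiable h x ->
  convex_function [set: convex_lmodType 'cV[R]_n] h ->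
  dotv (grad h x) (y - x) <= h y - h x.
Proof.
move=> dh cvx; rewrite leNgt; apply/negP => lt_hd.
have hd : h y - h x < dotv (grad h x) (y - x) < dotv (grad h x) (y - x) + 1.
  by rewrite lt_hd ltrDl ltr01.
have [k /andP[k0 k1] /andP[+ _]] := difference_quotient dh hd.
apply/negP; rewrite -leNgt.
suff : h (x + k *: (y - x)) <= k * h y + (1 - k) * h x by lra.
have -> : x + k *: (y - x) = k *: y + (1 - k) *: x.
  by rewrite scalerBr scalerBl scale1r addrCA.
have := cvx (Itv01 (ltW k0) k1) y x; rewrite !inE /= => /(_ I I).
by rewrite convRE.
Qed.

(** Convexity of a set, in the form in which segments [x + s (y - x)] are
    used. *)
Definition segment_closed (S : set 'cV[R]_n) := forall x y (s : R),
  S x -> S y -> 0 <= s <= 1 -> S (x + s *: (y - x)).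

Lemma grad_lipschitz_le h S L x y : (forall x, differentiable h x) ->
  segment_closed S -> grad_lipschitz_on S L h -> S x -> S y ->
  h y <= h x + dotv (grad h x) (y - x) + L / 2 * enorm (y - x) ^+ 2.
Proof.
move=> dh Sc hL Sx Sy.
have := @line_le h x (y - x) (dotv (grad h x) (y - x)) (L * enorm (y - x) ^+ 2) dh.
rewrite (addrC x) subrK => lh; suff : h y - h x <= dotv (grad h x) (y - x) +
  L * enorm (y - x) ^+ 2 / 2 by lra.
apply: lh => c /andP[c0 c1].
have Sc' : S (x + c *: (y - x)) by apply: Sc => //; rewrite !ltW.
have := dotv_le_enorm (grad h (x + c *: (y - x)) - grad h x) (y - x).
rewrite dotvDl dotvNl; have := hL _ _ Sc' Sx.
rewrite addrAC subrr add0r enormZ gtr0_norm// => hc.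
have := ler_wpM2r (enorm_ge0 (y - x)) hc; rewrite expr2; lra.
Qed.

Lemma grad_lipschitz_ge h S L x y : (forall x, differentiable h x) ->
  segment_closed S -> grad_lipschitz_on S L h -> S x -> S y ->
  h x + dotv (grad h x) (y - x) - L / 2 * enorm (y - x) ^+ 2 <= h y.
Proof.
move=> dh Sc hL Sx Sy.
have := @line_ge h x (y - x) (dotv (grad h x) (y - x)) (- (L * enorm (y - x) ^+ 2)) dh.
rewrite (addrC x) subrK => lh; suff : dotv (grad h x) (y - x) +
  - (L * enorm (y - x) ^+ 2) / 2 <= h y - h x by lra.
apply: lh => c /andP[c0 c1].
have Sc' : S (x + c *: (y - x)) by apply: Sc => //; rewrite !ltW.
have := dotv_ge_enorm (grad h (x + c *: (y - x)) - grad h x) (y - x).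
rewrite dotvDl dotvNl; have := hL _ _ Sc' Sx.
rewrite addrAC subrr add0r enormZ gtr0_norm// => hc.
have := ler_wpM2r (enorm_ge0 (y - x)) hc; rewrite expr2; lra.
Qed.
End Calculus.

Section Gradients.
Context {R : realType} {n : nat}.
Implicit Types (h : 'cV[R]_n -> R) (u v x y z d : 'cV[R]_n).

Lemma dotv_delta d i : dotv d (delta_mx i 0) = d i 0.
Proof.
rewrite /dotv (bigD1 i)//= mxE !eqxx mulr1 big1 ?addr0// => j ji.
by rewrite mxE (negbTE ji) mulr0.
Qed.

Lemma grad_unique h x d : (forall y, differentiable h y) ->
  (forall v, is_derive (0 : R) 1 (fun s : R => h (x + s *: v)) (dotv d v)) ->
  grad h x = d.
Proof.
move=> dh hd; apply/matrixP => i j; rewrite (ord1 j) -!dotv_delta.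
have := is_derive_line x (delta_mx i 0) 0 dh; rewrite scale0r addr0 => h1.
have h2 := hd (delta_mx i 0).
by rewrite -(@derive_val _ _ _ _ _ _ _ h1) (@derive_val _ _ _ _ _ _ _ h2).
Qed.

Lemma differentiable_sqdist z x :
  differentiable (fun y => enorm (y - z) ^+ 2) x.
Proof.
have -> : (fun y => enorm (y - z) ^+ 2) =
    \sum_(i < n) ((fun y : 'cV[R]_n => y i 0 - z i 0) * (fun y => y i 0 - z i 0)).
  apply/funext => y; rewrite enorm_sqr fct_sumE; apply: eq_bigr => i _.
  by rewrite !mxE.
apply: differentiable_sum => i.
have di : differentiable (fun y : 'cV[R]_n => y i 0 - z i 0) x.
  by apply: differentiableB; [exact: differentiable_coord|exact: differentiable_cst].
exact: differentiableM.
Qed.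

Lemma is_derive_sqdist z x v :
  is_derive (0 : R) 1 (fun s : R => enorm (x + s *: v - z) ^+ 2) (2 * dotv (x - z) v).
Proof.
rewrite (_ : (fun s => _) = fun s : R => enorm (x - z) ^+ 2 +
   (2 * dotv (x - z) v * s + enorm v ^+ 2 * s ^+ 2)).
  by apply: is_derive_eq; rewrite /= /GRing.scale /=; lra.
apply/funext => s; rewrite (addrAC x) (enormD_sqr (x - z)) dotvZr enormZ exprMn real_normK ?num_real//.
by ring.
Qed.

End Gradients.

Section Convexity.
Context {R : realType} {n : nat}.
Implicit Types (C : set 'cV[R]_n) (F : 'cV[R]_n -> R) (x y : 'cV[R]_n).

Definition strongly_convex C F (mu : R) := segment_closed C /\
  forall x y (s : R), C x -> C y -> 0 <= s <= 1 ->
    F (x + s *: (y - x)) <= (1 - s) * F x + s * F y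
      - mu / 2 * (s * (1 - s)) * enorm (y - x) ^+ 2.

(** Approximate optimality in the form in which it survives a change of the
    proximal centre: a first-order error [eps], then quadratic growth. *)
Definition eps_opt C F (mu eps : R) x := C x /\
  forall y, C y -> F x - eps * enorm (y - x) + mu / 2 * enorm (y - x) ^+ 2 <= F y.

(** The tangent inequality is used at the point of the segment, towards both
    ends. *)
Lemma strongly_convex_grad C F (G : 'cV[R]_n -> 'cV[R]_n) mu :
  segment_closed C ->
  (forall x y, C x -> C y ->
     F x + dotv (G x) (y - x) + mu / 2 * enorm (y - x) ^+ 2 <= F y) ->
  strongly_convex C F mu.
Proof.
move=> Cc hF; split=> // x y s Cx Cy /andP[s0 s1].
set w := x + s *: (y - x).
have Cw : C w by apply: Cc => //; rewrite s0.
have xw : x - w = - s *: (y - x) by rewrite /w opprD addrA subrr add0r scaleNr.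
have yw : y - w = (1 - s) *: (y - x).
  by rewrite /w opprD addrA scalerBl scale1r.
have := hF w x Cw Cx; have := hF w y Cw Cy.
rewrite xw yw !dotvZr !enormZ !exprMn !real_normK ?num_real// => hy hx.
have s1' : 0 <= 1 - s by rewrite subr_ge0.
have := ler_wpM2l s0 hy; have := ler_wpM2l s1' hx; lra.
Qed.

(** Strong convexity at [x + s (y - x)] gives the bound up to a factor
    [1 - s]; if it failed, [s] equal to half the relative defect would
    contradict minimality. *)
Lemma argmin_growth C F mu x y : 0 <= mu -> strongly_convex C F mu ->
  is_argmin C F x -> C y -> F x + mu / 2 * enorm (y - x) ^+ 2 <= F y.
Proof.
move=> mu0 [Cc hF] [Cx xmin] Cy; set e := mu / 2 * _.
have e0 : 0 <= e by rewrite mulr_ge0 ?divr_ge0// exprn_ge0 ?enorm_ge0.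
rewrite leNgt; apply/negP => lt_e; have Fxy := xmin _ Cy.
have ep : 0 < e by lra.
pose s := (e - (F y - F x)) / (2 * e).
have s0 : 0 < s by rewrite divr_gt0; lra.
have s1 : s <= 1 by rewrite /s ler_pdivrMr; lra.
have sI : 0 <= s <= 1 by rewrite ltW.
have := hF x y s Cx Cy sI; have := xmin _ (Cc x y s Cx Cy sI).
rewrite (_ : mu / 2 * _ * _ = s * ((1 - s) * e)); last by rewrite /e; ring.
move=> h1 h2; have : 0 <= s * (F y - F x - (1 - s) * e) by lra.
rewrite pmulr_rge0// (_ : (1 - s) * e = e - (e - (F y - F x)) / 2); first lra.
by rewrite /s; field; lra.
Qed.

(** A difference quotient from a minimizer towards a point of [C] is
    nonnegative. *)
Lemma argmin_normal C F x : differentiable F x -> segment_closed C ->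
  is_argmin C F x -> normal_cone C x (- grad F x).
Proof.
move=> dF Cc [Cx xmin]; split=> // y Cy; rewrite dotvNl oppr_le0 leNgt.
apply/negP => lt0; set v := y - x in lt0.
have hd : dotv (grad F x) v - 1 < dotv (grad F x) v < 0 by rewrite lt0 ltrBlDr ltrDl ltr01.
have [k /andP[k0 k1] /andP[_]] := difference_quotient dF hd.
rewrite mulr0 addr0; apply/negP; rewrite -leNgt; apply: xmin; apply: Cc => //.
by rewrite ltW.
Qed.

Lemma approx_stationary_opt C F mu eps x :
  (forall y, C y ->
     F x + dotv (grad F x) (y - x) + mu / 2 * enorm (y - x) ^+ 2 <= F y) ->
  approx_stationary C F eps x -> eps_opt C F mu eps x.
Proof.
move=> hF [Cx dx]; split=> // y Cy; apply/ler_addgt0Pr => e e0.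
pose d := enorm (y - x); have d0 : 0 <= d := enorm_ge0 _.
have eta0 : 0 < e / (d + 1) by rewrite divr_gt0//; lra.
have [v [_ vN] vlt] := dist_to_approx (normal_cone0 Cx) dx eta0.
have := dotv_le_enorm (- grad F x - v) (y - x).
have := ler_wpM2r d0 (ltW vlt); rewrite -/d.
have := vN _ Cy; rewrite !dotvDl !dotvNl.
have := hF _ Cy; rewrite -/d.
have : e / (d + 1) * d <= e.
  by rewrite mulrAC ler_pdivrMr; [rewrite ler_wpM2l// ?ltW//; lra|lra].
lra.
Qed.

Lemma exists_argmin C F : C !=set0 -> compact C -> continuous F ->
  exists x, is_argmin C F x.
Proof.
move=> C0 Cc Fc; have [x xC xmin] := compact_EVT_min C0 Cc (continuous_subspaceT Fc).
by exists x; split=> [|y Cy]; [exact: set_mem|apply: xmin; exact: mem_set].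
Qed.

End Convexity.

(** * Infima, norms and scalar inequalities *)

Section Generic.
Context {R : realType}.

Lemma inf_argmin n (C : set 'cV[R]_n) F x :
  is_argmin C F x -> inf [set F y | y in C] = F x.
Proof.
move=> [Cx xmin]; apply/eqP; rewrite eq_le; apply/andP; split.
  by apply: ge_inf; [exists (F x) => _ [y Cy <-]; exact: xmin|exists x].
by apply: lb_le_inf; [exists (F x), x|move=> _ [y Cy <-]; exact: xmin].
Qed.

(** A supremum bounds its set only if the set is bounded, which a
    Frobenius-type constant shows. *)
Lemma spectral_norm_le n m (M : 'M[R]_(n, m)) v :
  enorm (M *m v) <= spectral_norm M * enorm v.
Proof.
pose K := Num.sqrt (\sum_i enorm (\col_j M i j) ^+ 2).
have Mle u : enorm (M *m u) <= K * enorm u.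
  rewrite -[enorm u]ger0_norm ?enorm_ge0// -sqrtr_sqr -sqrtrM; last first.
    by apply: sumr_ge0 => i _; exact: sqr_ge0.
  rewrite ler_wsqrtr// mulr_suml; apply: ler_sum => i _.
  rewrite -expr2 -exprMn -[leLHS]real_normK ?num_real// lerXn2r ?nnegrE//.
    by rewrite mulr_ge0 ?enorm_ge0.
  rewrite mxE (_ : \sum_j _ = dotv (\col_j M i j) u) ?normr_dotv_le//.
  by apply: eq_bigr => j _; rewrite mxE.
have K0 : 0 <= K by exact: sqrtr_ge0.
have bnd : has_ubound [set enorm (M *m u) | u in [set u | enorm u <= 1]].
  exists K => _ [u u1 <-]; apply: le_trans (Mle u) _.
  by rewrite ler_piMr.
have [v0|v0] := eqVneq (enorm v) 0.
  by rewrite (enorm_eq0 v0) mulmx0 !enorm0 mulr0.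
have vp : 0 < enorm v by rewrite lt_neqAle eq_sym v0 enorm_ge0.
rewrite -ler_pdivrMr//; apply: ub_le_sup => //.
exists ((enorm v)^-1 *: v); last first.
  by rewrite -scalemxAr enormZ gtr0_norm ?invr_gt0// mulrC.
by rewrite /= enormZ gtr0_norm ?invr_gt0// mulVf.
Qed.

Lemma pospart_ge0 (a : R) : 0 <= pospart a.
Proof. by rewrite /pospart le_max lexx orbT. Qed.

Lemma pospart_cases (a : R) : a <= 0 /\ pospart a = 0 \/ 0 <= a /\ pospart a = a.
Proof.
case: (leP a 0) => a0; [left|right]; split=> //; rewrite ?ltW// /pospart.
  by rewrite max_r.
by rewrite max_l// ltW.
Qed.

Lemma young (a b k c : R) : 0 < c -> 0 < k ->
  a * b <= k * (c * b ^+ 2) + a ^+ 2 / c / (4 * k).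
Proof.
move=> c0 k0; rewrite -subr_ge0.
have -> : k * (c * b ^+ 2) + a ^+ 2 / c / (4 * k) - a * b =
    (2 * k * c * b - a) ^+ 2 / (4 * k * c) by field; rewrite !gt_eqF.
by rewrite divr_ge0 ?sqr_ge0// !mulr_ge0 ?ltW.
Qed.

(** Here [a^2 + q] is the increase of the dual function,
    [w = a^2 + 2 q + G^2] the squared dual residual and [e] the inner error.
    With [G <= D] and the two bounds on [q], each inequality says that a
    quadratic form is nonnegative. *)
Lemma gain_scalar (a G D e q : R) : 0 <= a -> 0 <= G -> G <= D -> 0 <= e ->
  - (a * G) <= q -> q <= 4 * e * D - 4 * D ^+ 2 ->
  [/\ (a ^+ 2 + 2 * q + G ^+ 2) / 6 + 3 / 8 * a ^+ 2 <= a ^+ 2 + q + 2 / 3 * e ^+ 2,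
      (a ^+ 2 + 2 * q + G ^+ 2) / 6 <= a ^+ 2 + q + 2 / 5 * e ^+ 2 &
      a ^+ 2 + 2 * q + G ^+ 2 <= a ^+ 2 + q + 4 / 3 * e ^+ 2].
Proof.
move=> a0 G0 GD e0 q1 q2.
have G2 : G ^+ 2 <= D ^+ 2 by rewrite lerXn2r ?nnegrE// (le_trans G0).
have Gle : G <= a / 4 + e.
  have [DE|Dn] := eqVneq D 0; first by move: GD; rewrite DE; lra.
  have D0 : 0 < D by rewrite lt_neqAle eq_sym Dn (le_trans G0).
  apply: (le_trans GD); rewrite -(ler_pM2l D0).
  have : a * G <= a * D by apply: ler_wpM2l.
  lra.
have k0 : 0 <= (a / 4 + e - G) * (a / 4 + e + G + 4 * a).
  by apply: mulr_ge0; lra.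
split.
- have := sqr_ge0 (3 * a - 4 * e); lra.
- have := sqr_ge0 (a - 4 / 7 * e); have := sqr_ge0 e; lra.
- have := sqr_ge0 (3 * D - 2 * e); lra.
Qed.

Lemma gain_scalar0 (a G D e q : R) : 0 <= a -> 0 <= G -> G <= D ->
  - (a * G) <= q -> q <= e - 2 * D ^+ 2 ->
  (a ^+ 2 + 2 * q + G ^+ 2) / 6 + 3 / 8 * a ^+ 2 <= a ^+ 2 + q + e / 2.
Proof.
move=> a0 G0 GD q1 q2.
have G2 : G ^+ 2 <= D ^+ 2 by rewrite lerXn2r ?nnegrE// (le_trans G0).
have : a * G <= a * D by apply: ler_wpM2l.
have := sqr_ge0 (a - 14 / 11 * D); have := sqr_ge0 D; lra.
Qed.

Lemma complementarity_scalar (t a b : R) : 0 < t -> 0 <= a ->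
  `|2^-1 * (a + pospart (a + t * b)) * b| * t <=
    `|(if pospart (a + t * b) == 0 then t * b / 2 else
       2^-1 * (a + pospart (a + t * b)))| * `|pospart (a + t * b) - a|.
Proof.
move=> t0 a0; have half : `|2^-1 : R| = 2^-1 by rewrite ger0_norm.
case: (pospart_cases (a + t * b)) => -[h ->].
  by rewrite eqxx addr0 sub0r normrN !normrM (ger0_norm a0) (gtr0_norm t0) half; lra.
case: eqP => [E|_].
  by rewrite E addr0 sub0r normrN !normrM (ger0_norm a0) (gtr0_norm t0) half; lra.
by rewrite (addrAC a) subrr add0r !normrM (gtr0_norm t0); lra.
Qed.

Lemma sin_le_self (y : R) : 0 <= y -> sin y <= y.
Proof.
rewrite le_eqVlt => /predU1P[<-|y0]; first by rewrite sin0.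
have dsin (s : R) : is_derive s 1 (@sin R) (cos s) by exact: is_derive_sin.
have csin : {within `[0, y], continuous (@sin R)}.
  by apply: continuous_subspaceT => s; exact: continuous_sin.
have [c _] := @MVT R (@sin R) cos 0 y y0 (fun s _ => dsin s) csin.
by rewrite sin0 !subr0 => ->; rewrite ler_piMl ?cos_le1// ltW.
Qed.

(** With [y = pi / 6], the formula for [cos (3 y)] gives
    [cos y ^ 2 = 3 / 4], so [1 - y^2 / 2 <= cos y <= 13 / 15]. *)
Lemma pi_sqr_ge : 48 / 5 <= pi ^+ 2 :> R.
Proof.
pose y : R := pi / 6; have y0 : 0 < y by rewrite divr_gt0// pi_gt0.
pose c := cos y.
have c0 : 0 < c.
  apply: cos_gt0_pihalf; have := pi_gt0 R; rewrite /y => p0.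
  by apply/andP; split; lra.
have c3 : c ^+ 2 = 3 / 4.
  have h : cos (y + (y + y)) = 0.
    by rewrite (_ : y + (y + y) = pi / 2) ?cos_pihalf// /y; lra.
  rewrite cosD cosD sinD -/c in h.
  have s2 : sin y ^+ 2 = 1 - c ^+ 2 by rewrite sin2cos2.
  have : c * (4 * c ^+ 2 - 3) = 0.
    have -> : c * (4 * c ^+ 2 - 3) = c * (c * c - sin y * sin y) - sin y * (sin y * c + c * sin y)
        + 3 * c * (sin y ^+ 2 - (1 - c ^+ 2)) by ring.
    by rewrite h s2 subrr mulr0 addr0.
  by move/eqP; rewrite mulf_eq0 gt_eqF//= => /eqP; lra.
have c2 : 1 - y ^+ 2 / 2 <= c.
  have -> : c = 1 - 2 * sin (y / 2) ^+ 2.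
    rewrite /c {1}(_ : y = y / 2 + y / 2); last by lra.
    rewrite cosD; have := cos2Dsin2 (y / 2); rewrite !expr2; lra.
  have y20 : 0 <= y / 2 by rewrite divr_ge0// ltW.
  have s0 : 0 <= sin (y / 2).
    apply: sin_ge0_pi; rewrite y20 /= /y; have := pi_gt0 R; lra.
  have : sin (y / 2) ^+ 2 <= (y / 2) ^+ 2 by rewrite lerXn2r ?nnegrE// sin_le_self.
  lra.
have c1 : c <= 13 / 15.
  rewrite -(@ler_pXn2r _ 2) ?nnegrE ?(ltW c0)//.
  by rewrite c3; lra.
by move: c2; rewrite /y; lra.
Qed.

(** The Cauchy-Schwarz inequality with weights. *)
Lemma cauchy3 (a b c w1 w2 w3 : R) : 0 < w1 -> 0 < w2 -> 0 < w3 ->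
  w1^-1 + w2^-1 + w3^-1 <= 1 ->
  (a + b + c) ^+ 2 <= w1 * a ^+ 2 + w2 * b ^+ 2 + w3 * c ^+ 2.
Proof.
move=> w10 w20 w30 hw; set S := a + b + c.
have sq w v : 0 < w -> 0 <= w * v ^+ 2 - 2 * v * S + S ^+ 2 / w.
  move=> w0; have -> : w * v ^+ 2 - 2 * v * S + S ^+ 2 / w = w * (v - S / w) ^+ 2.
    by field; rewrite gt_eqF.
  by rewrite mulr_ge0 ?sqr_ge0// ltW.
have := sq w1 a w10; have := sq w2 b w20; have := sq w3 c w30.
have := ler_wpM2l (sqr_ge0 S) hw; rewrite /S; lra.
Qed.

Lemma powR_le1 (e s : R) : 0 <= s -> 0 <= e <= 1 -> e `^ s <= 1.
Proof.
move=> s0 /andP[e0 e1]; have := ge0_ler_powR s0 e0 (ler01 : 1 \is Num.nneg) e1.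
by rewrite powR1.
Qed.

End Generic.

(** * Summing the estimates of the iterations *)

Section FiniteHorizon.
Context {R : realType}.

Lemma telescope_le (A b d : nat -> R) j k : (j <= k)%N ->
  (forall t, (j <= t < k)%N -> A t.+1 + d t <= A t + b t) ->
  A k + \sum_(j <= t < k) d t <= A j + \sum_(j <= t < k) b t.
Proof.
elim: k => [|k IH]; first by rewrite leqn0 => /eqP-> _; rewrite !big_geq// !addr0.
rewrite leq_eqVlt => /predU1P[<- _|]; first by rewrite !big_geq// !addr0.
rewrite ltnS => jk h; rewrite !big_nat_recr//=.
have h1 := h k; rewrite jk ltnSn in h1; have := h1 isT.
have : A k + \sum_(j <= t < k) d t <= A j + \sum_(j <= t < k) b t.
  by apply: IH => // t /andP[jt tk]; apply: h; rewrite jt ltnS ltnW.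
lra.
Qed.

Lemma sum_nat_le (f : nat -> R) j k j' k' : (forall t, 0 <= f t) ->
  (j' <= j)%N -> (k <= k')%N -> \sum_(j <= t < k) f t <= \sum_(j' <= t < k') f t.
Proof.
move=> f0 jj kk; have [jk|kj] := leqP j k; last first.
  by rewrite big_geq ?(ltnW kj)//; apply: sumr_ge0.
rewrite (big_cat_nat jj (leq_trans jk kk))//= (big_cat_nat jk kk)//=.
by rewrite [leRHS]addrCA lerDl addr_ge0// sumr_ge0.
Qed.

Lemma exists_le_average (f : nat -> R) j k b : (j < k)%N ->
  \sum_(j <= t < k) f t <= (k - j)%:R * b -> exists2 t, (j <= t < k)%N & f t <= b.
Proof.
move=> jk le_b; apply: contrapT => h.
have : (k - j)%:R * b < \sum_(j <= t < k) f t.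
  rewrite mulr_natl -sumr_const_nat; apply: ltr_sum_nat => // t tjk.
  by rewrite ltNge; apply/negP => ft; apply: h; exists t.
by rewrite ltNge le_b.
Qed.

Lemma sum_affine (f g : nat -> R) al be ga j k :
  \sum_(j <= t < k) (al * f t + be * g t + ga) =
  al * \sum_(j <= t < k) f t + be * \sum_(j <= t < k) g t + (k - j)%:R * ga.
Proof. by rewrite !big_split /= -!mulr_sumr sumr_const_nat mulr_natl. Qed.

Lemma sum_shift (f : nat -> R) j k : (0 < k)%N ->
  \sum_(j <= t < k.-1) f t.+1 = \sum_(j.+1 <= t < k) f t.
Proof. by move=> k0; rewrite -{2}(prednK k0) big_add1. Qed.

(** The integer [j0 + 1] is a quarter of [J + 1], rounded down. *)
Lemma quarter_window J : (10 <= J)%N ->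
  exists j0, [/\ (j0 < J)%N, (4 * j0.+1 <= J.+1)%N & (J.+1 <= 4 * j0.+1 + 3)%N].
Proof. by move=> J10; exists (J.+1 %/ 4).-1; split; lia. Qed.

(** * Inverse squares *)

Definition isq (t : nat) : R := t.+1%:R ^- 2.

Lemma isq_ge0 t : 0 <= isq t.
Proof. by rewrite invr_ge0 sqr_ge0. Qed.

(** A term is at most the increment of [- 1 / (t + 1 / 2)], as
    [(t + 1)^2 - 1 / 4 = (t + 1 / 2) (t + 3 / 2)]. *)
Lemma isq_tail j k : (j <= k)%N ->
  \sum_(j <= t < k) isq t <= (j%:R + 1 / 2)^-1 - (k%:R + 1 / 2)^-1.
Proof.
move=> jk; have := @telescope_le (fun t => (t%:R + 1 / 2)^-1) (fun=> 0) isq j k jk.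
rewrite big1_eq addr0 => h; rewrite lerBrDl; apply: h => t _.
rewrite /= addr0 -lerBrDl /isq -natr1.
have t0 : (0 : R) <= t%:R by exact: ler0n.
rewrite (_ : _ - _ = ((t%:R + 1) ^+ 2 - 1 / 4)^-1); last by field; rewrite !gt_eqF; nra.
by rewrite lef_pV2 ?posrE; nra.
Qed.

Lemma isq_sum_le j k : (j <= k)%N -> \sum_(0 <= t < k) isq t <=
  \sum_(0 <= t < j) isq t + (j%:R + 1 / 2)^-1.
Proof.
move=> jk; rewrite (big_cat_nat (leq0n j) jk)//= lerD2l.
have := isq_tail jk; have : 0 <= (k%:R + 1 / 2 : R)^-1.
  by rewrite invr_ge0 addr_ge0// divr_ge0.
lra.
Qed.

Lemma isq_tail_le j j0 k : (j0 <= j)%N -> \sum_(j <= t < k) isq t <= (j0%:R + 1 / 2)^-1.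
Proof.
move=> jj; have [jk|kj] := leqP j k; last first.
  by rewrite big_geq ?(ltnW kj)// invr_ge0 addr_ge0// divr_ge0.
apply: le_trans (isq_tail jk) _.
have : (j%:R + 1 / 2 : R)^-1 <= (j0%:R + 1 / 2)^-1.
  have : (j0%:R : R) <= j%:R by rewrite ler_nat.
  have : (0 : R) <= j0%:R by exact: ler0n.
  by move=> h1 h2; rewrite lef_pV2 ?posrE; lra.
have : 0 <= (k%:R + 1 / 2 : R)^-1 by rewrite invr_ge0 addr_ge0// divr_ge0.
lra.
Qed.

(** The terms with [t < 4] are added exactly; the tail gives [2 / 9]. *)
Lemma isq_sum_all k : \sum_(0 <= t < k) isq t <= 79 / 48.
Proof.
apply: (@le_trans _ _ (\sum_(0 <= t < k + 4) isq t)).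
  by apply: sum_nat_le; rewrite ?leq_addr//; exact: isq_ge0.
apply: le_trans (isq_sum_le (leq_addl k 4)) _.
have -> : (4%:R + 1 / 2 : R)^-1 = 2 / 9 by field.
by rewrite unlock /= /isq; lra.
Qed.

(** * The recursions *)

(** What the analysis retains of a run of [T] iterations, as numbers. The
    constants are [N = mu / (p theta)], [q = p / mu], [u = c^2 / mu],
    [m = (M^2 + 1) B^2 / mu^2], [E = eps^2 / mu], [D = phi^0 - flow]; thus
    [1 / (q N) = theta]. At iteration [t],

    [X = p |x' - z|^2], [V = v(z) - flow], [G = v(z) - d(lam, z)],
    [H = v(z) - d(lam', z)], [Lam = |lam|^2 / (2 tau)],
    [w = tau |residual|^2], [a = |lam' - lam|^2 / tau],
    [Y = p theta |x(z) - x~|^2], and [r], [c] are the products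
    [p theta |x' - z| |x(z) - x~|] and [p theta |x' - z| eps_t / mu], of
    which the squares are bounded; primes denote the values after the
    iteration. *)
Record estimates (T : nat) (N q u m E D : R) (X V G H Lam w a Y r c : nat -> R) : Prop := Estimates {
  est_T : (0 < T)%N;
  est_N : 18 <= N;
  est_q : 1 <= q;
  est_u : 0 < u;
  est_m : 0 <= m /\ m <= 3 / 2 * (q ^+ 2 * N);
  est_E : 0 < E;
  est_D : 0 <= D;
  est_budget : 32 / 5 * (u + u * m + u * q ^+ 2) + 48 * (q ^+ 2 * N * D) <= T%:R * E;
  est_pos : forall t, [/\ 0 <= X t, 0 <= V t, 0 <= G t, 0 <= H t & 0 <= Lam t] /\
             [/\ 0 <= w t, 0 <= a t & 0 <= Y t];
  est_V0 : V 0%N <= D;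
  est_Lam1 : Lam 1%N <= V 0%N / 4;
  est_X : forall t, (t < T)%N -> Lam t.+2 + X t / 2 <= Lam t.+1 + V t + 2 / 3 * (u * isq t);
  est_V : forall t eta, (t <= T)%N -> 0 < eta -> V t <= (1 + eta^-1) * V 0%N +
     (1 + eta) / 2 * ((q * N)^-1 ^+ 2 * (t%:R * \sum_(0 <= j < t) X j));
  est_H : forall t, (t < T)%N -> H t.+1 + w t.+1 / 2 + Lam t.+2 <= Lam t.+1 + V t.+1 +
     2 / 3 * (6 / 5 * (u * isq t) + 6 / N * (X t / (q * N)));
  est_H0 : H 0%N + w 0%N / 6 + 3 / 8 * a 0%N <= D / 2;
  est_gain1 : forall t, (t < T)%N -> H t.+1 + w t.+1 / 6 + 3 / 8 * a t.+1 <= G t.+1 +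
     (6 / 5 * (u * isq t) + 6 / N * (X t / (q * N))) / 6;
  est_gain2 : forall t, (t < T)%N -> H t.+1 + w t.+1 / 6 <= G t.+1 +
     (6 / 5 * (u * isq t) + 6 / N * (X t / (q * N))) / 10;
  est_gain3 : forall t, (t < T)%N -> H t.+1 + w t.+1 <= G t.+1 +
     (6 / 5 * (u * isq t) + 6 / N * (X t / (q * N))) / 3;
  est_G : forall t, (t < T)%N -> G t.+1 <= H t + r t + X t / (q * N) / N;
  est_VS : forall t, (t < T)%N -> V t.+1 <= V t - 35 / 36 * (X t / (q * N)) + r t + c t;
  est_r : forall t, (t < T)%N -> r t ^+ 2 <= X t / (q * N) * Y t;
  est_c : forall t, (t < T)%N -> c t ^+ 2 <= X t / (q * N) * (u * isq t / N);
  est_Y : forall t, (t < T)%N -> Y t <= w t / 12 + (X t / (q * N) + u * isq t / N) / 72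
    + E / (288 * (N * q ^+ 2))
}.

Section Run.
Variables (T : nat) (N q u m E D : R) (X V G H Lam w a Y r c : nat -> R).
Hypothesis run : estimates T N q u m E D X V G H Lam w a Y r c.

Let s t := X t / (q * N).
Let e t := u * isq t.
Let e1 t := 6 / 5 * e t + 6 / N * s t.
Let eE := E / (N * q ^+ 2).
Let NN := q ^+ 2 * N * D.

Let N0 : 0 < N. Proof. by apply: lt_le_trans (est_N run). Qed.
Let q0 : 0 < q. Proof. by apply: lt_le_trans (est_q run). Qed.
Let qN0 : 0 < q * N. Proof. exact: mulr_gt0. Qed.
Let X0 t : 0 <= X t. Proof. by have [[]] := est_pos run t. Qed.
Let V0 t : 0 <= V t. Proof. by have [[]] := est_pos run t. Qed.
Let G0 t : 0 <= G t. Proof. by have [[]] := est_pos run t. Qed.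
Let H0 t : 0 <= H t. Proof. by have [[]] := est_pos run t. Qed.
Let Lam0 t : 0 <= Lam t. Proof. by have [[]] := est_pos run t. Qed.
Let w0 t : 0 <= w t. Proof. by have [_ []] := est_pos run t. Qed.
Let a0 t : 0 <= a t. Proof. by have [_ []] := est_pos run t. Qed.
Let Y0 t : 0 <= Y t. Proof. by have [_ []] := est_pos run t. Qed.
Let u0 : 0 < u. Proof. exact: est_u run. Qed.
Let s0 t : 0 <= s t. Proof. by rewrite divr_ge0// ltW. Qed.
Let e0 t : 0 <= e t. Proof. by rewrite mulr_ge0 ?isq_ge0// ltW. Qed.
Let e10 t : 0 <= e1 t.
Proof. by rewrite addr_ge0// mulr_ge0// ?divr_ge0// ltW. Qed.
Let eE0 : 0 < eE.
Proof. by rewrite divr_gt0 ?(est_E run)// mulr_gt0// exprn_gt0. Qed.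

(* [glra] solves a linear goal from its antecedents and a few facts of the section:
   the local context is large, and [lra] would take all of it into account. *)
Ltac drop_facts := repeat match goal with
  | H : is_true ?P |- _ => tryif first [constr_eq H N0 | constr_eq H q0
      | constr_eq H qN0 | constr_eq H u0 | constr_eq H eE0] then fail else clear H
  end.
Ltac glra := drop_facts; lra.

Let sumX j k := \sum_(j <= t < k) X t.
Let sume j k := \sum_(j <= t < k) e t.

Let sumX0 j k : 0 <= sumX j k. Proof. exact: sumr_ge0. Qed.
Let sume0 j k : 0 <= sume j k. Proof. exact: sumr_ge0. Qed.

Lemma sums_sumX j k : \sum_(j <= t < k) s t = sumX j k / (q * N).
Proof. by rewrite mulr_suml. Qed.

Lemma r_le t al : (t < T)%N -> 0 < al -> r t <= al * s t + Y t / (4 * al).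
Proof.
move=> tT al0; have h := est_r run tT; rewrite leNgt; apply/negP => lt_r.
have k0 : 0 <= al * s t + Y t / (4 * al).
  apply: addr_ge0 (mulr_ge0 (ltW al0) (s0 t)) (divr_ge0 (Y0 t) _).
  by rewrite mulr_ge0// ltW.
have : (al * s t + Y t / (4 * al)) ^+ 2 < r t ^+ 2 by rewrite ltrXn2r// (le_lt_trans k0).
have : (al * s t - Y t / (4 * al)) ^+ 2 = (al * s t + Y t / (4 * al)) ^+ 2 - s t * Y t.
  by field; rewrite gt_eqF.
have := sqr_ge0 (al * s t - Y t / (4 * al)); rewrite -/(s t) in h; lra.
Qed.

Lemma c_le t j : (t < T)%N -> 0 < j -> c t <= j * s t + e t / N / (4 * j).
Proof.
move=> tT al0; have h := est_c run tT; rewrite leNgt; apply/negP => lt_r.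
have k0 : 0 <= j * s t + e t / N / (4 * j).
  apply: addr_ge0 (mulr_ge0 (ltW al0) (s0 t)) (divr_ge0 (divr_ge0 (e0 t) (ltW N0)) _).
  by rewrite mulr_ge0// ltW.
have : (j * s t + e t / N / (4 * j)) ^+ 2 < c t ^+ 2 by rewrite ltrXn2r// (le_lt_trans k0).
have : (j * s t - e t / N / (4 * j)) ^+ 2 = (j * s t + e t / N / (4 * j)) ^+ 2 - s t * (e t / N).
  by field; rewrite !gt_eqF.
have := sqr_ge0 (j * s t - e t / N / (4 * j)); rewrite -/(s t) -/(e t) in h; lra.
Qed.

(** While [J] is small compared with [N], the centre stays close to [z^0],
    so the envelope stays comparable with [D]. *)
Lemma sumV_le J eta : (J <= T)%N -> 0 < eta ->
  \sum_(0 <= t < J) V t <= (1 + eta^-1) * (J%:R * D) +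
    (1 + eta) / 4 * ((J%:R / (q * N)) ^+ 2 * sumX 0 J).
Proof.
move=> JT eta0.
pose k := (1 + eta) / 2 * ((q * N)^-1 ^+ 2 * sumX 0 J).
have k0 : 0 <= k.
  by apply: mulr_ge0; [lra|apply: mulr_ge0 (sumX0 _ _); exact: sqr_ge0].
have kE : (1 + eta) / 4 * ((J%:R / (q * N)) ^+ 2 * sumX 0 J) = k * (J%:R ^+ 2 / 2).
  by rewrite /k; field; rewrite !gt_eqF.
have e1' : 0 <= 1 + eta^-1 by rewrite addr_ge0// invr_ge0 ltW.
apply: (@le_trans _ _ (\sum_(0 <= t < J) ((1 + eta^-1) * D + k * t%:R))).
  apply: ler_sum_nat => t /andP[_ tJ].
  apply: le_trans (est_V run (ltnW (leq_trans tJ JT)) eta0) _; apply: lerD.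
    by rewrite ler_wpM2l// (est_V0 run).
  pose b := (1 + eta) / 2 * (q * N)^-1 ^+ 2.
  have b0 : 0 <= b by apply: mulr_ge0 (sqr_ge0 _); lra.
  rewrite (_ : _ * _ = b * (t%:R * \sum_(0 <= j < t) X j)); last by rewrite /b; ring.
  rewrite (_ : k * t%:R = b * (t%:R * sumX 0 J)); last by rewrite /k /b; ring.
  apply: (ler_wpM2l b0); apply: ler_wpM2l; first exact: ler0n.
  by apply: sum_nat_le => //; exact: ltnW.
rewrite kE big_split /= sumr_const_nat subn0 -[X in X + _]mulr_natl mulrCA lerD2l.
rewrite -mulr_sumr ler_wpM2l//; elim: J {JT k k0 kE} => [|J IH].
  by rewrite big_geq// expr0n /= mul0r.
rewrite big_nat_recr//= -natr1; have := ler0n R J; nra.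
Qed.

(** [Lam] telescopes: a large [X] makes the multiplier shrink. *)
Lemma sumX_le J : (J <= T)%N ->
  sumX 0 J / 2 <= D / 4 + \sum_(0 <= t < J) V t + 2 / 3 * sume 0 J.
Proof.
move=> JT.
have hs t : (0 <= t < J)%N -> Lam t.+2 + X t / 2 <= Lam t.+1 + (V t + 2 / 3 * e t).
  by move=> /andP[_ tJ]; rewrite addrA; apply: (est_X run); exact: leq_trans JT.
have := @telescope_le (fun t => Lam t.+1) (fun t => V t + 2 / 3 * e t)
  (fun t => X t / 2) 0 J (leq0n J) hs.
rewrite big_split /= -mulr_suml -mulr_sumr -/(sumX 0 J) -/(sume 0 J).
have := est_Lam1 run; have := est_V0 run; have := Lam0 J.+1; lra.
Qed.

(** * The gap along the run *)

Lemma e1_sum j k : \sum_(j <= t < k) e1 t = 6 / 5 * sume j k + 6 / N * (sumX j k / (q * N)).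
Proof. by rewrite -sums_sumX /sume !mulr_sumr -big_split. Qed.

Lemma Y_le t : (t < T)%N -> Y t <= w t / 12 + (s t + e t / N) / 72 + eE / 288.
Proof.
move=> tT; apply: le_trans (est_Y run tT) _; rewrite -/(s t) -/(e t) lerD2l /eE.
have -> : E / (288 * (N * q ^+ 2)) = E / (N * q ^+ 2) / 288 by field; rewrite !gt_eqF.
exact: lexx.
Qed.

Lemma G_stepH t : (t < T)%N ->
  G t.+1 <= H t + w t / 6 + (11 / 72 + N^-1) * s t + e t / N / 36 + eE / 144.
Proof.
move=> tT; have := est_G run tT; have := Y_le tT; rewrite -/(s t).
have k0 : (0 : R) < 1 / 8 by lra.
have := r_le tT k0; rewrite (_ : 4 * (1 / 8) = 1 / 2 :> R); last by lra.
lra.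
Qed.

Lemma G_step t : (t.+1 < T)%N ->
  G t.+2 <= G t.+1 + e1 t / 10 + (11 / 72 + N^-1) * s t.+1 + e t.+1 / N / 36 + eE / 144.
Proof.
move=> tT; have := G_stepH tT; have := est_gain2 run (ltnW tT).
rewrite -/(s t) -/(e t) -/(e1 t); lra.
Qed.

(** The gap cannot grow by much: in each iteration the dual gain pays for
    the [w]-part of the drift. *)
Lemma G_chain i J : (i <= J < T)%N ->
  G J.+1 <= H i + w i / 6 + (6 / 5 * sume i J + 6 / N * (sumX i J / (q * N))) / 10
    + (11 / 72 + N^-1) * (sumX i J.+1 / (q * N)) + sume i J.+1 / N / 36
    + (J.+1 - i)%:R * eE / 144.
Proof.
rewrite -e1_sum -sums_sumX; elim: J => [|J IH] /andP[].
  rewrite leqn0 => /eqP-> T0; rewrite /sume big_geq// !big_nat1 mul0r addr0 subn0.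
  by have := G_stepH T0; lra.
rewrite leq_eqVlt => /predU1P[->|iJ] JT.
  rewrite /sume big_geq// !big_nat1 mul0r addr0 subSnn.
  by have := G_stepH JT; lra.
have := IH; rewrite -ltnS iJ (ltnW JT) => /(_ isT).
rewrite !(@big_nat_recr _ _ _ J.+1 i) ?(ltnW iJ)//=.
rewrite /sume [\sum_(i <= t < J.+2) e t]big_nat_recr ?(ltnW iJ)//=.
rewrite [\sum_(i <= t < J.+1) e1 t]big_nat_recr//=.
rewrite (subSn (ltnW iJ)) -natr1.
have := G_step JT; lra.
Qed.

(** The telescoping of [Lam] bounds the gap after the multiplier step on
    average over a window, whatever its value at the start. *)
Lemma window_average j0 J : (j0.+1 <= J < T)%N ->
  \sum_(j0 <= t < J) (H t.+1 + w t.+1 / 6) <= D / 4 + \sum_(0 <= t < J.+1) V t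
    + 2 / 3 * (6 / 5 * sume 0 J + 6 / N * (sumX 0 J / (q * N))).
Proof.
move=> /andP[jJ JT].
have h1 t : (0 <= t < j0)%N -> Lam t.+2 + 0 <= Lam t.+1 + (V t + 2 / 3 * e t).
  move=> /andP[_ tj]; have tT : (t < T)%N.
    by apply: ltn_trans tj (ltn_trans _ JT).
  by have := est_X run tT; have := X0 t; rewrite -/(e t); lra.
have h2 t : (j0 <= t < J)%N -> Lam t.+2 + (H t.+1 + w t.+1 / 6) <=
    Lam t.+1 + (V t.+1 + 2 / 3 * e1 t).
  move=> /andP[_ tJ]; have tT : (t < T)%N by exact: ltn_trans JT.
  by have := est_H run tT; have := w0 t.+1; rewrite -/(e t) -/(s t) -/(e1 t); lra.
have h4 : Lam j0.+1 <= Lam 1%N + (\sum_(0 <= t < j0) V t + 2 / 3 * sume 0 j0).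
  rewrite /sume mulr_sumr -big_split /=.
  have := @telescope_le (fun t => Lam t.+1) _ (fun=> 0) 0 j0 (leq0n j0) h1.
  by rewrite big1_eq addr0.
have h3 : Lam J.+1 + \sum_(j0 <= t < J) (H t.+1 + w t.+1 / 6) <= Lam j0.+1 +
   (\sum_(j0 <= t < J) V t.+1 + 2 / 3 * \sum_(j0 <= t < J) e1 t).
  rewrite mulr_sumr -[\sum_(_ <= _ < _) V _ + _]big_split /=.
  exact: (@telescope_le (fun t => Lam t.+1) _ _ j0 J (ltnW jJ) h2).
have h5 : \sum_(j0 <= t < J) e1 t <= 6 / 5 * sume j0 J + 6 / N * (sumX 0 J / (q * N)).
  rewrite e1_sum lerD2l ler_wpM2l ?divr_ge0 ?(ltW N0)//.
  rewrite ler_pM2r ?invr_gt0//; exact: sum_nat_le.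
have h6 : \sum_(0 <= t < j0) V t + \sum_(j0 <= t < J) V t.+1 <= \sum_(0 <= t < J.+1) V t.
  have -> : \sum_(j0 <= t < J) V t.+1 = \sum_(j0.+1 <= t < J.+1) V t by rewrite big_add1.
  rewrite (@big_cat_nat _ _ _ j0 0 J.+1)//= ?lerD2l; last by rewrite ltnW// ltnW.
  exact: sum_nat_le.
have h7 : sume 0 j0 + sume j0 J = sume 0 J.
  by rewrite /sume (@big_cat_nat _ _ _ j0 0 J)// ltnW.
have := est_Lam1 run; have := est_V0 run; have := Lam0 J.+1.
have := sume0 0 j0; lra.
Qed.

(** * The potential [V + G / 12] *)

(** The motion of the centre costs [r] in [V] and [r / 12] in the potential
    through [G]; Young's inequality turns the sum into [169 / 576] of [s]
    and [Y], and the part [w / 12] of [Y] is what the gain in [G / 12]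
    returns. *)
Lemma potential_step t j : (t.+1 < T)%N -> 0 < j ->
  V t.+2 + G t.+2 / 12 + (35 / 36 - 169 / 576 - 1 / 72 - (12 * N)^-1 - j) * s t.+1 <=
  V t.+1 + G t.+1 / 12 + (e1 t / 36 + (1 / 72 + (4 * j)^-1) * (e t.+1 / N) + eE / 288).
Proof.
move=> tT j0; have := est_VS run tT; have := est_G run tT.
have := est_gain3 run (ltnW tT); have := c_le tT j0; have := Y_le tT.
(* [13 / 12 * r <= 169 / 576 * s + Y] *)
have k0 : (0 : R) < 13 / 48 by lra.
have := r_le tT k0; rewrite (_ : 4 * (13 / 48) = 13 / 12 :> R); last by lra.
rewrite -/(s t) -/(s t.+1) -/(e t) -/(e1 t) (invfM 12 N) (mulrC 12^-1 N^-1).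
lra.
Qed.

Lemma potential_sum J j : (J.+1 < T)%N -> 0 < j ->
  (35 / 36 - 169 / 576 - 1 / 72 - (4 * N)^-1 - j) * (sumX J.+1 T / (q * N)) <=
  V J.+1 + G J.+1 / 12 + 1 / 30 * sume J T + (1 / 72 + (4 * j)^-1) * (sume J.+1 T / N)
    + (T - J.+1)%:R * eE / 288 + sumX 0 J.+1 / (q * N) / (6 * N).
Proof.
move=> JT j0; set cs := 35 / 36 - _ - _; set K := 1 / 72 + _.
have hT : T = T.-1.+1 by rewrite prednK// (est_T run).
have JT' : (J <= T.-1)%N by rewrite -ltnS -hT ltnW.
have T0 := est_T run.
have h : V T + G T / 12 + (cs - (12 * N)^-1 - j) * (sumX J.+1 T / (q * N)) <=
   V J.+1 + G J.+1 / 12 + (1 / 36 * (6 / 5 * sume J T.-1 + 6 / N * (sumX J T.-1 / (q * N)))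
     + K / N * sume J.+1 T + (T - J.+1)%:R * (eE / 288)).
  rewrite -e1_sum -sums_sumX /sume -!(sum_shift _ J T0) [in (T - _)%:R]hT subSS.
  rewrite -sum_affine mulr_sumr {1 2}hT.
  apply: (@telescope_le (fun t => V t.+1 + G t.+1 / 12)) => // t /andP[_ tT].
  have tT' : (t.+1 < T)%N by rewrite hT ltnS.
  by have := potential_step tT' j0; rewrite /cs /K; lra.
have h1 : sume J T.-1 <= sume J T by apply: sum_nat_le => //; exact: leq_pred.
have h2 : sumX J T.-1 <= sumX 0 J.+1 + sumX J.+1 T.
  have -> : sumX 0 J.+1 + sumX J.+1 T = sumX 0 T by rewrite /sumX -big_cat_nat// ltnW.
  by apply: sum_nat_le => //; exact: leq_pred.
have h3 : sumX J T.-1 / (q * N) <= sumX 0 J.+1 / (q * N) + sumX J.+1 T / (q * N).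
  by rewrite -mulrDl ler_pM2r ?invr_gt0.
have h4 : 6 / N * (sumX J T.-1 / (q * N)) <= 6 / N * (sumX 0 J.+1 / (q * N) + sumX J.+1 T / (q * N)).
  by rewrite ler_wpM2l// divr_ge0// ltW.
have := V0 T; have := G0 T; move: h4 h.
rewrite !invfM (mulrC 12^-1) (mulrC 4^-1 N^-1) (mulrC 6^-1 N^-1); lra.
Qed.

(** * The multiplier increments *)

(** As [G_stepH], with more of [s] and less of [eE]. *)
Lemma a_stepH t : (t < T)%N -> G t.+1 <= H t + w t / 6 + (3 / 16 + N^-1) * s t
   + e t / N / 48 + eE / 192.
Proof.
move=> tT; have := est_G run tT; have := Y_le tT; rewrite -/(s t).
have k0 : (0 : R) < 1 / 6 by lra.
have := r_le tT k0; rewrite (_ : 4 * (1 / 6) = 2 / 3 :> R); last by lra.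
have := w0 t; lra.
Qed.

Lemma a_sum J : (J < T)%N ->
  3 / 8 * \sum_(J.+1 <= t < T.+1) a t <= G J.+1 + 1 / 5 * sume J T
    + (3 / 16 + 2 / N) * (sumX J.+1 T / (q * N)) + sumX 0 J.+1 / (q * N) / N
    + sume J.+1 T / N / 48 + (T - J.+1)%:R * eE / 192.
Proof.
move=> JT.
have hT : T = T.-1.+1 by rewrite prednK// (est_T run).
have JT' : (J <= T.-1)%N by rewrite -ltnS -hT.
have T0 := est_T run.
have h : G T + 3 / 8 * \sum_(J.+1 <= t < T) a t <= G J.+1 +
   (1 / 6 * \sum_(J <= t < T.-1) e1 t + 1 * \sum_(J <= t < T.-1)
       ((3 / 16 + N^-1) * s t.+1 + (48 * N)^-1 * e t.+1 + 0)
     + (T - J.+1)%:R * (eE / 192)).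
  rewrite [in (T - _)%:R]hT subSS -sum_affine -(sum_shift _ J T0) mulr_sumr {1}hT.
  apply: (@telescope_le (fun t => G t.+1)) => // t /andP[_ tT].
  have tT' : (t.+1 < T)%N by rewrite hT ltnS.
  have := a_stepH tT'; have := est_gain1 run (ltnW tT').
  rewrite -/(s t) -/(e t) -/(e1 t) (invfM 48); lra.
rewrite sum_affine mulr0 addr0 (sum_shift s J T0) sums_sumX (sum_shift e J T0) -/(sume J.+1 T) in h.
have h5 : 3 / 8 * a T <= G T + 1 / 6 * e1 T.-1.
  have := @est_gain1 _ _ _ _ _ _ _ _ _ _ _ _ _ _ _ _ _ run T.-1; rewrite -hT leqnn => /(_ isT).
  rewrite -/(s _) -/(e _) -/(e1 _); have := H0 T; have := w0 T; lra.
have h6 : \sum_(J <= t < T.-1) e1 t + e1 T.-1 = 6 / 5 * sume J T + 6 / N * (sumX J T / (q * N)).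
  by rewrite -e1_sum [in RHS]hT big_nat_recr.
have h2 : sumX J T <= sumX 0 J.+1 + sumX J.+1 T.
  have -> : sumX 0 J.+1 + sumX J.+1 T = sumX 0 T by rewrite /sumX -big_cat_nat// ltnW.
  exact: sum_nat_le.
have h3 : sumX J T / (q * N) <= sumX 0 J.+1 / (q * N) + sumX J.+1 T / (q * N).
  by rewrite -mulrDl ler_pM2r ?invr_gt0.
have h4 : 6 / N * (sumX J T / (q * N)) <= 6 / N * (sumX 0 J.+1 / (q * N) + sumX J.+1 T / (q * N)).
  by rewrite ler_wpM2l// divr_ge0// ltW.
rewrite (invfM 48) in h; rewrite big_nat_recr//=; lra.
Qed.

(** * Comparison with the budget *)

(** No iterate is an [eps]-KKT point. The stationarity residual of [x'] has
    three terms, which Cauchy-Schwarz separates with the weights [w1], [w2],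
    [w3]; the coefficient [17 / 4 m] accounts for feasibility and
    complementarity. *)
Hypothesis not_KKT : forall t w1 w2 w3, (t < T)%N -> 0 < w1 -> 0 < w2 -> 0 < w3 ->
  w1^-1 + w2^-1 + w3^-1 <= 1 ->
  E < w1 * (u * isq t) + w2 * (q * X t) + (w3 / 16 + 17 / 4 * m) * a t.+1.

(** The sum of [not_KKT] over [J <= t < T] against the budget. The sums of
    the [e t], [X t] and [a t] are bounded by combinations of [D], [u],
    [u q^2] and [T E]; [f] is the fraction of [T E] left when the terms in
    [T E] have been moved to the left, and the last hypotheses compare the
    remaining coefficients, one by one, with those of the budget. *)
Lemma budget_contra J t1 sD s1 sq sE aD an aE w1 w2 w3 k i0 f :
  (J < T)%N -> J%:R <= k * T%:R -> N^-1 <= i0 ->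
  [/\ 0 < w1, 0 < w2, 0 < w3 & w1^-1 + w2^-1 + w3^-1 <= 1] ->
  [/\ 0 <= sD, 0 <= aD, 0 <= an & 0 <= aE] ->
  sume J T <= t1 * u ->
  q * sumX J T <= sD * NN + s1 * u + sq * (u * q ^+ 2) + sE * (T%:R * E) ->
  \sum_(J.+1 <= t < T.+1) a t <= aD * D + an * u + aE * (T%:R * eE) ->
  f <= 1 - k - w2 * sE - (w3 * i0 / 16 + 51 / 8) * aE ->
  [/\ 0 <= f, w1 * t1 + w2 * (s1 + sq) + w3 * an / 16 <= 64 / 5 * f,
      w2 * sq <= 32 / 5 * f, 17 / 4 * an <= 32 / 5 * f &
      w2 * sD + (w3 * i0 / 16 + 51 / 8) * aD <= 48 * f] -> False.
Proof.
move=> JT Jk Ni [w10 w20 w30 winv] [sD0 aD0 an0 aE0] le_e le_X le_a fE [f0 c1 c2 c3 c4].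
have [m0 m1] := est_m run; have q1 := est_q run; have D0 := est_D run.
have E0 := est_E run; have bud := est_budget run.
have q2 : 1 <= q ^+ 2 by rewrite expr_ge1// ltW.
set A := \sum_(_ <= _ < _) _ in le_a.
have A0 : 0 <= A by exact: sumr_ge0.
have lt_sum : (T - J)%:R * E < w1 * sume J T + w2 * (q * sumX J T) + (w3 / 16 + 17 / 4 * m) * A.
  have -> : A = \sum_(J <= t < T) a t.+1 by rewrite /A big_add1.
  rewrite /sume /sumX !mulr_sumr -!big_split /= mulr_natl -sumr_const_nat.
  by apply: ltr_sum_nat => // t /andP[_ tT]; exact: not_KKT.
have TJ : (T - J)%:R = T%:R - J%:R :> R by rewrite natrB// ltnW.
pose TE := T%:R * E; have TE0 : 0 <= TE by rewrite mulr_ge0// ltW.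
have leTE : (1 - k) * TE <= (T - J)%:R * E.
  have h := ler_wpM2r (ltW E0) Jk; move: h; rewrite TJ /TE; glra.
have NN0 : 0 <= NN.
  by apply: mulr_ge0 => //; apply: mulr_ge0; [exact: sqr_ge0|exact: ltW].
have iN : 0 < N^-1 by rewrite invr_gt0.
have D_NN : D <= i0 * NN.
  have -> : D = N^-1 * (N * D) by rewrite mulKf// gt_eqF.
  have h1 : N * D <= NN.
    by rewrite /NN -mulrA ler_peMl// mulr_ge0// ltW.
  by apply: ler_pM => //; [exact: ltW|rewrite mulr_ge0// ltW].
have mD : m * D <= 3 / 2 * NN by have := ler_wpM2r D0 m1; rewrite /NN; glra.
have TEE : T%:R * eE = TE / (N * q ^+ 2) by rewrite /TE /eE; ring.
have q2N : 0 < N * q ^+ 2 by rewrite mulr_gt0// (lt_le_trans _ q2).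
have eE_TE : T%:R * eE <= i0 * TE.
  rewrite TEE invfM mulrA; apply: (@le_trans _ _ (TE / N)).
    by rewrite ler_pdivrMr ?ler_peMr ?divr_ge0 ?(ltW N0)// (lt_le_trans _ q2).
  by rewrite mulrC; apply: ler_wpM2r.
have mE : m * (T%:R * eE) <= 3 / 2 * TE.
  have h : m / (N * q ^+ 2) <= 3 / 2 by rewrite ler_pdivrMr// (mulrC N).
  by rewrite TEE; have := ler_wpM2r TE0 h; glra.
have h1 := ler_wpM2l (ltW w10) le_e; have h2 := ler_wpM2l (ltW w20) le_X.
have h3 : w3 / 16 * A <= w3 / 16 * (aD * (i0 * NN) + an * u + aE * (i0 * TE)).
  apply: ler_wpM2l; first by rewrite divr_ge0// ltW.
  apply: le_trans le_a _; have := ler_wpM2l aD0 D_NN; have := ler_wpM2l aE0 eE_TE; glra.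
have h4 : m * A <= aD * (3 / 2 * NN) + an * (u * m) + aE * (3 / 2 * TE).
  have := ler_wpM2l m0 le_a; have := ler_wpM2l aD0 mD; have := ler_wpM2l aE0 mE; glra.
have um0 : 0 <= u * m by rewrite mulr_ge0// ltW.
have uq : u <= u * q ^+ 2 by rewrite ler_peMr// ltW.
have b1 := ler_wpM2l f0 bud; rewrite -/NN -/TE in b1.
have g1 := ler_wpM2r um0 c3; have g2 := ler_wpM2r NN0 c4.
have g3 := ler_wpM2r (ltW u0) c1.
have uq0 : 0 <= u * q ^+ 2 - u by rewrite subr_ge0.
have g4 := ler_wpM2r uq0 c2.
rewrite -/TE in le_X h2; have g5 := ler_wpM2r TE0 fE.
move: lt_sum leTE h1 h2 h3 h4 b1 g1 g2 g3 g4 g5; glra.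
Qed.

(** Here [sumV_le] is used with [eta = 3]; then [(3 / 20)^2] of the sum of
    the [X t] is moved to the left. *)
Lemma sumX_early J Zp : (J <= T)%N -> J%:R <= 3 / 20 * N -> sume 0 J <= Zp * u ->
  191 / 400 * (sumX 0 J / N) <= ((4 * N)^-1 + 1 / 5) * D + 2 / 3 * Zp * (u / N).
Proof.
move=> JT JN le_e; have h1 := sumX_le JT.
have three : (0 : R) < 3 by lra.
have h2 := sumV_le JT three; rewrite (_ : (1 + 3) / 4 = 1 :> R) ?mul1r in h2; last by lra.
have q1 := est_q run.
have JqN : (J%:R / (q * N)) ^+ 2 <= 9 / 400.
  have -> : 9 / 400 = (3 / 20) ^+ 2 :> R by field.
  rewrite lerXn2r ?nnegrE ?divr_ge0 ?(ltW qN0)// ler_pdivrMr//.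
  by apply: le_trans JN _; rewrite ler_wpM2l// ler_peMl// ltW.
have h3 := ler_wpM2r (sumX0 0 J) JqN.
have h4 := ler_wpM2r (est_D run) JN.
have h5 : 191 / 400 * sumX 0 J <= D / 4 + N * D / 5 + 2 / 3 * Zp * u by lra.
have -> : ((4 * N)^-1 + 1 / 5) * D + 2 / 3 * Zp * (u / N) =
   (D / 4 + N * D / 5 + 2 / 3 * Zp * u) / N by field; rewrite gt_eqF.
by rewrite mulrA ler_pM2r// invr_gt0.
Qed.

Lemma sumX_early_le J i0 Zp SD Sn : (J <= T)%N -> J%:R <= 3 / 20 * N ->
  N^-1 <= i0 -> sume 0 J <= Zp * u ->
  i0 / 4 + 1 / 5 <= 191 / 400 * SD -> 2 / 3 * Zp <= 191 / 400 * Sn ->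
  sumX 0 J / N <= SD * D + Sn * (u / N).
Proof.
move=> JT JN Ni eZ SDle Snle; have h := sumX_early JT JN eZ.
have D0 := est_D run; have uN0 : 0 <= u / N by rewrite divr_ge0// ltW.
have h1 : ((4 * N)^-1 + 1 / 5) * D <= 191 / 400 * SD * D.
  apply: ler_wpM2r => //; apply: le_trans SDle.
  by rewrite invfM lerD2r mulrC ler_pM2r// invr_gt0.
have h2 := ler_wpM2r uN0 Snle; move: h h1 h2; glra.
Qed.

Lemma V_early J : (J <= T)%N -> J%:R <= 3 / 20 * N ->
  V J <= 4 / 3 * D + 3 / 10 * (sumX 0 J / N / q ^+ 2).
Proof.
move=> JT JN; have three : (0 : R) < 3 by lra.
have := est_V run JT three; rewrite -/(sumX 0 J) => /le_trans; apply.
have := est_V0 run; have k0 : 0 <= sumX 0 J / N / q ^+ 2.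
  by rewrite !divr_ge0 ?sqr_ge0// ltW.
have -> : (q * N)^-1 ^+ 2 * (J%:R * sumX 0 J) = J%:R / N * (sumX 0 J / N / q ^+ 2).
  by field; rewrite !gt_eqF.
have JN' : J%:R / N <= 3 / 20 by rewrite ler_pdivrMr.
have := ler_wpM2r k0 JN'; lra.
Qed.

Lemma sX_le J : sumX 0 J / (q * N) <= sumX 0 J / N.
Proof.
by rewrite ler_wpM2l// lef_pV2 ?posrE// ler_peMl ?(est_q run)// ltW.
Qed.

Lemma G_early J k : (J < T)%N -> J.+1%:R <= k * T%:R ->
  G J.+1 <= D / 2 + 3 / 25 * sume 0 J + (11 / 72 + 8 / 5 / N) * (sumX 0 J.+1 / N)
    + sume 0 J.+1 / N / 36 + k / 144 * (T%:R * eE).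
Proof.
move=> JT Jk.
have J0 : (0 <= J < T)%N by [].
have := G_chain J0; have := est_H0 run; have := a0 0%N; rewrite subn0.
have h1 := sX_le J.+1.
have h3 : sumX 0 J / (q * N) <= sumX 0 J.+1 / N.
  by apply: le_trans (sX_le J) _; rewrite ler_pM2r ?invr_gt0//; exact: sum_nat_le.
have h4 := ler_wpM2r (ltW eE0) Jk.
have c0 : 0 <= 11 / 72 + N^-1 by rewrite addr_ge0 ?invr_ge0 ?(ltW N0)//; lra.
have iN : 0 <= 6 / N by rewrite divr_ge0// ltW.
have h5 := ler_wpM2l c0 h1.
have h6 : 6 / N * (sumX 0 J / (q * N)) <= 6 / N * (sumX 0 J.+1 / N).
  by apply: ler_wpM2l.
lra.
Qed.

(** The bound of [G_early] contains a full [u], too much when [N] is large.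
    The smallest gap in the window [J / 4 <= t < J], whose length is of
    order [N], costs only [u / N]; from that index on [G_chain] applies. *)
Lemma G_window J : (10 <= J < T)%N -> J.+1%:R <= 3 / 20 * N ->
  (J.+1%:R : R) <= 1 / 4 * T%:R -> 3 / 20 * N <= J.+2%:R -> forall Zp : R,
  (forall k, sume 0 k <= Zp * u) -> N^-1 <= 3 / 220 ->
  G J.+1 <= (1 / 33 + 16 / 9) * D
    + (1 / 5 + 16 / 3 * (3 / 220) / 11 + 3 / 5 * (3 / 220) + 11 / 72 + 3 / 220) * (sumX 0 J.+1 / N)
    + (16 / 15 * Zp * (80 / 11) + 3 / 25 * (34 / 10) * (80 / 11) + Zp / 36) * (u / N)
    + 1 / 4 / 144 * (T%:R * eE).
Proof.
move=> /andP[J10 JT] JN Jk NJ Zp le_Z Ni.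
have [j0 [jJ n4n n4n']] := quarter_window J10.
set n := J.+1 in n4n n4n' *.
have wJ : (j0.+1 <= J < T)%N by rewrite jJ.
have n0 : (11 : R) <= n%:R by rewrite (ler_nat R 11 n).
set nR := n%:R in n0 JN Jk *.
have nR0 : 0 < nR by lra.
have avg := window_average wJ.
set W := D / 4 + _ + _ in avg.
have q1 := est_q run.
have SN := sX_le n.
have Sn0 : 0 <= sumX 0 n / N by rewrite divr_ge0// ltW.
have three : (0 : R) < 3 by lra.
have nT : (n <= T)%N by [].
have sV := sumV_le nT three; rewrite (_ : (1 + 3) / 4 = 1 :> R) ?mul1r in sV; last by lra.
have W0 : 0 <= W.
  apply: le_trans avg; apply: sumr_ge0 => t _; rewrite addr_ge0// divr_ge0//.
have [t tjJ le_t] : exists2 t, (j0 <= t < J)%N & H t.+1 + w t.+1 / 6 <= W / (3 / 4 * nR).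
  apply: exists_le_average => //; apply: le_trans avg _.
  have : 3 / 4 * nR <= (J - j0)%:R.
    rewrite natrB; last exact: ltnW.
    have : 4 * (j0.+1%:R : R) <= nR by rewrite -natrM ler_nat.
    rewrite /nR /n -(natr1 j0) -(natr1 J); lra.
  move=> h; apply: (@le_trans _ _ (3 / 4 * nR * (W / (3 / 4 * nR)))).
    by rewrite mulrCA divff ?mulr1// gt_eqF//; lra.
  by apply: ler_wpM2r => //; rewrite divr_ge0//; lra.
have /andP[jt tJ] := tjJ.
have tJT : (t.+1 <= J < T)%N by rewrite tJ.
have acc := G_chain tJT.
have le_e : sume t.+1 J <= u * (34 / 10 / nR).
  rewrite /sume -mulr_sumr; apply: ler_wpM2l; first exact: ltW.
  apply: le_trans (@sum_nat_le isq t.+1 J j0.+1 J isq_ge0 _ _) _ => //.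
  apply: le_trans (isq_tail jJ) _.
  have h1 : (j0.+1%:R + 1 / 2 : R)^-1 <= 44 / 10 / nR.
    have h : nR <= 4 * j0.+1%:R + 3 by rewrite -natrM -natrD ler_nat.
    rewrite -[leRHS]invrK invfM invrK lef_pV2 ?posrE; last 2 first.
    - by have := ler0n R j0.+1; lra.
    - by rewrite mulr_gt0//; lra.
    by lra.
  have h2 : 1 / nR <= (J%:R + 1 / 2)^-1.
    rewrite div1r lef_pV2 ?posrE//.
    by rewrite /nR /n -(natr1 J); lra.
  rewrite (_ : 34 / 10 / nR = 44 / 10 / nR - 1 / nR); first lra.
  by field; rewrite gt_eqF.
have NnR : N / nR <= 80 / 11.
  rewrite ler_pdivrMr//; move: NJ; rewrite -(natr1 J.+1) -/n -/nR; lra.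
have unR : u / nR <= 80 / 11 * (u / N).
  have -> : u / nR = N / nR * (u / N) by field; rewrite !gt_eqF.
  by apply: ler_wpM2r => //; rewrite divr_ge0// ltW.
have Zp0 : 0 <= Zp.
  have := le_trans (sume0 0 0) (le_Z 0%N); rewrite pmulr_lge0//.
have uN0 : 0 <= u / N by rewrite divr_ge0// ltW.
have nN : nR / N <= 3 / 20 by rewrite ler_pdivrMr.
have S0 : 0 <= sumX 0 n by [].
have sXn : sumX 0 J / (q * N) <= sumX 0 n / N.
  apply: le_trans (sX_le J) _; rewrite ler_pM2r ?invr_gt0//; exact: sum_nat_le.
have W_le : W / (3 / 4 * nR) <= (1 / 33 + 16 / 9) * D
   + (1 / 5 + 16 / 3 * (3 / 220) / 11) * (sumX 0 n / N) + 16 / 15 * Zp * (80 / 11) * (u / N).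
  have -> : W / (3 / 4 * nR) = (4 / 3) * (W / nR) by field; rewrite gt_eqF.
  have w1 : (nR / (q * N)) ^+ 2 * sumX 0 n <= nR * (nR / N * (sumX 0 n / N)).
    have -> : (nR / (q * N)) ^+ 2 * sumX 0 n = nR * (nR / N * (sumX 0 n / N)) / q ^+ 2.
      by field; rewrite !gt_eqF.
    rewrite ler_pdivrMr ?exprn_gt0//; apply: ler_peMr; last by rewrite expr_ge1// ltW.
    exact: mulr_ge0 (ltW nR0) (mulr_ge0 (divr_ge0 (ltW nR0) (ltW N0)) Sn0).
  have w2 : nR * (nR / N * (sumX 0 n / N)) <= nR * (3 / 20 * (sumX 0 n / N)).
    by apply: ler_wpM2l; [exact: ltW|apply: ler_wpM2r].
  have w3 : W <= D / 4 + (4 / 3 * (nR * D) + nR * (3 / 20 * (sumX 0 n / N)))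
      + 2 / 3 * (6 / 5 * (Zp * u) + 6 * (3 / 220) * (sumX 0 n / N)).
    have h1 : 6 / N * (sumX 0 J / (q * N)) <= 6 * (3 / 220) * (sumX 0 n / N).
      apply: ler_pM => //; [by rewrite divr_ge0// ltW|by rewrite divr_ge0// ltW|].
      by rewrite ler_wpM2l.
    have := le_Z J; move: sV w1 w2 h1; rewrite /W /nR /n; glra.
  have w4 : W / nR <= D / 4 / 11 + 4 / 3 * D + 3 / 20 * (sumX 0 n / N)
     + 4 / 5 * Zp * (80 / 11 * (u / N)) + 4 * (3 / 220) / 11 * (sumX 0 n / N).
    have i11 : nR^-1 <= 11^-1 by rewrite lef_pV2 ?posrE.
    have h := ler_wpM2r (ltW (_ : 0 < nR^-1)) w3.
    apply: le_trans (h _) _; first by rewrite invr_gt0.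
    have -> : (D / 4 + (4 / 3 * (nR * D) + nR * (3 / 20 * (sumX 0 n / N))) + 2 / 3 *
       (6 / 5 * (Zp * u) + 6 * (3 / 220) * (sumX 0 n / N))) / nR =
       D / 4 / nR + 4 / 3 * D + 3 / 20 * (sumX 0 n / N) + 4 / 5 * Zp * (u / nR) +
       4 * (3 / 220) * (sumX 0 n / N) / nR by field; rewrite !gt_eqF.
    have h1 := ler_wpM2l (divr_ge0 (est_D run) (ler0n R 4)) i11.
    have h2 := ler_wpM2l (mulr_ge0 (mulr_ge0 (ler0n R 4) (divr_ge0 (ler0n R 3) (ler0n R 220))) Sn0) i11.
    have h3 := ler_wpM2l (mulr_ge0 (divr_ge0 (ler0n R 4) (ler0n R 5)) Zp0) unR.
    by move: h1 h2 h3; glra.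
  by move: w4; glra.
have Jk' : (J.+1 - t.+1)%:R * eE <= 1 / 4 * (T%:R * eE).
  have -> : 1 / 4 * (T%:R * eE) = 1 / 4 * T%:R * eE by ring.
  apply: ler_wpM2r; first exact: ltW.
  by apply: le_trans Jk; rewrite ler_nat leq_subr.
have e36 : sume t.+1 J.+1 / N / 36 <= Zp / 36 * (u / N).
  have : sume t.+1 J.+1 <= Zp * u by apply: le_trans (le_Z J.+1); exact: sum_nat_le.
  by move=> h; have := ler_wpM2r (ltW (_ : 0 < N^-1)) h; rewrite invr_gt0 => /(_ N0); glra.
have s1 : 6 / N * (sumX t.+1 J / (q * N)) <= 6 * (3 / 220) * (sumX 0 n / N).
  apply: ler_pM => //; [by rewrite divr_ge0// ltW|by rewrite divr_ge0// ltW| |].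
    by rewrite ler_wpM2l.
  apply: le_trans sXn; rewrite ler_pM2r ?invr_gt0//; exact: sum_nat_le.
have s2 : (11 / 72 + N^-1) * (sumX t.+1 J.+1 / (q * N)) <= (11 / 72 + 3 / 220) * (sumX 0 n / N).
  apply: ler_pM => //.
  - by rewrite addr_ge0 ?invr_ge0 ?(ltW N0)//; lra.
  - by rewrite divr_ge0// ltW.
  - by rewrite lerD2l.
  by apply: le_trans SN; rewrite ler_pM2r ?invr_gt0//; exact: sum_nat_le.
have e1' : 6 / 5 * sume t.+1 J <= 6 / 5 * (34 / 10 * (80 / 11 * (u / N))).
  by move: le_e unR; rewrite mulrCA; glra.
rewrite -/n in acc *; move: acc le_t W_le Jk' e36 s1 s2 e1'; glra.
Qed.

(** The case of a long run: iterations up to [J], with [J + 1] about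
    [3 N / 20], are discarded. Numbers [i0] and [k] bound [1 / N] and
    [(J + 1) / T]; [Zp], [tl], [tlm], [tlms] bound the sums of the inner
    errors before and after [J]; [SD] and [Sn] are the coefficients of [D]
    and [u / N] in the bound on the discarded [X t], [gD] and [gn] those in
    a bound on the gap at [J + 1], and [gDa], [gnu] those of [D] and [u] in
    a second one; [sD], [s1], [sq], [sE] bound the later [X t], and [aD],
    [an], [aE] the later [a t]. *)
Lemma late_contra J i0 k j Zp SD Sn gD gDa gn gnu tl tlm tlms sD s1 sq sE aD an aE
    w1 w2 w3 cs ca f :
  (J.+1 < T)%N -> J.+1%:R <= 3 / 20 * N -> J.+1%:R <= k * T%:R -> N^-1 <= i0 -> 0 < j ->
  [/\ sume 0 J.+1 <= Zp * u, sume J.+1 T <= tl * u, sume J T <= tlm * u &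
      sume J T <= tlms * (u / N)] ->
  [/\ 0 <= SD, 0 <= Sn, i0 / 4 + 1 / 5 <= 191 / 400 * SD &
      2 / 3 * Zp <= 191 / 400 * Sn] ->
  G J.+1 <= gD * D + gn * (u / N) + k / 144 * (T%:R * eE) ->
  G J.+1 <= gDa * D + gnu * u + k / 144 * (T%:R * eE) ->
  cs <= 35 / 36 - 169 / 576 - 1 / 72 - i0 / 4 - j -> 0 < cs ->
  [/\ 4 / 3 + 3 / 10 * SD + gD / 12 + SD * i0 / 6 <= cs * sD,
      3 / 10 * Sn <= cs * s1,
      gn / 12 + tlms / 30 + (1 / 72 + (4 * j)^-1) * tl + Sn * i0 / 6 <= cs * sq &
      k / 1728 + 1 / 288 <= cs * sE] ->
  [/\ 0 <= sD, 0 <= s1, 0 <= sq & 0 <= sE] ->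
  3 / 16 + 2 * i0 <= ca ->
  [/\ 8 / 3 * (gDa + ca * sD + SD * i0) <= aD,
      8 / 3 * (gnu + tlm / 5 + ca * (s1 + sq) * i0 + tl * i0 / 48 + Sn * i0 * i0) <= an &
      8 / 3 * (k / 144 + 1 / 192 + ca * sE) <= aE] ->
  [/\ 0 <= aD, 0 <= an, 0 <= aE & 0 <= tl] ->
  [/\ 0 < w1, 0 < w2, 0 < w3 & w1^-1 + w2^-1 + w3^-1 <= 1] ->
  f <= 1 - k - w2 * sE - (w3 * i0 / 16 + 51 / 8) * aE ->
  [/\ 0 <= f, w1 * tl + w2 * (s1 + sq) + w3 * an / 16 <= 64 / 5 * f,
      w2 * sq <= 32 / 5 * f, 17 / 4 * an <= 32 / 5 * f &
      w2 * sD + (w3 * i0 / 16 + 51 / 8) * aD <= 48 * f] -> False.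
Proof.
move=> JT JN Jk Ni j0 [eZ el em ems] [SD0 Sn0 SDle Snle].
have q1 := est_q run; have D0 := est_D run; have E0 := est_E run.
have q2 : 1 <= q ^+ 2 by rewrite expr_ge1// ltW.
have iN : 0 < N^-1 by rewrite invr_gt0.
have i00 : 0 < i0 by exact: lt_le_trans Ni.
pose uN := u / N; have uN0 : 0 <= uN by rewrite divr_ge0// ltW.
pose TE := T%:R * eE; have TE0 : 0 <= TE by rewrite mulr_ge0// ltW.
have uNi : uN <= i0 * u by rewrite /uN mulrC; apply: ler_wpM2r => //; exact: ltW.
have SN : sumX 0 J.+1 / N <= SD * D + Sn * uN.
  exact: (sumX_early_le (ltnW JT) JN Ni eZ SDle Snle).
have SN0 : 0 <= sumX 0 J.+1 / N by rewrite divr_ge0// ltW.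
have sX := sX_le J.+1; have sX0 : 0 <= sumX 0 J.+1 / (q * N) by rewrite divr_ge0// ltW.
pose uq := uN / q ^+ 2.
have uq0 : 0 <= uq by rewrite divr_ge0// sqr_ge0.
have uquN : uq <= uN by rewrite /uq ler_pdivrMr ?exprn_gt0// ler_peMr.
have VJ : V J.+1 <= (4 / 3 + 3 / 10 * SD) * D + 3 / 10 * Sn * uq.
  apply: le_trans (V_early (ltnW JT) JN) _.
  have h : sumX 0 J.+1 / N / q ^+ 2 <= SD * D + Sn * uq.
    apply: (@le_trans _ _ ((SD * D + Sn * uN) / q ^+ 2)).
      by rewrite ler_pM2r// invr_gt0 exprn_gt0.
    have -> : (SD * D + Sn * uN) / q ^+ 2 = SD * D / q ^+ 2 + Sn * uq by rewrite /uq; ring.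
    rewrite lerD2r ler_pdivrMr ?exprn_gt0//; apply: ler_peMr => //; exact: mulr_ge0.
  lra.
have sXN : sumX 0 J.+1 / (q * N) / N <= i0 * (SD * D + Sn * uN).
  rewrite mulrC; apply: ler_pM => //; first exact: ltW.
  exact: le_trans sX SN.
have TJ : (T - J.+1)%:R * eE <= TE.
  by apply: ler_wpM2r; [exact: ltW|rewrite ler_nat leq_subr].
move=> gap1 gap2 csE cs0.
have elN : sume J.+1 T / N <= tl * uN.
  by rewrite /uN mulrA ler_pM2r.
move=> [c1 c2 c3 c4].
have sums : sumX J.+1 T / (q * N) <= sD * D + s1 * uq + sq * uN + sE * TE.
  have h := potential_sum JT j0.
  have h1 : cs * (sumX J.+1 T / (q * N)) <=
     (35 / 36 - 169 / 576 - 1 / 72 - (4 * N)^-1 - j) * (sumX J.+1 T / (q * N)).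
    apply: ler_wpM2r; first by rewrite divr_ge0// ltW.
    by move: Ni csE; rewrite invfM; glra.
  have K0 : 0 <= 1 / 72 + (4 * j)^-1.
    by rewrite addr_ge0// invr_ge0 mulr_ge0// ltW.
  have h2 := ler_wpM2l K0 elN.
  have h3 : sumX 0 J.+1 / (q * N) / (6 * N) <= i0 * (SD * D + Sn * uN) / 6.
    rewrite (_ : _ / (6 * N) = sumX 0 J.+1 / (q * N) / N / 6); last by field; rewrite !gt_eqF.
    by rewrite ler_pM2r.
  have b1 := ler_wpM2r D0 c1; have b2 := ler_wpM2r uq0 c2.
  have b3 := ler_wpM2r uN0 c3; have b4 := ler_wpM2r TE0 c4.
  rewrite -(ler_pM2l cs0); apply: le_trans h1 _.
  move: gap1 ems b1 b2 b3 b4 h2 h3 VJ TJ h; rewrite -/TE -/uN; glra.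
move=> {c1 c2 c3 c4} [sD0 s10 sq0 sE0] cE [a1 a2 a3] [aD0 an0 aE0 tl0].
have asum : \sum_(J.+2 <= t < T.+1) a t <= aD * D + an * u + aE * TE.
  have h := a_sum (ltnW JT).
  apply: (@le_trans _ _ (\sum_(J.+1 <= t < T.+1) a t)); first exact: sum_nat_le.
  have c0 : 0 <= 3 / 16 + 2 / N by rewrite addr_ge0 ?divr_ge0// ltW.
  have h1 : (3 / 16 + 2 / N) * (sumX J.+1 T / (q * N)) <= ca * (sD * D + s1 * uq + sq * uN + sE * TE).
    apply: ler_pM => //; first by rewrite divr_ge0// ltW.
    by move: Ni cE; glra.
  have cc0 : 0 <= ca by move: i00 cE; glra.
  have s1q : s1 * uq + sq * uN <= (s1 + sq) * (i0 * u).
    have h2 := ler_wpM2l s10 (le_trans uquN uNi); have h3 := ler_wpM2l sq0 uNi; move: h2 h3; glra.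
  have h2 := ler_wpM2l cc0 s1q.
  have h3 := ler_wpM2l Sn0 uNi; have h4 := ler_wpM2l (ltW i00) h3.
  have h5 := ler_wpM2l tl0 uNi.
  have b1 := ler_wpM2r D0 a1; have b2 := ler_wpM2r (ltW u0) a2; have b3 := ler_wpM2r TE0 a3.
  move: gap2 em h h1 sXN elN TJ h2 h3 h4 h5 b1 b2 b3; rewrite -/TE; glra.
move=> {a1 a2 a3} ws fE fs.
have XS : q * sumX J.+1 T <= sD * NN + s1 * u + sq * (u * q ^+ 2) + sE * (T%:R * E).
  have q2N : 0 < q ^+ 2 * N by rewrite mulr_gt0// exprn_gt0.
  have := ler_wpM2l (ltW q2N) sums.
  have -> : q ^+ 2 * N * (sumX J.+1 T / (q * N)) = q * sumX J.+1 T by field; rewrite !gt_eqF.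
  have -> : q ^+ 2 * N * (sD * D + s1 * uq + sq * uN + sE * TE) =
     sD * NN + s1 * u + sq * (u * q ^+ 2) + sE * (T%:R * E).
    by rewrite /NN /uq /uN /TE /eE; field; rewrite !gt_eqF.
  by [].
exact: (budget_contra JT Jk Ni ws _ el XS asum fE fs).
Qed.

Lemma sume_isq j k b : \sum_(j <= t < k) isq t <= b -> sume j k <= b * u.
Proof. by move=> h; rewrite /sume -mulr_sumr mulrC; apply: ler_wpM2r => //; exact: ltW. Qed.

(** All the sums of inner errors are bounded through [n0 <= J] and
    [J <= n1]; an [n1]-dependent bound on [N] turns [u] into a multiple of
    [u / N]. *)
Lemma early_bounds J n0 n1 i0 k Zp sJ SD Sn gD gn gnu tl tlm tlms :
  (J.+1 < T)%N -> (n0.+1 <= J.+1 <= n1.+1)%N -> J.+1%:R <= 3 / 20 * N ->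
  3 / 20 * N <= J.+2%:R -> J.+1%:R <= k * T%:R -> N^-1 <= i0 -> 0 < i0 ->
  \sum_(0 <= t < n1.+1) isq t <= Zp -> \sum_(0 <= t < n1) isq t <= sJ ->
  i0 / 4 + 1 / 5 <= 191 / 400 * SD -> 2 / 3 * Zp <= 191 / 400 * Sn -> 0 <= SD -> 0 <= Sn ->
  1 <= tl * (n0.+1%:R + 1 / 2) -> 1 <= tlm * (n0%:R + 1 / 2) -> 0 <= tlm ->
  tlm * n1.+2%:R * (20 / 3) <= tlms ->
  1 / 2 + (11 / 72 + 8 / 5 * i0) * SD <= gD ->
  3 / 25 * sJ * n1.+2%:R * (20 / 3) + (11 / 72 + 8 / 5 * i0) * Sn + Zp / 36 <= gn ->
  3 / 25 * sJ + ((11 / 72 + 8 / 5 * i0) * Sn + Zp / 36) * i0 <= gnu ->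
  [/\ [/\ sume 0 J.+1 <= Zp * u, sume J.+1 T <= tl * u, sume J T <= tlm * u &
      sume J T <= tlms * (u / N)],
   G J.+1 <= gD * D + gn * (u / N) + k / 144 * (T%:R * eE) &
   G J.+1 <= gD * D + gnu * u + k / 144 * (T%:R * eE)].
Proof.
move=> JT /andP[nJ Jn] JN NJ Jk Ni i00 leZ lesJ SDle Snle SD0 Sn0 htl htlm tlm0 htlms hgD hgn hgnu.
have D0 := est_D run; have iN : 0 < N^-1 by rewrite invr_gt0.
have eZ : sume 0 J.+1 <= Zp * u.
  by apply: sume_isq; apply: le_trans leZ; apply: sum_nat_le => //; exact: isq_ge0.
have eJ : sume 0 J <= sJ * u.
  by apply: sume_isq; apply: le_trans lesJ; apply: sum_nat_le => //; exact: isq_ge0.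
have sJ0 : 0 <= sJ by apply: le_trans lesJ; apply: sumr_ge0 => t _; exact: isq_ge0.
have Zp0 : 0 <= Zp by apply: le_trans leZ; apply: sumr_ge0 => t _; exact: isq_ge0.
have tlle : sume J.+1 T <= tl * u.
  apply: sume_isq; apply: le_trans (isq_tail_le _ nJ) _.
  by rewrite -div1r ler_pdivrMr// addr_gt0 ?divr_gt0// ltr0n.
have tlmle : sume J T <= tlm * u.
  apply: sume_isq; apply: le_trans (isq_tail_le _ (nJ : (n0 <= J)%N)) _.
  by rewrite -div1r ler_pdivrMr// ltr_wpDl// divr_gt0.
have NN1 : N <= n1.+2%:R * (20 / 3).
  have : (J.+2%:R : R) <= n1.+2%:R by rewrite ler_nat.
  by move: NJ; glra.
have uN0 : 0 < u / N by rewrite divr_gt0.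
have uE : u = N * (u / N) by rewrite mulrC divfK// gt_eqF.
have tlmsle : sume J T <= tlms * (u / N).
  apply: le_trans tlmle _.
  have -> : tlm * u = tlm * N * (u / N) by rewrite -mulrA -uE.
  rewrite ler_pM2r//.
  by apply: le_trans htlms; rewrite -mulrA; apply: ler_wpM2l.
have SN := sumX_early_le (ltnW JT) JN Ni eZ SDle Snle.
have h := G_early (ltnW JT) Jk.
have SN0 : 0 <= sumX 0 J.+1 / N by rewrite divr_ge0// ltW.
have h1 : (11 / 72 + 8 / 5 / N) * (sumX 0 J.+1 / N) <=
    (11 / 72 + 8 / 5 * i0) * (SD * D + Sn * (u / N)).
  apply: ler_pM => //; first by rewrite addr_ge0// ?divr_ge0// ltW.
  by rewrite lerD2l ler_wpM2l// divr_ge0.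
have h2 : sume 0 J.+1 / N / 36 <= Zp / 36 * (u / N).
  by have := ler_wpM2r (ltW iN) eZ; glra.
have h3 : sJ * u <= sJ * n1.+2%:R * (20 / 3) * (u / N).
  have -> : sJ * u = sJ * N * (u / N) by rewrite -mulrA -uE.
  rewrite ler_pM2r// -mulrA; exact: ler_wpM2l.
have h4 : u / N <= i0 * u by rewrite mulrC; apply: ler_wpM2r => //; exact: ltW.
have c0 : 0 <= (11 / 72 + 8 / 5 * i0) * Sn + Zp / 36.
  by rewrite addr_ge0 ?divr_ge0// mulr_ge0// addr_ge0 ?divr_ge0// mulr_ge0 ?divr_ge0// ltW.
have h5 := ler_wpM2l c0 h4.
have b1 := ler_wpM2r D0 hgD; have b2 := ler_wpM2r (ltW uN0) hgn.
have b3 := ler_wpM2r (ltW u0) hgnu.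
split=> //.
- move: h h1 h2 h3 b1 b2 eJ; glra.
- move: h h1 h2 h5 b1 b3 eJ; glra.
Qed.

(** In each of the following cases the bounds named in [late_contra] are
    computed one after the other from the range of [J + 1] and rounded up to
    short fractions; the weights [w1], [w2], [w3] are those for which the
    comparison with the budget holds. *)
Lemma late_2_2 J : (J.+1 < T)%N -> (2 <= J.+1 <= 2)%N -> J.+1%:R <= 3 / 20 * N ->
  3 / 20 * N <= J.+2%:R -> (J.+1%:R : R) <= (2 / 11) * T%:R -> False.
Proof.
move=> JT JJ JN NJ Jk.
have Ni : N^-1 <= (1 / 18).
  by rewrite -[leRHS]invrK lef_pV2 ?posrE ?invr_gt0//; have := est_N run; glra.
have [] := @early_bounds J 1 1 (1 / 18) (2 / 11) (5 / 4) 1 (142 / 317) (274 / 157) (191 / 314)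
  (20 / 7) (58 / 399) (2 / 5) (2 / 3) (40 / 3) JT JJ JN NJ Jk Ni.
all: try by [rewrite unlock /= /isq; glra | glra].
move=> bnd gap1 gap2.
by apply: (late_contra JT JN Jk Ni _ bnd _ gap1 gap2
  (i0 := (1 / 18)) (k := (2 / 11)) (j := (13 / 100)) (Zp := (5 / 4)) (SD := (142 / 317)) (Sn := (274 / 157))
  (gD := (191 / 314)) (gDa := (191 / 314)) (gn := (20 / 7)) (gnu := (58 / 399))
  (tl := (2 / 5)) (tlm := (2 / 3)) (tlms := (40 / 3))
  (sD := (263 / 90)) (s1 := (206 / 205)) (sq := (181 / 64)) (sE := (2 / 291))
  (aD := (257 / 64)) (an := (311 / 335)) (aE := (9 / 395)) (w1 := (355 / 76)) (w2 := (71 / 50)) (w3 := (184 / 15))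
  (cs := (161 / 309)) (ca := (43 / 144)) (f := (247 / 373))); (try split); (try split); glra.
Qed.

Lemma late_3_3 J : (J.+1 < T)%N -> (3 <= J.+1 <= 3)%N -> J.+1%:R <= 3 / 20 * N ->
  3 / 20 * N <= J.+2%:R -> (J.+1%:R : R) <= (1 / 4) * T%:R -> False.
Proof.
move=> JT JJ JN NJ Jk.
have Ni : N^-1 <= (1 / 20).
  have /andP[nJ _] := JJ; have : (3%:R : R) <= J.+1%:R by rewrite ler_nat.
  by move=> h; rewrite -[leRHS]invrK lef_pV2 ?posrE ?invr_gt0//; move: h JN; glra.
have [] := @early_bounds J 2 2 (1 / 20) (1 / 4) (49 / 36) (5 / 4) (85 / 191) (382 / 201) (67 / 111)
  (345 / 77) (67 / 385) (2 / 7) (2 / 5) (32 / 3) JT JJ JN NJ Jk Ni.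
all: try by [rewrite unlock /= /isq; glra | glra].
move=> bnd gap1 gap2.
by apply: (late_contra JT JN Jk Ni _ bnd _ gap1 gap2
  (i0 := (1 / 20)) (k := (1 / 4)) (j := (1 / 10)) (Zp := (49 / 36)) (SD := (85 / 191)) (Sn := (382 / 201))
  (gD := (67 / 111)) (gDa := (67 / 111)) (gn := (345 / 77)) (gnu := (67 / 385))
  (tl := (2 / 7)) (tlm := (2 / 5)) (tlms := (32 / 3))
  (sD := (223 / 81)) (s1 := (193 / 187)) (sq := (241 / 91)) (sE := (2 / 305))
  (aD := (223 / 59)) (an := (302 / 363)) (aE := (9 / 382)) (w1 := (261 / 40)) (w2 := (32 / 25)) (w3 := (153 / 10))
  (cs := (216 / 391)) (ca := (23 / 80)) (f := (85 / 144))); (try split); (try split); glra.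
Qed.

Lemma late_4_5 J : (J.+1 < T)%N -> (4 <= J.+1 <= 5)%N -> J.+1%:R <= 3 / 20 * N ->
  3 / 20 * N <= J.+2%:R -> (J.+1%:R : R) <= (1 / 4) * T%:R -> False.
Proof.
move=> JT JJ JN NJ Jk.
have Ni : N^-1 <= (3 / 80).
  have /andP[nJ _] := JJ; have : (4%:R : R) <= J.+1%:R by rewrite ler_nat.
  by move=> h; rewrite -[leRHS]invrK lef_pV2 ?posrE ?invr_gt0//; move: h JN; glra.
have [] := @early_bounds J 3 4 (3 / 80) (1 / 4) (161 / 110) (205 / 144) (139 / 317) (47 / 23) (124 / 209)
  (307 / 42) (10 / 53) (2 / 9) (2 / 7) (80 / 7) JT JJ JN NJ Jk Ni.
all: try by [rewrite unlock /= /isq; glra | glra].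
move=> bnd gap1 gap2.
by apply: (late_contra JT JN Jk Ni _ bnd _ gap1 gap2
  (i0 := (3 / 80)) (k := (1 / 4)) (j := (1 / 10)) (Zp := (161 / 110)) (SD := (139 / 317)) (Sn := (47 / 23))
  (gD := (124 / 209)) (gDa := (124 / 209)) (gn := (307 / 42)) (gnu := (10 / 53))
  (tl := (2 / 9)) (tlm := (2 / 7)) (tlms := (80 / 7))
  (sD := (71 / 26)) (s1 := (373 / 338)) (sq := (104 / 37)) (sE := (2 / 307))
  (aD := (329 / 93)) (an := (292 / 381)) (aE := (7 / 303)) (w1 := (288 / 43)) (w2 := (32 / 25)) (w3 := (101 / 7))
  (cs := (5 / 9)) (ca := (21 / 80)) (f := (111 / 187))); (try split); (try split); glra.
Qed.

Lemma late_6_8 J : (J.+1 < T)%N -> (6 <= J.+1 <= 8)%N -> J.+1%:R <= 3 / 20 * N ->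
  3 / 20 * N <= J.+2%:R -> (J.+1%:R : R) <= (1 / 4) * T%:R -> False.
Proof.
move=> JT JJ JN NJ Jk.
have Ni : N^-1 <= (1 / 40).
  have /andP[nJ _] := JJ; have : (6%:R : R) <= J.+1%:R by rewrite ler_nat.
  by move=> h; rewrite -[leRHS]invrK lef_pV2 ?posrE ?invr_gt0//; move: h JN; glra.
have [] := @early_bounds J 5 7 (1 / 40) (1 / 4) (362 / 237) (192 / 127) (165 / 382) (386 / 181) (7 / 12)
  (397 / 35) (16 / 83) (2 / 13) (2 / 11) (120 / 11) JT JJ JN NJ Jk Ni.
all: try by [rewrite unlock /= /isq; glra | glra].
move=> bnd gap1 gap2.
by apply: (late_contra JT JN Jk Ni _ bnd _ gap1 gap2
  (i0 := (1 / 40)) (k := (1 / 4)) (j := (1 / 10)) (Zp := (362 / 237)) (SD := (165 / 382)) (Sn := (386 / 181))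
  (gD := (7 / 12)) (gDa := (7 / 12)) (gn := (397 / 35)) (gnu := (16 / 83))
  (tl := (2 / 13)) (tlm := (2 / 11)) (tlms := (120 / 11))
  (sD := (214 / 79)) (s1 := (347 / 303)) (sq := (299 / 98)) (sE := (1 / 154))
  (aD := (33 / 10)) (an := (109 / 160)) (aE := (6 / 265)) (w1 := (391 / 39)) (w2 := (59 / 50)) (w3 := (400 / 21))
  (cs := (219 / 392)) (ca := (19 / 80)) (f := (89 / 149))); (try split); (try split); glra.
Qed.

Lemma late_9_10 J : (J.+1 < T)%N -> (9 <= J.+1 <= 10)%N -> J.+1%:R <= 3 / 20 * N ->
  3 / 20 * N <= J.+2%:R -> (J.+1%:R : R) <= (1 / 4) * T%:R -> False.
Proof.
move=> JT JJ JN NJ Jk.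
have Ni : N^-1 <= (1 / 60).
  have /andP[nJ _] := JJ; have : (9%:R : R) <= J.+1%:R by rewrite ler_nat.
  by move=> h; rewrite -[leRHS]invrK lef_pV2 ?posrE ?invr_gt0//; move: h JN; glra.
have [] := @early_bounds J 8 9 (1 / 60) (1 / 4) (358 / 231) (271 / 176) (62 / 145) (251 / 116) (124 / 215)
  14 (43 / 224) (2 / 19) (2 / 17) (371 / 43) JT JJ JN NJ Jk Ni.
all: try by [rewrite unlock /= /isq; glra | glra].
move=> bnd gap1 gap2.
by apply: (late_contra JT JN Jk Ni _ bnd _ gap1 gap2
  (i0 := (1 / 60)) (k := (1 / 4)) (j := (2 / 25)) (Zp := (358 / 231)) (SD := (62 / 145)) (Sn := (251 / 116))
  (gD := (124 / 215)) (gDa := (124 / 215)) (gn := 14) (gnu := (43 / 224))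
  (tl := (2 / 19)) (tlm := (2 / 17)) (tlms := (371 / 43))
  (sD := (333 / 128)) (s1 := (389 / 348)) (sq := (367 / 119)) (sE := (2 / 321))
  (aD := (312 / 101)) (an := (21 / 34)) (aE := (1 / 45)) (w1 := (157 / 12)) (w2 := (57 / 50)) (w3 := (389 / 18))
  (cs := (169 / 291)) (ca := (53 / 240)) (f := (167 / 278))); (try split); (try split); glra.
Qed.

(** Beyond [J + 1 = 10] the first bound on the gap comes from [G_window],
    and a single set of constants serves all [J]. *)
Lemma late_large J : (J.+1 < T)%N -> (11 <= J.+1)%N -> J.+1%:R <= 3 / 20 * N ->
  3 / 20 * N <= J.+2%:R -> (J.+1%:R : R) <= 1 / 4 * T%:R -> False.
Proof.
move=> JT JJ JN NJ Jk.
have nJ : (11%:R : R) <= J.+1%:R by rewrite ler_nat.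
have Ni : N^-1 <= 3 / 220.
  by rewrite -[leRHS]invrK lef_pV2 ?posrE ?invr_gt0//; move: nJ JN; glra.
have leZ k : sume 0 k <= 79 / 48 * u by apply: sume_isq; exact: isq_sum_all.
have uN0 : 0 < u / N by rewrite divr_gt0.
have J10 : (10 <= J < T)%N by apply/andP; split; [exact: JJ|exact: ltnW].
have SN : sumX 0 J.+1 / N <= (118 / 277) * D + (108 / 47) * (u / N).
  by apply: (sumX_early_le (ltnW JT) JN Ni (leZ _)); glra.
have D0 := est_D run.
have gap1 : G J.+1 <= (67 / 34) * D + (50 / 3) * (u / N) + 1 / 4 / 144 * (T%:R * eE).
  have := G_window J10 JN Jk NJ leZ Ni; have := ltW uN0; move: SN D0; glra.
have bnd : [/\ sume 0 J.+1 <= 79 / 48 * u, sume J.+1 T <= (2 / 23) * u, sume J T <= (2 / 21) * u &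
      sume J T <= (160 / 21) * (u / N)].
  split=> //.
  - apply: sume_isq; apply: le_trans (isq_tail_le _ JJ) _.
    by rewrite -div1r ler_pdivrMr; glra.
  - apply: sume_isq; apply: le_trans (isq_tail_le _ (JJ : (10 <= J)%N)) _.
    by rewrite -div1r ler_pdivrMr; glra.
  have -> : (160 / 21) * (u / N) = (160 / 21) / N * u by ring.
  apply: sume_isq; apply: le_trans (isq_tail_le T (leqnn J)) _.
  rewrite -div1r ler_pdivlMr// mulrAC ler_pdivrMr; last by have := ler0n R J; glra.
  by move: nJ NJ; rewrite -(natr1 J.+1) -(natr1 J); glra.
have gap2 : G J.+1 <= (139 / 242) * D + (79 / 388) * u + 1 / 4 / 144 * (T%:R * eE).
  have h := G_early (ltnW JT) Jk.
  have SN0 : 0 <= sumX 0 J.+1 / N by rewrite divr_ge0// ltW.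
  have h1 : (11 / 72 + 8 / 5 / N) * (sumX 0 J.+1 / N) <=
      (11 / 72 + 8 / 5 * (3 / 220)) * ((118 / 277) * D + (108 / 47) * (u / N)).
    apply: ler_pM => //; first by rewrite addr_ge0// ?divr_ge0// ltW.
    by rewrite lerD2l ler_wpM2l// divr_ge0.
  have h2 : sume 0 J.+1 / N <= 79 / 48 * u / N by rewrite ler_pM2r ?invr_gt0.
  have h4 : u / N <= 3 / 220 * u by rewrite mulrC; apply: ler_wpM2r => //; exact: ltW.
  move: u0 h h1 h2 h4 D0 (leZ J); glra.
by apply: (late_contra JT JN Jk Ni _ bnd _ gap1 gap2
  (i0 := (3 / 220)) (k := (1 / 4)) (j := (2 / 25)) (Zp := (79 / 48)) (SD := (118 / 277)) (Sn := (108 / 47))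
  (gD := (67 / 34)) (gDa := (139 / 242)) (gn := (50 / 3)) (gnu := (79 / 388))
  (tl := (2 / 23)) (tlm := (2 / 21)) (tlms := (160 / 21))
  (sD := (179 / 64)) (s1 := (262 / 221)) (sq := (261 / 79)) (sE := (2 / 321))
  (aD := (211 / 67)) (an := (235 / 373)) (aE := (4 / 181)) (w1 := (125 / 8)) (w2 := (28 / 25)) (w3 := (209 / 9))
  (cs := (132 / 227)) (ca := (61 / 284)) (f := (71 / 118))); (try split); (try split); glra.
Qed.

Lemma a_sum0 : 3 / 8 * \sum_(0 <= t < T.+1) a t <= D / 2 + 1 / 5 * sume 0 T
    + (3 / 16 + 2 / N) * (sumX 0 T / (q * N)) + sume 0 T / N / 48 + T%:R * eE / 192.
Proof.
have T0 := est_T run; have := a_sum T0; have := a_stepH T0; have := est_H0 run.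
have aE : \sum_(0 <= t < T.+1) a t = a 0%N + \sum_(1 <= t < T.+1) a t.
  by rewrite (@big_cat_nat _ _ _ 1)//= big_nat1.
have eE1 : sume 0 T = e 0%N + sume 1 T.
  by rewrite /sume (@big_cat_nat _ _ _ 1 0 T)//= big_nat1.
have XE : sumX 0 T / (q * N) = s 0%N + sumX 1 T / (q * N).
  by rewrite /sumX (@big_cat_nat _ _ _ 1 0 T)//= big_nat1 mulrDl.
have X1 : sumX 0 1 / (q * N) = s 0%N by rewrite /sumX big_nat1.
have TE : T%:R * eE = eE + (T - 1)%:R * eE.
  by rewrite natrB// mulrBl mul1r addrCA subrr addr0.
rewrite aE eE1 XE X1 TE; glra.
Qed.

(** The case of a short run: the centre stays near [z^0], so that the
    telescoping of [Lam] bounds the sum of the [X t] over the whole run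
    ([eta = 3 / 4] in [sumV_le]). It serves with at most one iteration
    discarded, that with the largest inner error. *)
Lemma early_contra J ka Z1 t1 k SD Sn aD an aE w1 w2 w3 co cc f :
  (J < T)%N -> J%:R <= k * T%:R -> T%:R <= ka * N -> 0 <= ka ->
  sume 0 T <= Z1 * u -> sume J T <= t1 * u ->
  co <= 1 / 2 - 7 / 16 * ka ^+ 2 -> 0 < co -> cc = 3 / 16 + 2 / 18 -> 0 <= Z1 ->
  [/\ 1 / 72 + 7 / 3 * ka <= co * SD, 2 / 3 * Z1 <= co * Sn, 0 <= SD & 0 <= Sn] ->
  [/\ 8 / 3 * (1 / 2 + cc * SD) <= aD,
      8 / 3 * (Z1 / 5 + cc * Sn / 18 + Z1 / 48 / 18) <= an & 8 / 3 / 192 <= aE] ->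
  [/\ 0 <= aD, 0 <= an & 0 <= aE] ->
  [/\ 0 < w1, 0 < w2, 0 < w3 & w1^-1 + w2^-1 + w3^-1 <= 1] ->
  f <= 1 - k - (w3 * (1 / 18) / 16 + 51 / 8) * aE ->
  [/\ 0 <= f, w1 * t1 + w2 * Sn + w3 * an / 16 <= 64 / 5 * f,
      w2 * (Sn / 2) <= 32 / 5 * f, 17 / 4 * an <= 32 / 5 * f &
      w2 * SD + (w3 * (1 / 18) / 16 + 51 / 8) * aD <= 48 * f] -> False.
Proof.
move=> JT Jk TN ka0 eZ eJ coE co0 ccE Z10 [c1 c2 SD0 Sn0] [a1 a2 a3] [aD0 an0 aE0] ws fE
  [f0 f1 f2 f3 f4].
have q1 := est_q run; have D0 := est_D run; have E0 := est_E run.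
have N18 := est_N run.
have Ni : N^-1 <= 1 / 18.
  by rewrite -[leRHS]invrK lef_pV2 ?posrE ?invr_gt0//; move: N18; glra.
have iN : 0 < N^-1 by rewrite invr_gt0.
have uN0 : 0 <= u / N by rewrite divr_ge0// ltW.
have uNi : u / N <= 1 / 18 * u by rewrite mulrC; apply: ler_wpM2r => //; exact: ltW.
have k34 : (0 : R) < 3 / 4 by glra.
have S_le : co * (sumX 0 T / N) <= (1 / 72 + 7 / 3 * ka) * D + 2 / 3 * Z1 * (u / N).
  have h1 := sumX_le (leqnn T); have h2 := sumV_le (leqnn T) k34.
  have TqN : (T%:R / (q * N)) ^+ 2 <= ka ^+ 2.
    rewrite lerXn2r ?nnegrE ?divr_ge0 ?(ltW qN0)// ler_pdivrMr//.
    by apply: le_trans TN _; rewrite ler_wpM2l// ler_peMl// ltW.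
  have h3 := ler_wpM2r (sumX0 0 T) TqN.
  have h4 := ler_wpM2r D0 TN.
  have h5 := ler_wpM2r D0 N18.
  have h6 : co * sumX 0 T <= (N / 72 + 7 / 3 * (ka * N)) * D + 2 / 3 * Z1 * u.
    have h7 := ler_wpM2r (sumX0 0 T) coE.
    by move: h1 h2 h3 h4 h5 h7 eZ; rewrite invf_div; glra.
  have -> : (1 / 72 + 7 / 3 * ka) * D + 2 / 3 * Z1 * (u / N) =
     ((N / 72 + 7 / 3 * (ka * N)) * D + 2 / 3 * Z1 * u) / N by field; rewrite gt_eqF.
  by rewrite mulrA ler_pM2r.
have {}S_le : sumX 0 T / N <= SD * D + Sn * (u / N).
  rewrite -(ler_pM2l co0); apply: le_trans S_le _.
  have h1 := ler_wpM2r D0 c1; have h2 := ler_wpM2r uN0 c2; move: h1 h2; glra.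
have S0 : 0 <= sumX 0 T / N by rewrite divr_ge0// ltW.
have XS : q * sumX J T <= SD * NN + Sn / 2 * u + Sn / 2 * (u * q ^+ 2) + 0 * (T%:R * E).
  have h1 : sumX J T <= sumX 0 T by exact: sum_nat_le.
  have qN0' := ltW qN0; have h2 := ler_wpM2l qN0' S_le; have h3 := ler_wpM2l (ltW q0) h1.
  have h4 : q * N * (sumX 0 T / N) = q * sumX 0 T by field; rewrite gt_eqF.
  have h5 : q * N * (SD * D + Sn * (u / N)) = SD * (q * (N * D)) + Sn * (u * q).
    by field; rewrite gt_eqF.
  have h6 : q * (N * D) <= NN.
    rewrite /NN expr2 -!mulrA; apply: ler_wpM2l; first exact: ltW.
    by rewrite ler_peMl// mulr_ge0// ltW.
  have h7 : u * q <= u / 2 + u * q ^+ 2 / 2.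
    by have := mulr_ge0 (ltW u0) (sqr_ge0 (q - 1)); glra.
  have h8 := ler_wpM2l SD0 h6; have h9 := ler_wpM2l Sn0 h7.
  by move: h2 h3 h8 h9; rewrite h4 h5; glra.
have asum : \sum_(J.+1 <= t < T.+1) a t <= aD * D + an * u + aE * (T%:R * eE).
  apply: (@le_trans _ _ (\sum_(0 <= t < T.+1) a t)); first exact: sum_nat_le.
  have h := a_sum0; have TE0 : 0 <= T%:R * eE by rewrite mulr_ge0// ltW.
  have h1 : (3 / 16 + 2 / N) * (sumX 0 T / (q * N)) <= cc * (SD * D + Sn * (u / N)).
    apply: ler_pM => //; first by rewrite addr_ge0 ?divr_ge0// ltW.
    - by rewrite divr_ge0// ltW.
    - by move: Ni; rewrite ccE; glra.
    exact: le_trans (sX_le T) S_le.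
  have h2 : sume 0 T / N <= Z1 * (u / N) by rewrite mulrA ler_pM2r.
  have cc0 : 0 <= cc by rewrite ccE; glra.
  have h3 := ler_wpM2l (mulr_ge0 cc0 Sn0) uNi; have h4 := ler_wpM2l Z10 uNi.
  have b1 := ler_wpM2r D0 a1; have b2 := ler_wpM2r (ltW u0) a2; have b3 := ler_wpM2r TE0 a3.
  move: h h1 h2 h3 h4 b1 b2 b3 eZ; glra.
have fs : [/\ 0 <= f, w1 * t1 + w2 * (Sn / 2 + Sn / 2) + w3 * an / 16 <= 64 / 5 * f,
      w2 * (Sn / 2) <= 32 / 5 * f, 17 / 4 * an <= 32 / 5 * f &
      w2 * SD + (w3 * (1 / 18) / 16 + 51 / 8) * aD <= 48 * f].
  by split=> //; move: f1; glra.
have fE' : f <= 1 - k - w2 * 0 - (w3 * (1 / 18) / 16 + 51 / 8) * aE by rewrite mulr0 subr0.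
exact: (budget_contra JT Jk Ni ws _ eJ XS asum fE' fs).
Qed.

Lemma early_small : (T <= 7)%N -> False.
Proof.
move=> T7; have N18 := est_N run; have T0 := est_T run.
have eZ : sume 0 T <= (192 / 127) * u.
  apply: sume_isq; apply: (@le_trans _ _ (\sum_(0 <= t < 7) isq t)).
    by apply: sum_nat_le => //; exact: isq_ge0.
  by rewrite unlock /= /isq; glra.
have TN : (T%:R : R) <= 7 / 18 * N.
  have : (T%:R : R) <= 7%:R by rewrite ler_nat.
  by move: N18; glra.
have Jk : (0%:R : R) <= 0 * T%:R by rewrite mul0r.
by apply: (early_contra T0 Jk TN _ eZ eZ
  (ka := (7 / 18)) (Z1 := (192 / 127)) (t1 := (192 / 127))
  (k := 0) (SD := (206 / 97)) (Sn := (309 / 133)) (aD := (369 / 122)) (an := (339 / 371)) (aE := (1 / 72)) (w1 := (344 / 141)) (w2 := (49 / 25)) (w3 := (113 / 9)) (co := (59 / 136)) (cc := (43 / 144)) (f := (235 / 258))); (try split); glra.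
Qed.

Lemma early_medium : (7 < T)%N -> T%:R <= 3 / 5 * N -> False.
Proof.
move=> T8 TN.
have eZ : sume 0 T <= 79 / 48 * u by apply: sume_isq; exact: isq_sum_all.
have eJ : sume 1 T <= 31 / 48 * u.
  apply: sume_isq; have := isq_sum_all T; rewrite (@big_cat_nat _ _ _ 1 0 T)//=; last by apply: leq_trans T8.
  by rewrite big_nat1 {1}/isq expr1n invr1; glra.
have Jk : (1%:R : R) <= 1 / 8 * T%:R.
  have : (8%:R : R) <= T%:R by rewrite ler_nat.
  by glra.
have T1 : (1 < T)%N by apply: leq_trans T8.
by apply: (early_contra T1 Jk TN _ eZ eJ
  (ka := (3 / 5)) (Z1 := (79 / 48)) (t1 := (31 / 48))
  (k := (1 / 8)) (SD := (289 / 70)) (Sn := (157 / 49)) (aD := (305 / 66)) (an := (333 / 325)) (aE := (1 / 72)) (w1 := (397 / 66)) (w2 := (32 / 25)) (w3 := (191 / 10)) (co := (25 / 73)) (cc := (43 / 144)) (f := (304 / 387))); (try split); glra.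
Qed.

(** If [T > 3 N / 5], then [J + 1] is the integer part of [3 N / 20], so
    that at most a quarter of the run is discarded. *)
Lemma estimates_absurd : False.
Proof.
have N18 := est_N run.
have [T7|T8] := leqP T 7; first exact: early_small.
have [TN|NT] := lerP T%:R (3 / 5 * N); first exact: early_medium.
have y0 : 0 <= 3 / 20 * N by move: N18; glra.
have /andP[] := Num.Theory.truncn_itv y0; set n := Num.truncn _ => n1 n2.
have n3 : (2 <= n)%N.
  rewrite -ltnS -(ltr_nat R); apply: le_lt_trans n2; move: N18; glra.
have [J nE] : exists J, n = J.+1 by exists n.-1; rewrite prednK// ltnW.
rewrite nE in n1 n2 n3; clear nE n.
have Jk : (J.+1%:R : R) <= 1 / 4 * T%:R by move: n1 NT; glra.
have JT : (J.+1 < T)%N.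
  rewrite -(ltr_nat R); apply: le_lt_trans Jk _.
  have : (0 : R) < T%:R by rewrite ltr0n; apply: leq_trans T8.
  by glra.
have n2' := ltW n2.
have [J1|J2] := leqP J.+1 2.
  have Jk2 : (J.+1%:R : R) <= 2 / 11 * T%:R.
    have -> : J.+1 = 2%N by apply/eqP; rewrite eqn_leq J1.
    have : (10%:R : R) < T%:R by move: NT N18; glra.
    rewrite ltr_nat => T11; have : (11%:R : R) <= T%:R by rewrite ler_nat.
    by glra.
  by apply: (late_2_2 JT _ n1 n2' Jk2); rewrite n3.
have [J3|J4] := leqP J.+1 3; first by apply: (late_3_3 JT _ n1 n2' Jk); rewrite J2.
have [J5|J6] := leqP J.+1 5; first by apply: (late_4_5 JT _ n1 n2' Jk); rewrite J4.
have [J8|J9] := leqP J.+1 8; first by apply: (late_6_8 JT _ n1 n2' Jk); rewrite J6.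
have [J10|J11] := leqP J.+1 10; first by apply: (late_9_10 JT _ n1 n2' Jk); rewrite J9.
exact: (late_large JT J11 n1 n2' Jk).
Qed.

End Run.
End FiniteHorizon.

(** The standing assumptions, bundled so that every lemma has the same
    hypothesis. *)
Record assumptions (R : realType) n m l (P : setting R n m l) : Prop := Assumptions {
  reg_m_gt0 : (0 < m)%N;
  reg_f_diff : forall x, differentiable (fobj P) x;
  reg_g_diff : forall i x, differentiable (gcon P i) x;
  reg_X_compact : compact (Xset P);
  reg_f_lower : forall x, Xset P x -> flow P <= fobj P x;
  reg_L_ge0 : 0 <= cL P;
  reg_f_smooth : grad_lipschitz_on (Xset P) (cL P) (fobj P);
  reg_g_smooth : forall i, grad_lipschitz_on (Xset P) (cL P) (gcon P i);
  reg_g_convex : forall i, convex_function [set: convex_lmodType 'cV[R]_n] (gcon P i);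
  reg_f_grad_bound : forall x, Xset P x -> enorm (grad (fobj P) x) <= cBf P;
  reg_g_bound : forall x, Xset P x -> Num.max (enorm (gvec P x)) (spectral_norm (jacg P x)) <= cBg P;
  reg_slater : Xset P (xfeas P) /\ forall i, gcon P i (xfeas P) < 0;
  reg_p_gtL : cL P < cp P
}.

Section Problem.
Context {R : realType} {n m l : nat}.
Variable P : setting R n m l.
Implicit Types (x y z : 'cV[R]_n) (lam : 'cV[R]_m).

Local Notation f := (fobj P).
Local Notation g := (gcon P).
Local Notation p := (cp P).
Local Notation L := (cL P).
Local Notation mu := (cp P - cL P).
Local Notation B := (cBg P).
Local Notation tau := (ctau P).
Local Notation X := (Xset P).
Local Notation D := (diameter (Xset P)).

Hypothesis P_reg : assumptions P.
Let m_gt0 := reg_m_gt0 P_reg.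
Let f_diff := reg_f_diff P_reg.
Let g_diff := reg_g_diff P_reg.
Let X_compact := reg_X_compact P_reg.
Let f_lower := reg_f_lower P_reg.
Let L_ge0 := reg_L_ge0 P_reg.
Let f_smooth := reg_f_smooth P_reg.
Let g_smooth := reg_g_smooth P_reg.
Let g_convex := reg_g_convex P_reg.
Let f_grad_bound := reg_f_grad_bound P_reg.
Let g_bound := reg_g_bound P_reg.
Let slater := reg_slater P_reg.
Let p_gtL := reg_p_gtL P_reg.

Lemma mu_gt0 : 0 < mu. Proof. by rewrite subr_gt0. Qed.
Lemma p_gt0 : 0 < p. Proof. exact: le_lt_trans p_gtL. Qed.
Lemma mu_le_p : mu <= p. Proof. by rewrite lerBlDr lerDl. Qed.

Lemma X_xfeas : X (xfeas P). Proof. by case: slater. Qed.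

Lemma B_gt0 : 0 < B.
Proof.
have := g_bound X_xfeas; rewrite ge_max => /andP[gB _].
apply: lt_le_trans gB; apply: lt_le_trans (enorm_coord_le _ (Ordinal m_gt0)).
by rewrite normr_gt0 mxE lt_eqF//; case: slater.
Qed.

Lemma tau_gt0 : 0 < tau.
Proof. by rewrite divr_gt0 ?mu_gt0// mulr_gt0// exprn_gt0// B_gt0. Qed.

Lemma tau_B : tau * B ^+ 2 = mu / 4.
Proof. by rewrite /ctau; have := B_gt0 => B0; field; lra. Qed.

Lemma slackD x v (s : R) j : slack P (x + s *: v) j = slack P x j + s * (cA P *m v) j 0.
Proof. by rewrite /slack mulmxDr -scalemxAr !mxE addrAC. Qed.

Lemma X_segment : segment_closed X.
Proof.
move=> x y s Xx Xy /andP[s0 s1] j; have := Xx j; have := Xy j.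
have -> : slack P y j = slack P x j + 1 * (cA P *m (y - x)) j 0.
  by rewrite -slackD scale1r (addrC x) subrK.
by rewrite slackD => hy hx; nra.
Qed.

Lemma X_bounded : exists K, forall x y, X x -> X y -> enorm (x - y) <= K.
Proof.
pose h x : R := enorm (x - xfeas P) ^+ 2.
have hc : {within X, continuous h}.
  apply: continuous_subspaceT => x.
  by apply: differentiable_continuous; exact: differentiable_sqdist.
have X0 : X !=set0 by exists (xfeas P); exact: X_xfeas.
have [c _ cmax] := compact_EVT_max X0 X_compact hc.
exists (2 * enorm (c - xfeas P)) => x y Xx Xy.
apply: le_trans (enorm_triangle (xfeas P) _ _) _.
have le_c u : X u -> enorm (u - xfeas P) <= enorm (c - xfeas P).
  move=> Xu; rewrite -(@ler_pXn2r _ 2) ?nnegrE ?enorm_ge0//.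
  by apply: cmax; exact: mem_set.
by rewrite (enormC (xfeas P)); have := le_c _ Xx; have := le_c _ Xy; lra.
Qed.

Lemma diameter_le x y : X x -> X y -> enorm (x - y) <= D.
Proof.
move=> Xx Xy; have [K hK] := X_bounded; apply: ub_le_sup; last by exists x, y.
by exists K => _ [u [v [Xu Xv ->]]]; exact: hK.
Qed.

Lemma diameter_ge0 : 0 <= D.
Proof. exact: le_trans (enorm_ge0 _) (diameter_le X_xfeas X_xfeas). Qed.

(** * The constraint map *)

Lemma jacgE x (e : 'cV[R]_m) : jacg P x *m e = \sum_i e i 0 *: grad (g i) x.
Proof.
apply/matrixP => i j; rewrite (ord1 j) summxE mxE; apply: eq_bigr => k _.
by rewrite !mxE mulrC.
Qed.

Lemma jacg_le x e : X x -> enorm (jacg P x *m e) <= B * enorm e.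
Proof.
move=> Xx; apply: le_trans (spectral_norm_le _ _) _.
by apply: ler_wpM2r; [exact: enorm_ge0|have := g_bound Xx; rewrite ge_max => /andP[]].
Qed.

Lemma gvec_le x : X x -> enorm (gvec P x) <= B.
Proof. by move=> Xx; have := g_bound Xx; rewrite ge_max => /andP[]. Qed.

Lemma differentiable_dotg lam x : differentiable (fun y => dotv lam (gvec P y)) x.
Proof.
have -> : (fun y => dotv lam (gvec P y)) = \sum_(i < m) (lam i 0 *: (g i : _ -> R^o)).
  by apply/funext => y; rewrite fct_sumE; apply: eq_bigr => i _; rewrite mxE.
by apply: differentiable_sum => i; apply: differentiableZ.
Qed.

Lemma grad_dotg lam x : grad (fun y => dotv lam (gvec P y)) x = jacg P x *m lam.
Proof.
apply: grad_unique => [y|v]; first exact: differentiable_dotg.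
have -> : (fun s : R => dotv lam (gvec P (x + s *: v))) =
    \sum_(i < m) (lam i 0 *: ((fun s : R => g i (x + s *: v)) : R -> R^o)).
  by apply/funext => s; rewrite fct_sumE; apply: eq_bigr => i _; rewrite mxE.
have dg i : is_derive (0 : R) 1 (fun s : R => g i (x + s *: v)) (dotv (grad (g i) x) v).
  have := is_derive_line x v 0 (g_diff i); by rewrite scale0r addr0.
apply: is_derive_eq; rewrite jacgE /dotv.
rewrite (eq_bigr (fun i => \sum_(k < n) lam i 0 * (grad (g i) x k 0 * v k 0))); last first.
  by move=> i _; rewrite -mulr_sumr.
rewrite exchange_big /=; apply: eq_bigr => k _; rewrite summxE mulr_suml.
by apply: eq_bigr => i _; rewrite !mxE mulrA.
Qed.

(** The mean value theorem is applied to the scalar function [<e, g y>] with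
    [e = g y - g x], so that the constant is the spectral bound and not a
    multiple of it. *)
Lemma gvec_lip x y : X x -> X y ->
  enorm (gvec P y - gvec P x) <= B * enorm (y - x).
Proof.
move=> Xx Xy; set e := gvec P y - gvec P x.
have [e0|e0] := eqVneq (enorm e) 0.
  by rewrite e0 mulr_ge0 ?enorm_ge0 ?ltW ?B_gt0.
have ep : 0 < enorm e by rewrite lt_neqAle eq_sym e0 enorm_ge0.
rewrite -(ler_pM2l ep) -expr2 enorm_sqr.
have := @line_le _ _ (fun y => dotv e (gvec P y)) x (y - x)
  (B * enorm e * enorm (y - x)) 0 (differentiable_dotg e).
rewrite (addrC x) subrK mul0r addr0 /= => h.
have -> : dotv e e = dotv e (gvec P y) - dotv e (gvec P x).
  by rewrite -dotvNr -dotvDr.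
rewrite mulrA (mulrC (enorm e)); apply: h => c /andP[c0 c1].
rewrite mul0r addr0 grad_dotg; apply: le_trans (dotv_le_enorm _ _) _.
apply: ler_wpM2r; first exact: enorm_ge0.
by apply: jacg_le; apply: X_segment => //; rewrite !ltW.
Qed.

(** * The proximal Lagrangian *)

Definition Lgrad x z lam := grad f x + jacg P x *m lam + p *: (x - z).

Lemma LpE x z lam : Lp P x z lam = proxf P z x + dotv lam (gvec P x).
Proof.
rewrite /Lp /proxf addrAC; congr (_ + _).
by apply: eq_bigr => i _; rewrite mxE.
Qed.

Lemma proxf_Lp z : proxf P z = fun y => Lp P y z 0.
Proof. by apply/funext => y; rewrite LpE dotv0l addr0. Qed.

Lemma differentiable_proxf z x : differentiable (proxf P z) x.
Proof.
have -> : proxf P z = (f : _ -> R^o) + (p / 2) *: (fun y => enorm (y - z) ^+ 2 : R^o).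
  by apply/funext.
apply: differentiableD => //; apply: differentiableZ; exact: differentiable_sqdist.
Qed.

Lemma Lp_fun z lam : (fun y => Lp P y z lam) =
  (proxf P z : _ -> R^o) + (fun y => dotv lam (gvec P y) : R^o).
Proof. by apply/funext => y; rewrite LpE. Qed.

Lemma differentiable_Lp z lam x : differentiable (fun y => Lp P y z lam) x.
Proof.
rewrite Lp_fun; apply: differentiableD; first exact: differentiable_proxf.
exact: differentiable_dotg.
Qed.

Lemma grad_Lp x z lam : grad (fun y => Lp P y z lam) x = Lgrad x z lam.
Proof.
apply: grad_unique => [y|v]; first exact: differentiable_Lp.
have -> : (fun s : R => Lp P (x + s *: v) z lam) =
   ((fun s : R => f (x + s *: v)) : R -> R^o)
   + (((p / 2) *: (fun s : R => enorm (x + s *: v - z) ^+ 2 : R^o))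
   + (fun s : R => dotv lam (gvec P (x + s *: v)) : R^o)).
  by apply/funext => s; rewrite LpE /proxf -addrA.
have df : is_derive (0 : R) 1 (fun s : R => f (x + s *: v)) (dotv (grad f x) v).
  by have := is_derive_line x v 0 f_diff; rewrite scale0r addr0.
have dg : is_derive (0 : R) 1 (fun s : R => dotv lam (gvec P (x + s *: v)))
     (dotv (jacg P x *m lam) v).
  have := is_derive_line x v 0 (differentiable_dotg lam).
  by rewrite scale0r addr0 grad_dotg.
have ds := is_derive_sqdist z x v.
apply: (is_derive_eq (is_deriveD df (is_deriveD (is_deriveZ (p / 2) ds) dg))).
rewrite /Lgrad !dotvE /GRing.scale /=; lra.
Qed.

Lemma dotg_convex lam x y : nonneg_orthant lam ->
  dotv (jacg P x *m lam) (y - x) <= dotv lam (gvec P y - gvec P x).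
Proof.
move=> lam0; rewrite jacgE {1}/dotv.
rewrite (eq_bigr (fun k => \sum_i lam i 0 * (grad (g i) x k 0 * (y - x) k 0))); last first.
  move=> k _; rewrite summxE mulr_suml; apply: eq_bigr => i _.
  by rewrite !mxE mulrA.
rewrite exchange_big /=; apply: ler_sum => i _; rewrite -mulr_sumr.
rewrite !mxE; apply: ler_wpM2l; first exact: lam0.
exact: convex_grad_le.
Qed.

(** The proximal term outweighs the curvature [- L] of the objective. The
    set [S] is [X], or the larger set that the accelerated method visits. *)
Lemma Lp_lower S x y z lam : segment_closed S -> grad_lipschitz_on S L f ->
  nonneg_orthant lam -> S x -> S y ->
  Lp P x z lam + dotv (Lgrad x z lam) (y - x) + mu / 2 * enorm (y - x) ^+ 2
    <= Lp P y z lam.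
Proof.
move=> Sc fL lam0 Sx Sy; rewrite !LpE /proxf /Lgrad !dotvDl dotvZl.
have := grad_lipschitz_ge f_diff Sc fL Sx Sy.
have := dotg_convex x y lam0; rewrite [dotv lam _]dotvDr dotvNr.
have -> : enorm (y - z) ^+ 2 =
    enorm (x - z) ^+ 2 + 2 * dotv (x - z) (y - x) + enorm (y - x) ^+ 2.
  by rewrite -enormD_sqr (addrC (x - z)) addrA subrK.
lra.
Qed.

Lemma nonneg0 : @nonneg_orthant R m 0. Proof. by move=> i; rewrite mxE. Qed.

Lemma Lp_strongly_convex z lam : nonneg_orthant lam ->
  strongly_convex X (fun y => Lp P y z lam) mu.
Proof.
move=> lam0; apply: strongly_convex_grad; first exact: X_segment.
by move=> x y; apply: Lp_lower => //; exact: X_segment.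
Qed.

Lemma feasible_segment : segment_closed (feasible P).
Proof.
move=> x y s [Xx gx] [Xy gy] s01; split; first exact: X_segment.
move=> i; have : strongly_convex X (g i) 0.
  apply: (@strongly_convex_grad _ _ _ _ (grad (g i))); first exact: X_segment.
  move=> u v Xu Xv; rewrite !mul0r addr0.
  have := @convex_grad_le _ _ _ u v (@g_diff i u) (@g_convex i); lra.
move=> [_ /(_ _ _ _ Xx Xy s01)]; rewrite !mul0r subr0 => h.
have := gx i; have := gy i; move: s01 => /andP[s0 s1]; nra.
Qed.

Lemma proxf_strongly_convex z : strongly_convex (feasible P) (proxf P z) mu.
Proof.
rewrite proxf_Lp; apply: strongly_convex_grad; first exact: feasible_segment.
move=> x y [Xx _] [Xy _]; apply: (@Lp_lower X) => //; [exact: X_segment|exact: nonneg0].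
Qed.

Lemma feasible_nonempty : feasible P (xfeas P).
Proof. by case: slater => Xs gs; split=> // i; exact: ltW. Qed.

Lemma feasible_compact : compact (feasible P).
Proof.
have fE : feasible P = X `&` \bigcap_(i in setT) [set x | g i x <= 0].
  by apply/seteqP; split=> x [Xx gx]; split=> // i; [move=> _|]; exact: gx.
apply: (subclosed_compact _ X_compact); last by move=> x [].
rewrite fE; apply: closedI; first by apply: compact_closed => //; exact: norm_hausdorff.
apply: closed_bigI => i _.
rewrite (_ : [set x | _] = g i @^-1` [set r | r <= 0]) //.
apply: closed_comp; last exact: closed_le.
by move=> x _; apply: differentiable_continuous.
Qed.

(** The points written [x~] and [x(z)] above. *)
Definition xlag z lam := xget 0 [set x | is_argmin X (fun y => Lp P y z lam) x].
Definition xprox z := xget 0 [set x | is_argmin (feasible P) (proxf P z) x].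

Lemma xlagP z lam : is_argmin X (fun y => Lp P y z lam) (xlag z lam).
Proof.
rewrite /xlag; case: xgetP => [x _ //|h].
have [||x xmin] := @exists_argmin _ _ X (fun y => Lp P y z lam) _ X_compact.
- by exists (xfeas P); exact: X_xfeas.
- by move=> x; apply: differentiable_continuous; exact: differentiable_Lp.
by case: (h x).
Qed.

Lemma xproxP z : is_argmin (feasible P) (proxf P z) (xprox z).
Proof.
rewrite /xprox; case: xgetP => [x _ //|h].
have [||x xmin] := @exists_argmin _ _ _ (proxf P z) _ feasible_compact.
- by exists (xfeas P); exact: feasible_nonempty.
- by move=> x; apply: differentiable_continuous; exact: differentiable_proxf.
by case: (h x).
Qed.

Lemma dualfE z lam : dualf P lam z = Lp P (xlag z lam) z lam.
Proof. exact: inf_argmin (xlagP z lam). Qed.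

Lemma envvE z : envv P z = proxf P z (xprox z).
Proof. exact: inf_argmin (xproxP z). Qed.

Lemma xlag_X z lam : X (xlag z lam). Proof. by case: (xlagP z lam). Qed.

Lemma xprox_feas z : feasible P (xprox z). Proof. by case: (xproxP z). Qed.

Lemma xprox_X z : X (xprox z). Proof. by case: (xprox_feas z). Qed.

Lemma dualf_le z lam x : X x -> dualf P lam z <= Lp P x z lam.
Proof. by rewrite dualfE; case: (xlagP z lam) => _; apply. Qed.

Lemma dualf_growth z lam x : nonneg_orthant lam -> X x ->
  dualf P lam z + mu / 2 * enorm (x - xlag z lam) ^+ 2 <= Lp P x z lam.
Proof.
move=> lam0 Xx; rewrite dualfE.
apply: (argmin_growth (ltW mu_gt0) (Lp_strongly_convex z lam0)) => //.
exact: xlagP.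
Qed.

Lemma envv_le z x : feasible P x -> envv P z <= proxf P z x.
Proof. by rewrite envvE; case: (xproxP z) => _; apply. Qed.

Lemma envv_ge z : flow P + p / 2 * enorm (xprox z - z) ^+ 2 <= envv P z.
Proof. by rewrite envvE lerD2r f_lower//; exact: xprox_X. Qed.

Lemma proxf_ge z x : X x -> flow P + p / 2 * enorm (x - z) ^+ 2 <= proxf P z x.
Proof. by move=> Xx; rewrite lerD2r f_lower. Qed.

Lemma weak_duality lam x : nonneg_orthant lam -> feasible P x ->
  dotv lam (gvec P x) <= 0.
Proof.
move=> lam0 [_ gx]; apply: sumr_le0 => i _; rewrite mxE.
by rewrite mulr_ge0_le0// lam0.
Qed.

Lemma prox_shift z z' u : enorm (u - z') ^+ 2 =
  enorm (u - z) ^+ 2 - 2 * dotv (z' - z) (u - z) + enorm (z' - z) ^+ 2.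
Proof. by rewrite (dotvC (z' - z)) -enormB_sqr opprB addrA subrK. Qed.

Lemma approx_stationary_Lp eps z lam x : nonneg_orthant lam ->
  approx_stationary X (fun y => Lp P y z lam) eps x ->
  eps_opt X (fun y => Lp P y z lam) mu eps x.
Proof.
move=> lam0 [Xx st]; apply: approx_stationary_opt => // y Xy.
by rewrite grad_Lp; apply: (@Lp_lower X) => //; exact: X_segment.
Qed.

(** A change of the centre adds a linear function to the objective. *)
Lemma eps_opt_center eps z z' lam x :
  eps_opt X (fun y => Lp P y z lam) mu eps x ->
  eps_opt X (fun y => Lp P y z' lam) mu (eps + p * enorm (z' - z)) x.
Proof.
move=> [Xx xopt]; split=> // y Xy; have := xopt y Xy; rewrite !LpE /proxf.
rewrite !(prox_shift z z').
have := dotv_le_enorm (z' - z) (y - x); rewrite !dotvE.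
have := p_gt0; nra.
Qed.

(** * One iteration *)

Local Notation dstep := (dual_step P tau).

Lemma dual_step_ge0 lam x : nonneg_orthant (dstep lam x).
Proof. by move=> i; rewrite mxE pospart_ge0. Qed.

(** The multiplier step is the projection of [lam + tau g(x)] onto the
    orthant: the residual is normal at the projection. *)
Lemma dual_step_normal lam x :
  normal_cone (@nonneg_orthant R m) (dstep lam x)
    (lam + tau *: gvec P x - dstep lam x).
Proof.
split; first exact: dual_step_ge0.
move=> y y0; apply: sumr_le0 => i _; rewrite !mxE.
have := y0 i; case: (pospart_cases (lam i 0 + tau * g i x)) => -[h ->]; nra.
Qed.

Lemma normal_orthant0 (v e : 'cV[R]_m) : normal_cone (@nonneg_orthant R m) e v ->
  dotv v e = 0.
Proof.
move=> [e0 h]; apply/eqP; rewrite eq_le; apply/andP; split.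
  have := h (2 *: e) _; rewrite scalerDl scale1r addrK; apply=> i.
  by rewrite !mxE addr_ge0 ?e0.
have := h 0 nonneg0; rewrite sub0r dotvNr; lra.
Qed.

(** The two consequences of the projection property through which products
    of multipliers and constraints become differences of squares. *)
Lemma dual_step_inner lam x : nonneg_orthant lam ->
  let lam' := dstep lam x in
  2 * tau * dotv lam' (gvec P x) =
    enorm lam' ^+ 2 - enorm lam ^+ 2 + enorm (lam' - lam) ^+ 2 /\
  enorm (lam' - lam) ^+ 2 <= tau * dotv (lam' - lam) (gvec P x).
Proof.
move=> lam0 lam'; have hn := dual_step_normal lam x; rewrite -/lam' in hn.
have := normal_orthant0 hn; case: hn => _ /(_ _ lam0).
rewrite enormB_sqr !enorm_sqr !dotvE !(dotvC _ lam') !(dotvC _ lam).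
rewrite (dotvC lam lam').
by move=> h1 h2; split; lra.
Qed.

(** Subtracting [tau g(y)] enlarges the positive part; with [y] near [x],
    the full size of [g(x)] is replaced by a Lipschitz term. *)
Lemma dual_step_le lam x y : nonneg_orthant lam -> feasible P y ->
  enorm (dstep lam x) <= enorm (lam + tau *: (gvec P x - gvec P y)).
Proof.
move=> lam0 [_ gy]; apply: enorm_le_coord => i; rewrite !mxE.
rewrite ger0_norm ?pospart_ge0//; have := gy i; have := tau_gt0.
case: (pospart_cases (lam i 0 + tau * g i x)) => -[h ->] //.
move=> t0 gyi; apply: le_trans (ler_norm _); nra.
Qed.

(** This is where the value of [tau] comes from. *)
Lemma gvec_lip_sqr x y : X x -> X y ->
  tau * enorm (gvec P y - gvec P x) ^+ 2 <= mu / 4 * enorm (y - x) ^+ 2.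
Proof.
move=> Xx Xy; have := gvec_lip Xx Xy; rewrite -tau_B -mulrA.
rewrite ler_pM2l ?tau_gt0// -exprMn => h.
by rewrite lerXn2r ?nnegrE ?enorm_ge0// (le_trans _ h)// enorm_ge0.
Qed.

(** The competitor [x(z)] is feasible, so [dual_step_le] applies to it; it
    is worth at most [v(z)], while the objective at [x] is at least
    [flow + p / 2 |x - z|^2]. *)
Lemma multiplier_growth z lam x eps : nonneg_orthant lam ->
  eps_opt X (fun y => Lp P y z lam) mu eps x ->
  enorm (dstep lam x) ^+ 2 / (2 * tau) + p / 2 * enorm (x - z) ^+ 2 <=
  enorm lam ^+ 2 / (2 * tau) + (envv P z - flow P) + 2 / 3 * (eps ^+ 2 / mu).
Proof.
move=> lam0 [Xx xopt]; have mu0 := mu_gt0; have t0 := tau_gt0.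
have t2 : 0 < 2 * tau by lra.
have Fh := xprox_feas z; have Xh := xprox_X z.
have := xopt _ Xh; rewrite !LpE -envvE; set d := enorm (xprox z - x).
have := proxf_ge z Xx.
have := dual_step_le x lam0 Fh.
have := gvec_lip_sqr Xh Xx; rewrite (enormC x) -/d.
set dg := gvec P x - _ => hdg le_e.
have {le_e} : enorm (dstep lam x) ^+ 2 / (2 * tau) <= enorm lam ^+ 2 / (2 * tau) +
    dotv lam dg + tau * enorm dg ^+ 2 / 2.
  have -> : enorm lam ^+ 2 / (2 * tau) + dotv lam dg + tau * enorm dg ^+ 2 / 2 =
      enorm (lam + tau *: dg) ^+ 2 / (2 * tau).
    rewrite enormD_sqr enormZ exprMn real_normK ?num_real// dotvZr.
    by field; rewrite gt_eqF.
  by rewrite ler_pM2r ?invr_gt0// lerXn2r ?nnegrE ?enorm_ge0.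
have k0 : (0 : R) < 3 / 8 by lra.
have := young eps d mu0 k0; rewrite (_ : 4 * (3 / 8) = 3 / 2); last by field.
rewrite /dg dotvDr dotvNr; lra.
Qed.

Lemma multiplier_start x : X x ->
  enorm (dstep 0 x) ^+ 2 / (2 * tau) <= (envv P x - flow P) / 4.
Proof.
move=> Xx; have mu0 := mu_gt0; have t0 := tau_gt0.
have t2 : 0 < 2 * tau by lra.
have Fh := xprox_feas x; have Xh := xprox_X x.
have := dual_step_le x nonneg0 Fh; rewrite add0r enormZ gtr0_norm// => h.
have : enorm (dstep 0 x) ^+ 2 / (2 * tau) <=
    tau * enorm (gvec P x - gvec P (xprox x)) ^+ 2 / 2.
  rewrite ler_pdivrMr//.
  rewrite (_ : tau * _ / 2 * _ = (tau * enorm (gvec P x - gvec P (xprox x))) ^+ 2).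
    by rewrite lerXn2r ?nnegrE ?enorm_ge0// (le_trans _ h) ?enorm_ge0.
  by field.
have := gvec_lip_sqr Xh Xx; have := envv_ge x; rewrite (enormC x).
have := mu_le_p; have := sqr_ge0 (enorm (xprox x - x)); nra.
Qed.

(** The old minimizer is feasible for the new centre; [eta] splits its new
    distance. *)
Lemma envv_move z z' eta : 0 < eta -> envv P z' - flow P <=
  (1 + eta^-1) * (envv P z - flow P) + (1 + eta) / 2 * (p * enorm (z' - z) ^+ 2).
Proof.
move=> e0; have p0 := p_gt0.
have := envv_le z' (xprox_feas z); rewrite (envvE z) /proxf.
have := f_lower (xprox_X z); set fx := f _; set w := xprox z.
have : enorm (w - z') ^+ 2 <= (1 + eta^-1) * enorm (w - z) ^+ 2 + (1 + eta) * enorm (z' - z) ^+ 2.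
  rewrite (prox_shift z z').
  have := dotv_ge_enorm (z' - z) (w - z).
  have := young (enorm (w - z)) (enorm (z' - z)) (k := eta / 2) ltr01 ltac:(lra).
  rewrite (_ : _ / 1 / _ = eta^-1 * enorm (w - z) ^+ 2 / 2); last by field; rewrite gt_eqF.
  lra.
have : 0 <= eta^-1 by rewrite invr_ge0 ltW.
nra.
Qed.

(** The dual gradient at [lam'], which is [g(x~)], becomes normal to the
    orthant at [lam'] when this vector is subtracted ([residual_normal]); so
    its norm measures how far [lam'] is from maximizing the dual function. *)
Definition dual_residual z lam x : 'cV[R]_m := let lam' := dual_step P tau lam x in
  tau^-1 *: (lam' - lam) + (gvec P (xlag z lam') - gvec P x).

(** The dual function is concave with gradient [g(x~)] at [lam'], whence the
    first bound; the projection property compares [<lam' - lam, g(x)>] with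
    [|lam' - lam|^2 / tau]. *)
Lemma gain_data z lam x : nonneg_orthant lam -> X x ->
  let lam' := dual_step P tau lam x in let xt := xlag z lam' in
  let a := enorm (lam' - lam) / Num.sqrt tau in
  let G := Num.sqrt tau * enorm (gvec P xt - gvec P x) in
  let D := Num.sqrt mu * enorm (xt - x) / 2 in
  let q := dotv (lam' - lam) (gvec P xt - gvec P x) in
  [/\ 0 <= a /\ a ^+ 2 = enorm (lam' - lam) ^+ 2 / tau, 0 <= G, G <= D, - (a * G) <= q &
    a ^+ 2 + q <= dualf P lam' z - dualf P lam z /\
    tau * enorm (dual_residual z lam x) ^+ 2 = a ^+ 2 + 2 * q + G ^+ 2].
Proof.
move=> lam0 Xx lam' xt a G D q; have mu0 := mu_gt0; have t0 := tau_gt0.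
pose st := Num.sqrt tau; have st0 : 0 < st by rewrite sqrtr_gt0.
have stE : Num.sqrt tau ^+ 2 = tau by rewrite sqr_sqrtr// ltW.
have Xt : X xt by exact: xlag_X.
have a2 : a ^+ 2 = enorm (lam' - lam) ^+ 2 / tau by rewrite /a exprMn exprVn stE.
split.
- by rewrite a2 divr_ge0 ?enorm_ge0 ?ltW.
- by rewrite mulr_ge0 ?enorm_ge0 ?ltW.
- have D0 : 0 <= D by rewrite divr_ge0 ?mulr_ge0 ?enorm_ge0 ?sqrtr_ge0.
  rewrite -(@ler_pXn2r _ 2) ?nnegrE// ?(mulr_ge0 (ltW st0) (enorm_ge0 _))//.
  rewrite /G /D !exprMn stE (sqr_sqrtr (ltW mu0)).
  have := gvec_lip_sqr Xx Xt; have -> : (2^-1 : R) ^+ 2 = 4^-1 by field.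
  by lra.
- rewrite /a /G -/st (_ : _ / st * _ = enorm (lam' - lam) * enorm (gvec P xt - gvec P x)).
    exact: dotv_ge_enorm.
  by field; rewrite gt_eqF.
split.
  have [_] := dual_step_inner x lam0; rewrite -/lam' mulrC -ler_pdivrMr// -a2.
  have := dualf_le z lam Xt; rewrite (dualfE z lam') -/xt !LpE.
  by rewrite /q !dotvE; lra.
rewrite enormD_sqr enormZ exprMn real_normK ?num_real// dotvZl a2 /G exprMn stE /q.
by rewrite /lam' /xt; field; rewrite gt_eqF.
Qed.

(** As in [multiplier_growth] the norm of the multiplier pays, here for the
    duality gap instead of [|x - z|]. *)
Lemma gap_le z lam x eps : nonneg_orthant lam ->
  eps_opt X (fun y => Lp P y z lam) mu eps x ->
  let lam' := dual_step P tau lam x in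
  (envv P z - dualf P lam' z) + tau * enorm (dual_residual z lam x) ^+ 2 / 2
    + enorm lam' ^+ 2 / (2 * tau) <=
  enorm lam ^+ 2 / (2 * tau) + (envv P z - flow P) + 2 / 3 * (eps ^+ 2 / mu).
Proof.
move=> lam0 [Xx xopt]; set lam' := dual_step P tau lam x; cbv zeta.
have mu0 := mu_gt0; have t0 := tau_gt0.
have t2 : 0 < 2 * tau by lra.
have [[a0 aE] G0 GD q1 [q3 wE]] := gain_data z lam0 Xx.
rewrite -/lam' in aE G0 GD q1 wE q3.
have Xt : X (xlag z lam') by exact: xlag_X.
have smE : Num.sqrt mu ^+ 2 = mu by rewrite sqr_sqrtr// ltW.
set G := Num.sqrt tau * _ in G0 GD wE.
set D' := Num.sqrt mu * _ / 2 in GD.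
have D0 : 0 <= D' by exact: le_trans GD.
have G2 : G ^+ 2 <= D' ^+ 2 by rewrite lerXn2r ?nnegrE.
set b := enorm (xlag z lam' - x) in D' GD D0 G2.
have DE : mu / 2 * b ^+ 2 = 2 * D' ^+ 2 by rewrite /D' !exprMn smE; field.
have [inner _] := dual_step_inner x lam0; rewrite -/lam' in inner.
have {}inner : dotv lam' (gvec P x) = enorm lam' ^+ 2 / (2 * tau)
    - enorm lam ^+ 2 / (2 * tau) + enorm (lam' - lam) ^+ 2 / tau / 2.
  have -> : dotv lam' (gvec P x) = 2 * tau * dotv lam' (gvec P x) / (2 * tau).
    by field; rewrite gt_eqF.
  by rewrite inner; field; rewrite gt_eqF.
have yng : eps * b <= 3 / 2 * D' ^+ 2 + 2 / 3 * (eps ^+ 2 / mu).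
  have k0 : (0 : R) < 3 / 8 by lra.
  have := young eps b mu0 k0; rewrite (_ : 4 * (3 / 8) = 3 / 2 :> R); last by field.
  have : 3 / 8 * (mu * b ^+ 2) = 3 / 2 * D' ^+ 2 by move: DE; lra.
  lra.
have := xopt _ Xt; rewrite dualfE !LpE -/b DE wE aE.
have := proxf_ge z Xx.
have : 0 <= p / 2 * enorm (x - z) ^+ 2.
  by rewrite mulr_ge0 ?sqr_ge0// divr_ge0// ltW// p_gt0.
move: inner yng G2; rewrite !dotvE; lra.
Qed.

(** The increase of the dual function can be spent in three ways; they trade
    the increment of the multiplier and the dual residual against the inner
    error. *)
Lemma dual_gain z lam x eps : nonneg_orthant lam ->
  eps_opt X (fun y => Lp P y z lam) mu eps x -> 0 <= eps ->
  let lam' := dual_step P tau lam x in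
  let a2 := enorm (lam' - lam) ^+ 2 / tau in
  let w := tau * enorm (dual_residual z lam x) ^+ 2 in
  let gain := dualf P lam' z - dualf P lam z in
  [/\ w / 6 + 3 / 8 * a2 <= gain + eps ^+ 2 / mu / 6,
      w / 6 <= gain + eps ^+ 2 / mu / 10 &
      w <= gain + eps ^+ 2 / mu / 3].
Proof.
move=> lam0 [Xx xopt] eps0 lam' a2 w gain; have mu0 := mu_gt0.
have [[a0 aE] G0 GD q1 [q3 wE]] := gain_data z lam0 Xx.
have Xt : X (xlag z lam') by exact: xlag_X.
have lam'0 : nonneg_orthant lam' by exact: dual_step_ge0.
have sm0 : 0 < Num.sqrt mu by rewrite sqrtr_gt0.
have smE : Num.sqrt mu ^+ 2 = mu by rewrite sqr_sqrtr// ltW.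
set D := Num.sqrt mu * _ / 2 in GD.
pose e := eps / (2 * Num.sqrt mu).
have e0 : 0 <= e by rewrite divr_ge0// mulr_ge0// ltW.
have eE : e ^+ 2 = eps ^+ 2 / mu / 4.
  by rewrite /e exprMn exprVn exprMn smE; field; rewrite gt_eqF.
have q2 : dotv (lam' - lam) (gvec P (xlag z lam') - gvec P x) <= 4 * e * D - 4 * D ^+ 2.
  have := xopt _ Xt; have := dualf_growth z lam'0 Xx.
  rewrite dualfE !LpE (enormC x) !dotvE.
  have -> : 4 * e * D = eps * enorm (xlag z lam' - x).
    by rewrite /e /D; field; rewrite gt_eqF.
  have -> : 4 * D ^+ 2 = mu * enorm (xlag z lam' - x) ^+ 2.
    by rewrite /D !exprMn smE; field.
  by lra.
have [] := gain_scalar a0 G0 GD e0 q1 q2; rewrite aE -/a2 in q3.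
by rewrite -wE aE eE -/a2 -/w => h1 h2 h3; rewrite /gain /lam'; split; lra.
Qed.

(** The first iterate solves no subproblem, so its inner error is its
    suboptimality [f(x0) - d(0, x0)], which the initial potential contains. *)
Lemma dual_gain0 x0 :
  let lam' := dual_step P tau 0 x0 in
  let a2 := enorm (lam' - 0) ^+ 2 / tau in
  let w := tau * enorm (dual_residual x0 0 x0) ^+ 2 in
  X x0 -> envv P x0 - dualf P lam' x0 <= (phi0 P x0 - flow P) / 2 - w / 6 - 3 / 8 * a2.
Proof.
move=> lam' a2 w Xx; have mu0 := mu_gt0.
have [[a0 aE] G0 GD q1 [q3 wE]] := gain_data x0 nonneg0 Xx.
have Xt : X (xlag x0 lam') by exact: xlag_X.
have lam'0 : nonneg_orthant lam' by exact: dual_step_ge0.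
have smE : Num.sqrt mu ^+ 2 = mu by rewrite sqr_sqrtr// ltW.
set D := Num.sqrt mu * _ / 2 in GD.
pose e := Lp P x0 x0 0 - dualf P 0 x0.
have q2 : dotv (lam' - 0) (gvec P (xlag x0 lam') - gvec P x0) <= e - 2 * D ^+ 2.
  have := dualf_le x0 0 Xt; have := dualf_growth x0 lam'0 Xx.
  rewrite /e (dualfE x0 lam') !LpE (enormC x0) subr0 !dotvE !dotv0l.
  have -> : 2 * D ^+ 2 = mu / 2 * enorm (xlag x0 lam' - x0) ^+ 2.
    by rewrite /D !exprMn smE; field.
  by lra.
rewrite aE -/a2 in q3; have := gain_scalar0 a0 G0 GD q1 q2; rewrite -wE aE -/a2 -/w /phi0 /e /lam'.
have : flow P <= dualf P 0 x0.
  rewrite dualfE LpE dotv0l addr0.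
  apply: le_trans (proxf_ge x0 (xlag_X x0 0)).
  by rewrite lerDl mulr_ge0 ?sqr_ge0// divr_ge0// ltW// p_gt0.
lra.
Qed.

Lemma potential_start x0 : X x0 ->
  [/\ 2 * (envv P x0 - dualf P 0 x0) <= phi0 P x0 - flow P,
      envv P x0 - flow P <= phi0 P x0 - flow P & 0 <= envv P x0 - flow P].
Proof.
move=> Xx; have p0 := p_gt0.
have := dualf_le x0 0 Xx; have := envv_ge x0.
have : 0 <= p / 2 * enorm (xprox x0 - x0) ^+ 2.
  by rewrite mulr_ge0 ?sqr_ge0// divr_ge0// ltW.
have : flow P <= dualf P 0 x0.
  rewrite dualfE LpE dotv0l addr0.
  apply: le_trans (proxf_ge x0 (xlag_X x0 0)).
  by rewrite lerDl mulr_ge0 ?sqr_ge0// divr_ge0// ltW.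
have := weak_duality nonneg0 (xprox_feas x0).
have := dualf_le x0 0 (xprox_X x0).
by rewrite /phi0 envvE !LpE !dotv0l => *; split; lra.
Qed.

Lemma gap_ge0 z lam : nonneg_orthant lam -> dualf P lam z <= envv P z.
Proof.
move=> lam0; have := dualf_le z lam (xprox_X z).
have := weak_duality lam0 (xprox_feas z).
by rewrite envvE LpE; lra.
Qed.

(** * Moving the centre *)

(** The envelope at the new centre is at most the value there of the old
    [x(z)], and the dual values are compared by quadratic growth. Both
    proximal terms undergo the same motion, so that their first-order
    changes cancel up to [<xi, x(z) - x~>]. *)
Lemma gap_move z xi lam th : 0 <= th -> nonneg_orthant lam ->
  envv P (z + th *: xi) - dualf P lam (z + th *: xi) <= envv P z - dualf P lam z
    + p * th * enorm xi * enorm (xprox z - xlag z lam)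
    + p ^+ 2 * th ^+ 2 / (2 * mu) * enorm xi ^+ 2.
Proof.
move=> th0 lam0; set z' := z + th *: xi; have p0 := p_gt0; have mu0 := mu_gt0.
have := envv_le z' (xprox_feas z).
have Xt' := xlag_X z' lam; have := dualf_growth z lam0 Xt'.
rewrite (dualfE z') (envvE z) !LpE /proxf !(prox_shift z z').
rewrite (_ : z' - z = th *: xi); last by rewrite /z' addrC addrA addNr add0r.
rewrite !dotvZl; move: (xlag z' lam) (xlag z lam) (xprox z) => xt' xt xh.
have := dotv_ge_enorm xi (xh - xt); have := dotv_ge_enorm xi (xt - xt').
rewrite !dotvE (enormC xt xt'); set b := enorm (xt' - xt); set y := enorm (xh - xt).
move=> h1 h2.
have k0 : (0 : R) < 1 / 2 by lra.
have := young (p * th * enorm xi) b mu0 k0.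
rewrite (_ : (p * th * enorm xi) ^+ 2 / mu / _ = p ^+ 2 * th ^+ 2 / (2 * mu) * enorm xi ^+ 2); last first.
  by field; rewrite gt_eqF.
have pth : 0 <= p * th by rewrite mulr_ge0 // ltW.
have := ler_wpM2l pth h1; have := ler_wpM2l pth h2.
lra.
Qed.

Lemma eps_opt_near z lam x eps : nonneg_orthant lam -> 0 <= eps ->
  eps_opt X (fun y => Lp P y z lam) mu eps x ->
  mu * enorm (x - xlag z lam) <= eps.
Proof.
move=> lam0 eps0 [Xx xopt]; have mu0 := mu_gt0.
have Xt := xlag_X z lam.
have := xopt _ Xt; have := dualf_growth z lam0 Xx.
rewrite dualfE enormC; set b := enorm _ => h1 h2.
have b0 : 0 <= b := enorm_ge0 _.
have [b00|bn] := eqVneq b 0; last first.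
  have bp : 0 < b by rewrite lt_neqAle eq_sym bn.
  by rewrite -(ler_pM2r bp); lra.
by rewrite b00 mulr0.
Qed.

(** The old [x(z)] is feasible for the new centre, and it is close to [x] up
    to [x(z) - x~] and the inner error. *)
Lemma envv_step z lam x eps th : 0 <= th <= 1 / 18 -> nonneg_orthant lam -> 0 <= eps ->
  eps_opt X (fun y => Lp P y z lam) mu eps x ->
  envv P (z + th *: (x - z)) <= envv P z - 35 / 36 * (p * th * enorm (x - z) ^+ 2)
    + p * th * enorm (x - z) * (enorm (xprox z - xlag z lam) + eps / mu).
Proof.
move=> /andP[th0 th1] lam0 eps0 xopt; set xi := x - z; have p0 := p_gt0; have mu0 := mu_gt0.
have near : enorm (x - xlag z lam) <= eps / mu.
  by rewrite ler_pdivlMr// mulrC; exact: eps_opt_near xopt.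
have := envv_le (z + th *: xi) (xprox_feas z).
rewrite (envvE z) /proxf (prox_shift z).
have -> : z + th *: xi - z = th *: xi by rewrite addrC addrA addNr add0r.
rewrite dotvZl enormZ exprMn real_normK ?num_real//.
set xh := xprox z; set xt := xlag z lam in near *.
have -> : xh - z = xi + (xh - x) by rewrite /xi (addrC (x - z)) addrA subrK.
have := dotv_ge_enorm xi (xh - x); rewrite dotvDr -enorm_sqr.
have := enorm_triangle xt xh x; rewrite (enormC xt).
set y := enorm (xh - xt) => h1 h2.
have h3 : enorm (xh - x) <= y + eps / mu by lra.
have h4 := ler_wpM2l (enorm_ge0 xi) h3.
have pth : 0 <= p * th by rewrite mulr_ge0 // ltW.
have h5 : - (enorm xi * (y + eps / mu)) <= dotv xi (xh - x) by lra.
have h6 := ler_wpM2l pth h5.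
have h7 : p * th * enorm xi ^+ 2 * th <= p * th * enorm xi ^+ 2 * (1 / 18).
  by apply: ler_wpM2l => //; rewrite mulr_ge0 ?sqr_ge0.
lra.
Qed.

(** * Bounds on the multipliers *)

Local Notation M := (Mlam P).
Local Notation gmin := (inf [set - g i (xfeas P) | i in [set: 'I_m]]).

Lemma gminP : 0 < gmin /\ forall i, gmin <= - g i (xfeas P).
Proof.
pose F i := - g i (xfeas P).
have [i0 _ i0min] := @arg_minP _ _ _ (Ordinal m_gt0) xpredT F erefl.
have -> : gmin = F i0.
  apply/eqP; rewrite eq_le; apply/andP; split.
    by apply: ge_inf; [exists (F i0) => _ [i _ <-]; exact: i0min|exists i0].
  by apply: lb_le_inf; [exists (F i0), i0|move=> _ [i _ <-]; exact: i0min].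
split; last by move=> i; exact: i0min.
by rewrite oppr_gt0; case: slater.
Qed.

Lemma Bf_ge0 : 0 <= cBf P.
Proof. exact: le_trans (enorm_ge0 _) (f_grad_bound X_xfeas). Qed.

Lemma Clam_ge0 : 0 <= Clam P.
Proof.
have D0 := diameter_ge0; have := Bf_ge0; have := p_gt0.
by move=> p0 b0; rewrite mulr_ge0// !addr_ge0// mulr_ge0// ltW.
Qed.

Lemma Mlam_ge : 2 * tau * B <= M.
Proof. by rewrite /Mlam le_max lexx. Qed.

Lemma Mlam_slater : Clam P + tau * B ^+ 2 <= M * gmin.
Proof.
have [g0 _] := gminP; rewrite -ler_pdivrMr// /Mlam le_max; apply/orP; right.
have t0 := tau_gt0; rewrite le_eqVlt; apply/orP; left; apply/eqP.
by field; rewrite !gt_eqF.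
Qed.

Lemma Mlam_gt0 : 0 < M.
Proof.
apply: lt_le_trans Mlam_ge.
by have := mulr_gt0 tau_gt0 B_gt0; lra.
Qed.

Lemma objective_gap x y : X x -> X y -> f x - f y <= cBf P * D.
Proof.
move=> Xx Xy.
have := @line_le _ _ f y (x - y) (cBf P * D) 0 f_diff.
rewrite (addrC y) subrK mul0r addr0; apply=> c /andP[c0 c1].
rewrite mul0r addr0; apply: le_trans (dotv_le_enorm _ _) _.
apply: ler_pM; rewrite ?enorm_ge0//; last exact: diameter_le.
by apply: f_grad_bound; apply: X_segment => //; rewrite !ltW.
Qed.

Lemma prox_gap x y z : X x -> X y -> X z ->
  proxf P z x - proxf P z y <= (cBf P + p * D) * D.
Proof.
move=> Xx Xy Xz; have := objective_gap Xx Xy; rewrite /proxf.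
have := diameter_le Xx Xz; have := enorm_ge0 (x - z).
have p0 := p_gt0; have D0 := diameter_ge0 => e0 eD.
have : enorm (x - z) ^+ 2 <= D ^+ 2 by rewrite lerXn2r ?nnegrE.
move=> h1 h2; have := ler_wpM2l (ltW p0) h1.
have : 0 <= p * enorm (y - z) ^+ 2 by rewrite mulr_ge0 ?sqr_ge0// ltW.
have : 0 <= p * D ^+ 2 by rewrite mulr_ge0 ?sqr_ge0// ltW.
lra.
Qed.

Lemma dotg_slater lam : nonneg_orthant lam ->
  dotv lam (gvec P (xfeas P)) <= - (gmin * enorm lam).
Proof.
move=> lam0; have [g0 gi] := gminP.
have : enorm lam <= \sum_i lam i 0.
  rewrite -(@ler_pXn2r _ 2) ?nnegrE ?enorm_ge0 ?sumr_ge0//.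
  rewrite enorm_sqr expr2 mulr_suml; apply: ler_sum => i _.
  apply: ler_wpM2l => //; rewrite (bigD1 i)//= lerDl; apply: sumr_ge0 => j _.
  exact: lam0.
move=> h; rewrite lerNr; apply: le_trans (ler_wpM2l (ltW g0) h) _.
rewrite mulr_sumr /dotv -sumrN; apply: ler_sum => i _; rewrite mxE.
by rewrite mulrC -mulrN; apply: ler_wpM2l (gi i).
Qed.

Lemma dual_step_sqr lam x :
  enorm (dual_step P tau lam x) ^+ 2 <= enorm (lam + tau *: gvec P x) ^+ 2.
Proof.
rewrite lerXn2r ?nnegrE ?enorm_ge0//; apply: enorm_le_coord => i; rewrite !mxE.
by case: (pospart_cases (lam i 0 + tau * g i x)) => -[h ->]; rewrite ?normr0.
Qed.

Lemma multiplier_bound0 x : X x -> enorm (dual_step P tau 0 x) <= M.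
Proof.
move=> Xx; have t0 := tau_gt0; have B0 := B_gt0.
have := dual_step_sqr 0 x; rewrite add0r ler_pXn2r ?nnegrE ?enorm_ge0// => h.
apply: le_trans h _; apply: le_trans Mlam_ge; rewrite enormZ gtr0_norm//.
have := ler_wpM2l (ltW t0) (gvec_le Xx); nra.
Qed.

(** When the multiplier is large, the Slater point makes the next step point
    inwards. *)
Lemma multiplier_bound z lam x eps : nonneg_orthant lam -> X z -> eps <= 1 ->
  eps_opt X (fun y => Lp P y z lam) mu eps x ->
  enorm lam <= M -> enorm (dual_step P tau lam x) <= M.
Proof.
move=> lam0 Xz eps1 [Xx xopt] lamM.
have t0 := tau_gt0; have B0 := B_gt0; have mu0 := mu_gt0.
have M0 := Mlam_gt0; have [g0 gi] := gminP; have C0 := Clam_ge0.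
have D0 := diameter_ge0.
have Xf := X_xfeas.
have inner : dotv lam (gvec P x) <= Clam P - gmin * enorm lam.
  have := xopt _ Xf; rewrite !LpE; have := dotg_slater lam0.
  have := prox_gap Xf Xx Xz; have := diameter_le Xf Xx.
  have := enorm_ge0 (xfeas P - x); set e := enorm (_ - x) => e0 eD h1 h2 h3.
  have : 0 <= mu / 2 * e ^+ 2 by rewrite mulr_ge0 ?sqr_ge0// divr_ge0// ltW.
  have : eps * e <= 1 * D by apply: le_trans (ler_wpM2r e0 eps1) _; rewrite !mul1r.
  by rewrite /Clam; lra.
have gB : gmin <= B.
  pose i0 : 'I_m := Ordinal m_gt0; apply: le_trans (gi i0) _.
  apply: le_trans (gvec_le Xf); apply: le_trans (enorm_coord_le _ i0).
  by rewrite mxE -normrN ler_norm.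
rewrite -(@ler_pXn2r _ 2) ?nnegrE ?enorm_ge0 ?(ltW M0)//.
apply: le_trans (dual_step_sqr lam x) _.
rewrite enormD_sqr dotvZr enormZ exprMn real_normK ?num_real//.
have gn : enorm (gvec P x) ^+ 2 <= B ^+ 2.
  by rewrite lerXn2r ?nnegrE ?enorm_ge0 ?gvec_le// ltW.
have h1 := ler_wpM2l (sqr_ge0 tau) gn; have h2 := ler_wpM2l (ltW t0) inner.
have h3 := ler_wpM2l (ltW t0) Mlam_slater.
set s := enorm lam in lamM inner h2 *; have s0 : 0 <= s := enorm_ge0 _.
have h5 : tau * (Clam P + tau * B ^+ 2) <= M ^+ 2 / 2.
  apply: le_trans h3 _; have := ler_wpM2l (ltW (mulr_gt0 t0 M0)) gB.
  have := ler_wpM2l (ltW M0) Mlam_ge; lra.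
(* a convex function of s, so bounded by its values at 0 and at M *)
have : M * (s ^+ 2 + 2 * tau * (Clam P - gmin * s) + tau ^+ 2 * B ^+ 2) <= M * M ^+ 2.
  have h6 : 0 <= (M - s) * (M ^+ 2 / 2 - tau * (Clam P + tau * B ^+ 2)).
    by rewrite mulr_ge0 ?subr_ge0.
  have h7 : 0 <= s * (tau * (M * gmin) - tau * (Clam P + tau * B ^+ 2)).
    by rewrite mulr_ge0 ?subr_ge0.
  have h8 : 0 <= M * s * (M - s) by rewrite (mulr_ge0 (mulr_ge0 (ltW M0) s0))// subr_ge0.
  have h9 : 0 <= M * (tau * B) ^+ 2 by apply: mulr_ge0 (ltW M0) _; exact: sqr_ge0.
  lra.
rewrite ler_pM2l// => h4; lra.
Qed.

(** * Approximate KKT points *)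

(** The multiplier of the KKT conditions is the mean of two successive ones:
    in each coordinate either the new one vanishes or their difference is
    [tau g_i(x)], and in both cases complementarity fails by at most a
    multiple of that difference. *)
Lemma KKT_of_step eps z lam x : nonneg_orthant lam ->
  approx_stationary X (fun y => Lp P y z lam) eps x ->
  let lam' := dual_step P tau lam x in
  let a2 := enorm (lam' - lam) ^+ 2 / tau in
  enorm lam <= M -> enorm lam' <= M ->
  forall e, eps + p * enorm (x - z) + Num.sqrt (mu * a2) / 4 <= e ->
    17 / 16 * (M ^+ 2 + 1) * a2 / tau <= e ^+ 2 -> eps_KKT P e x.
Proof.
move=> lam0 [Xx st] lam' a2 lM l'M e st_e comp_e.
have t0 := tau_gt0; have B0 := B_gt0; have mu0 := mu_gt0.
have M0 := Mlam_gt0; have p0 := p_gt0.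
have lam'0 : nonneg_orthant lam' by exact: dual_step_ge0.
pose d := enorm (lam' - lam); have d0 : 0 <= d := enorm_ge0 _.
have a2E : a2 = d ^+ 2 / tau by [].
have e0 : 0 <= e.
  apply: le_trans st_e; rewrite !addr_ge0 ?divr_ge0 ?sqrtr_ge0//.
    by apply: le_trans st; exact: dist_to_ge0.
  by rewrite mulr_ge0 ?enorm_ge0// ltW.
have comp : (M ^+ 2 + 1) * (17 / 16) * (d / tau) ^+ 2 <= e ^+ 2.
  have -> : (M ^+ 2 + 1) * (17 / 16) * (d / tau) ^+ 2 = 17 / 16 * (M ^+ 2 + 1) * a2 / tau.
    by rewrite a2E; field; rewrite gt_eqF.
  exact: comp_e.
(* its gradient differs from that at [lam] by [B |lam' - lam| / 2], whence the
   term in [sqrt (mu a2)] *)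
pose lb := 2^-1 *: (lam + lam').
have lbM : enorm lb <= M.
  by rewrite enormZ gtr0_norm//; have := enormD lam lam'; lra.
split=> //; exists lb; split.
- move=> i; rewrite !mxE; apply: mulr_ge0 => //.
  by apply: addr_ge0; [exact: lam0|exact: pospart_ge0].
- apply: le_trans st_e.
  have -> : - grad f x - \sum_i lb i 0 *: grad (g i) x =
      - Lgrad x z lam + (p *: (x - z) - 2^-1 *: (jacg P x *m (lam' - lam))).
    rewrite -jacgE /lb -scalemxAr mulmxDr mulmxBr /Lgrad.
    move: (jacg P x *m lam) (jacg P x *m lam') => J J'.
    by apply/matrixP => i j; rewrite !mxE; lra.
  rewrite -grad_Lp.
  apply: le_trans (dist_toD _ _ (normal_cone0 Xx)) _; rewrite -addrA.
  apply: lerD => //; apply: le_trans (enormB _ _) _.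
  rewrite !enormZ (gtr0_norm p0) gtr0_norm// lerD2l.
  have := jacg_le (lam' - lam) Xx; rewrite -/d => h.
  have -> : Num.sqrt (mu * a2) = 2 * B * d.
    have -> : mu * a2 = (2 * B * d) ^+ 2.
      have -> : mu = 4 * (tau * B ^+ 2) by rewrite tau_B; field.
      by rewrite a2E; field; rewrite gt_eqF.
    by rewrite sqrtr_sqr ger0_norm// !mulr_ge0// ltW.
  lra.
- rewrite -(@ler_pXn2r R 2) ?nnegrE ?enorm_ge0//; apply: le_trans comp.
  have : enorm (gpos P x) <= d / tau.
    rewrite ler_pdivlMr// mulrC.
    have -> : tau * enorm (gpos P x) = enorm (tau *: gpos P x) by rewrite enormZ gtr0_norm.
    apply: enorm_le_coord => i; rewrite !mxE.
    have := lam0 i; case: (pospart_cases (g i x)) => -[h1 ->].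
      by rewrite mulr0 normr0.
    move=> li; rewrite (_ : pospart _ = lam i 0 + tau * g i x).
      by rewrite addrAC subrr add0r.
    by rewrite /pospart max_l// addr_ge0// mulr_ge0// ltW.
  move=> le_d; have : enorm (gpos P x) ^+ 2 <= (d / tau) ^+ 2.
    by rewrite lerXn2r ?nnegrE ?enorm_ge0// (le_trans _ le_d)// enorm_ge0.
  move=> h; apply: le_trans h _.
  have := mulr_ge0 (sqr_ge0 M) (sqr_ge0 (d / tau)); have := sqr_ge0 (d / tau); lra.
- rewrite -(@ler_pXn2r R 2) ?nnegrE ?sumr_ge0//; apply: le_trans comp.
  pose v : 'cV[R]_m := \col_i (if lam' i 0 == 0 then tau * g i x / 2 else lb i 0).
  have le_v : \sum_i `|lb i 0 * g i x| <= enorm v * (d / tau).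
    have : dotv (\col_i `|v i 0|) (\col_i `|(lam' - lam) i 0|) / tau <= enorm v * (d / tau).
      rewrite mulrA ler_pM2r ?invr_gt0//; apply: le_trans (dotv_le_enorm _ _) _.
      apply: ler_pM; rewrite ?enorm_ge0//; apply: enorm_le_coord => i;
        by rewrite [in leLHS]mxE normr_id.
    apply: le_trans; rewrite /dotv mulr_suml; apply: ler_sum => i _; rewrite !mxE.
    rewrite ler_pdivlMr//; exact: complementarity_scalar.
  apply: (@le_trans _ _ ((enorm v * (d / tau)) ^+ 2)).
    have s0 : 0 <= \sum_i `|lb i 0 * g i x| by apply: sumr_ge0.
    by rewrite lerXn2r ?nnegrE// (le_trans s0).
  rewrite exprMn ler_wpM2r ?sqr_ge0//.
  have : enorm v ^+ 2 <= enorm lb ^+ 2 + (tau / 2) ^+ 2 * enorm (gvec P x) ^+ 2.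
    rewrite !enorm_sqr /dotv mulr_sumr -big_split; apply: ler_sum => i _.
    rewrite !mxE /=; case: ifP => _.
      have := sqr_ge0 (2^-1 * (lam i 0 + pospart (lam i 0 + tau * g i x))); lra.
    have := sqr_ge0 (tau / 2 * g i x); lra.
  have := gvec_le Xx; have gx0 := enorm_ge0 (gvec P x) => gB.
  have : (tau * enorm (gvec P x)) ^+ 2 <= (M / 2) ^+ 2.
    have tg0 : 0 <= tau * enorm (gvec P x) by apply: mulr_ge0 => //; exact: ltW.
    have M20 : 0 <= M / 2 by rewrite divr_ge0// ltW.
    rewrite lerXn2r ?nnegrE//.
    by have := Mlam_ge; have := ler_wpM2l (ltW t0) gB; lra.
  have : enorm lb ^+ 2 <= M ^+ 2 by rewrite lerXn2r ?nnegrE ?enorm_ge0 ?(ltW M0).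
  have := sqr_ge0 M; lra.
Qed.

(** * Distance between the primal and the dual minimizers *)

Local Notation NX := (normal_cone X).
Local Notation NR := (normal_cone (@nonneg_orthant R m)).

Lemma residual_primal z lam :
  dist_to (- grad f (xlag z lam) - jacg P (xlag z lam) *m lam)
    (NX (xlag z lam)) <= p * enorm (xlag z lam - z).
Proof.
set xt := xlag z lam; have p0 := p_gt0.
have Xs : segment_closed X by exact: X_segment.
have := argmin_normal (differentiable_Lp z lam xt) Xs (xlagP z lam).
rewrite grad_Lp => Nx; apply: le_trans (dist_to_le _ Nx) _.
have -> : - grad f xt - jacg P xt *m lam - - Lgrad xt z lam = p *: (xt - z).
  rewrite /Lgrad; move: (jacg P xt *m lam) => J.
  by apply/matrixP => i j; rewrite !mxE; ring.
by rewrite enormZ gtr0_norm.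
Qed.

Lemma residual_normal z lam x (lam' := dual_step P tau lam x) :
  NR lam' (gvec P (xlag z lam') - dual_residual z lam x).
Proof.
have t0 := tau_gt0; have [l0 h] := dual_step_normal lam x.
split=> // y y0; have := h y y0.
have -> : gvec P (xlag z lam') - dual_residual z lam x =
    tau^-1 *: (lam + tau *: gvec P x - lam').
  rewrite /dual_residual -/lam'; apply/matrixP => i j; rewrite !mxE.
  by field; rewrite gt_eqF.
by rewrite dotvZl => h'; rewrite pmulr_rle0// invr_gt0.
Qed.

Lemma residual_dual z lam x :
  dist_to (gvec P (xlag z (dual_step P tau lam x))) (NR (dual_step P tau lam x))
    <= enorm (dual_residual z lam x).
Proof.
apply: le_trans (dist_to_le _ (residual_normal z lam x)) _.
by rewrite opprB addrC subrK.
Qed.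

(** The point [x~] violates each constraint by at most the dual residual.
    Moving it towards the Slater point by a fraction of the same order makes
    it feasible, so the primal and dual values differ by a multiple of the
    residual; strong convexity turns this into a bound on a square. *)
Lemma slater_drift z lam x : X z -> enorm (dual_step P tau lam x) <= M ->
  mu * enorm (xprox z - xlag z (dual_step P tau lam x)) ^+ 2 <=
    2 * M * enorm (dual_residual z lam x).
Proof.
set lam' := dual_step P tau lam x => Xz lM.
have mu0 := mu_gt0; have M0 := Mlam_gt0; have [g0 gi] := gminP.
have t0 := tau_gt0.
have l'0 : nonneg_orthant lam' by exact: dual_step_ge0.
set xt := xlag z lam'; set xh := xprox z; set om := enorm (dual_residual z lam x).
have Xt : X xt by exact: xlag_X. have Xh : X xh by exact: xprox_X.
have Xf := X_xfeas.
have om0 : 0 <= om := enorm_ge0 _.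
have NRo := residual_normal z lam x; rewrite -/lam' -/xt in NRo.
have inner : - (M * om) <= dotv lam' (gvec P xt).
  have := normal_orthant0 NRo; rewrite dotvDl dotvNl (dotvC _ lam') (dotvC _ lam').
  have := dotv_ge_enorm lam' (dual_residual z lam x); rewrite -/om -/xt.
  have := ler_wpM2r om0 lM; lra.
have dual : mu / 2 * enorm (xh - xt) ^+ 2 - M * om <= proxf P z xh - proxf P z xt.
  have := dualf_growth z l'0 Xh; rewrite dualfE -/xt !LpE.
  have := weak_duality l'0 (xprox_feas z); lra.
(* the smallest weight that makes the combination feasible *)
pose a := om / (om + gmin).
have og : 0 < om + gmin by lra.
have a0 : 0 <= a by rewrite divr_ge0// ltW.
have a1 : a <= 1 by rewrite ler_pdivrMr// mul1r; lra.
have a01 : 0 <= a <= 1 by rewrite a0.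
pose xc := xt + a *: (xfeas P - xt).
have Xc : X xc by exact: X_segment.
have gle i : g i xt <= om.
  have h : 0 <= - (gvec P xt - dual_residual z lam x) i 0.
    case: NRo => _ /(_ (lam' + delta_mx i 0)); rewrite addrAC subrr add0r dotv_delta.
    rewrite oppr_ge0; apply=> j; rewrite [_ j 0]mxE addr_ge0 ?l'0//.
    by rewrite mxE; case: eqP.
  have := enorm_coord_le (dual_residual z lam x) i; rewrite -/om ler_norml => /andP[_].
  by move: h; rewrite !mxE; lra.
have Fc : feasible P xc.
  split=> // i; have : strongly_convex X (g i) 0.
    apply: (@strongly_convex_grad _ _ _ _ (grad (g i))); first exact: X_segment.
    move=> u v Xu Xv; rewrite !mul0r addr0.
    have := @convex_grad_le _ _ _ u v (@g_diff i u) (@g_convex i); lra.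
  move=> [_ /(_ _ _ _ Xt Xf a01)]; rewrite -/xc !mul0r subr0 => h.
  apply: le_trans h _; have ga : a * om + a * gmin = om.
    by rewrite -mulrDr /a divfK// gt_eqF.
  have := ler_wpM2l a0 (gi i); have : 0 <= 1 - a by lra.
  move=> h1; have := ler_wpM2l h1 (gle i); lra.
have [_ Fsc] : strongly_convex X (proxf P z) mu.
  by rewrite proxf_Lp; apply: Lp_strongly_convex => //; exact: nonneg0.
have h1 := Fsc _ _ _ Xt Xf a01; rewrite -/xc in h1.
have h2 := argmin_growth (ltW mu0) (proxf_strongly_convex z) (xproxP z) Fc.
have h3 : enorm (xc - xh) ^+ 2 = (1 - a) * enorm (xh - xt) ^+ 2
    + a * enorm (xfeas P - xh) ^+ 2 - a * (1 - a) * enorm (xfeas P - xt) ^+ 2.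
  rewrite (enormC xh) (_ : xc - xh = (1 - a) *: (xt - xh) + a *: (xfeas P - xh)); last first.
    by rewrite /xc; apply/matrixP => i j; rewrite !mxE; ring.
  rewrite (_ : xfeas P - xt = (xfeas P - xh) - (xt - xh)); last first.
    by rewrite opprB addrA subrK.
  rewrite (enormB_sqr (xfeas P - xh)) (enormD_sqr ((1 - a) *: _)) !enormZ !exprMn !real_normK ?num_real//.
  by rewrite dotvZl dotvZr (dotvC (xt - xh)); ring.
rewrite -/xh h3 in h2.
have h4 := prox_gap Xf Xh Xz.
have D0 := diameter_ge0.
have h5 : proxf P z (xfeas P) - proxf P z xh <= M * gmin.
  apply: le_trans h4 _; apply: le_trans Mlam_slater.
  rewrite /Clam; have := mulr_ge0 (ltW t0) (sqr_ge0 B); lra.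
have h6 : (1 - a) * (proxf P z xh - proxf P z xt) <= a * (M * gmin)
    - mu / 2 * (1 - a) * enorm (xh - xt) ^+ 2.
  have := ler_wpM2l a0 h5.
  have : 0 <= mu / 2 * (a * enorm (xfeas P - xh) ^+ 2).
    apply: mulr_ge0; first by rewrite divr_ge0// ltW.
    by apply: mulr_ge0 => //; exact: sqr_ge0.
  lra.
have h7 : 0 <= 1 - a by lra.
have h8 := ler_wpM2l h7 dual.
have aE : 1 - a = gmin / (om + gmin) by rewrite /a; field; rewrite gt_eqF.
have h9 : (1 - a) * (mu * enorm (xh - xt) ^+ 2) <= (1 - a) * (2 * M * om).
  have : a * gmin = (1 - a) * om by rewrite aE /a; field; rewrite gt_eqF.
  move=> h; have : a * (M * gmin) = (1 - a) * (M * om) by rewrite mulrCA h; ring.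
  lra.
by move: h9; rewrite aE ler_pM2l// divr_gt0.
Qed.

Lemma cK_ge : p <= cK P.
Proof.
rewrite /cK lerDr addr_ge0// !mulr_ge0 ?sqrtr_ge0// ltW//; exact: Mlam_gt0.
Qed.

Lemma Cd_gt0 : 0 < cgamma P -> 0 < Cd P.
Proof.
move=> ga; rewrite /Cd divr_gt0 ?mu_gt0// mulr_gt0 ?powR_gt0//.
exact: lt_le_trans p_gt0 cK_ge.
Qed.

(** Young's inequality with exponent [d] absorbs the power of the residual
    that comes from the error bound into its square; the remainder is what
    the condition of [theta(eps)] involving [eps] makes small. For [d = 1]
    the two squares are compared directly. *)
Lemma young_error_bound (e th r u : R) : 0 < cgamma P -> 1 <= cd P -> 0 < e -> 0 < th ->
  th <= theta_hat P -> (cd P != 1 -> th <= (e ^+ 2 / (2 * cAd P)) `^ (cd P - 1)) ->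
  0 <= r <= u ->
  p * th * (Cd P * r `^ (2 / cd P)) <= tau * u ^+ 2 / 12 + th * e ^+ 2 / (288 * p).
Proof.
move=> ga d1 e0 th0 th1 th2 /andP[r0 ru].
have p0 := p_gt0; have t0 := tau_gt0; have C0 := Cd_gt0 ga.
have u0 : 0 <= u by exact: le_trans ru.
have d0 : 0 < cd P by exact: lt_le_trans d1.
have pC : 0 < p * Cd P by rewrite mulr_gt0.
have pCt : 0 < p * Cd P * th by rewrite mulr_gt0.
have rle : r `^ (2 / cd P) <= (u ^+ 2) `^ (cd P)^-1.
  rewrite -powR_mulrn// -powRrM; apply: ge0_ler_powR; rewrite ?nnegrE//.
  by rewrite divr_ge0// ltW.
apply: (@le_trans _ _ (p * th * (Cd P * (u ^+ 2) `^ (cd P)^-1))).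
  by apply: ler_wpM2l; [rewrite mulr_ge0// ltW|apply: ler_wpM2l => //; exact: ltW].
have e2 : 0 <= th * e ^+ 2 / (288 * p).
  apply: divr_ge0; first exact: mulr_ge0 (ltW th0) (sqr_ge0 e).
  exact: mulr_ge0 (ler0n R 288) (ltW p0).
have [d1E|dn1] := eqVneq (cd P) 1.
  rewrite d1E invr1 powRr1 ?sqr_ge0//.
  have : th * (12 * p * Cd P) <= tau.
    rewrite -ler_pdivlMr; last by rewrite -mulrA mulr_gt0.
    by move: th1; rewrite /theta_hat d1E invr1 subrr powRr0 mulr1.
  move=> h; have := ler_wpM2r (sqr_ge0 u) h; lra.
have {}th2 := th2 dn1.
have d1' : 0 < cd P - 1 by rewrite subr_gt0 lt_neqAle eq_sym dn1.
have A0 : 0 < cAd P.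
  rewrite /cAd; apply: mulr_gt0; last by rewrite powR_gt0// -mulrA mulr_gt0.
  apply: mulr_gt0; last by rewrite powR_gt0// divr_gt0// mulr_gt0.
  by rewrite !mulr_gt0// subr_gt0 invf_lt1// -subr_gt0.
(* the conjugate exponent *)
pose d' := cd P / (cd P - 1).
have dd' : (cd P)^-1 + d'^-1 = 1.
  by rewrite /d' invf_div; field; rewrite !gt_eqF.
(* [k] makes the first term of Young's inequality equal to [tau u^2 / 2]; the
   factor 6 in [b] divides it down to [tau u^2 / 12]. *)
pose k := tau * cd P / 2; have k0 : 0 < k by rewrite divr_gt0// mulr_gt0.
pose a := (k * u ^+ 2) `^ (cd P)^-1.
pose b := 6 * p * Cd P * th / k `^ (cd P)^-1.
have kp : 0 < k `^ (cd P)^-1 by rewrite powR_gt0.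
have b0 : 0 < b.
  rewrite /b divr_gt0//.
  have -> : 6 * p * Cd P * th = 6 * (p * Cd P * th) by ring.
  by rewrite mulr_gt0.
have d'0 : 0 < d' by rewrite divr_gt0.
have := conjugate_powR (powR_ge0 _ _ : 0 <= a) (ltW b0) d0 d'0 dd'.
have -> : a * b = 6 * (p * th * (Cd P * (u ^+ 2) `^ (cd P)^-1)).
  rewrite /a /b (powRM _ (ltW k0) (sqr_ge0 u)).
  by field; rewrite gt_eqF.
have -> : a `^ cd P / cd P = tau * u ^+ 2 / 2.
  rewrite /a -powRrM mulVf ?gt_eqF// powRr1 ?(mulr_ge0 (ltW k0) (sqr_ge0 u))//.
  by rewrite /k; field; rewrite gt_eqF.
have d'E : d' = 1 + (cd P - 1)^-1 by rewrite /d'; field; rewrite gt_eqF.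
have bE : b `^ d' / d' = cAd P * (th * th `^ (cd P - 1)^-1) / (24 * p).
  have pC6 : 0 <= 6 * p * Cd P by rewrite -mulrA mulr_ge0// ltW.
  have -> : b = 6 * p * Cd P * (th * k^-1 `^ (cd P)^-1).
    have kV : k `^ (cd P)^-1 * k^-1 `^ (cd P)^-1 = 1.
      by rewrite -powRM ?invr_ge0 ?(ltW k0)// divff ?powR1// gt_eqF.
    rewrite /b mulrA; apply: (@mulIf _ (k `^ (cd P)^-1)); first by rewrite gt_eqF.
    by rewrite divfK ?gt_eqF// -[RHS]mulrA [X in _ = _ * X]mulrC kV mulr1.
  have c0 : 0 <= k^-1 `^ (cd P)^-1 by exact: powR_ge0.
  rewrite (powRM d' pC6 (mulr_ge0 (ltW th0) c0)) (powRM d' (ltW th0) c0) -powRrM.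
  have -> : th `^ d' = th * th `^ (cd P - 1)^-1.
    by rewrite d'E powRD ?powRr1 ?(ltW th0)// (gt_eqF th0) implybT.
  have -> : (cd P)^-1 * d' = (cd P - 1)^-1 by rewrite /d'; field; rewrite !gt_eqF.
  have -> : k^-1 = 2 / (tau * cd P) by rewrite /k invf_div.
  have d'V : 1 - (cd P)^-1 = d'^-1 by rewrite -dd' addrAC subrr add0r.
  by rewrite /cAd -/d' d'V; field; rewrite !gt_eqF.
rewrite bE.
have thle : th `^ (cd P - 1)^-1 <= e ^+ 2 / (2 * cAd P).
  have X0 : 0 <= e ^+ 2 / (2 * cAd P) by rewrite divr_ge0 ?sqr_ge0// mulr_ge0// ltW.
  have -> : e ^+ 2 / (2 * cAd P) = (e ^+ 2 / (2 * cAd P)) `^ (cd P - 1) `^ (cd P - 1)^-1.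
    by rewrite -powRrM divff ?gt_eqF// powRr1.
  by apply: ge0_ler_powR; rewrite ?nnegrE ?powR_ge0 ?invr_ge0 ?(ltW d1') ?(ltW th0).
have A1 : cAd P * (th * th `^ (cd P - 1)^-1) / (24 * p) <= th * e ^+ 2 / (48 * p).
  have -> : th * e ^+ 2 / (48 * p) = cAd P * (th * (e ^+ 2 / (2 * cAd P))) / (24 * p).
    by field; rewrite !gt_eqF.
  rewrite ler_pM2r ?invr_gt0 ?mulr_gt0//.
  by apply: ler_wpM2l; [exact: ltW|apply: ler_wpM2l => //; exact: ltW].
have : th * e ^+ 2 / (288 * p) = th * e ^+ 2 / (48 * p) / 6 by field; rewrite gt_eqF.
lra.
Qed.

(** If the residuals are small, the property of [R(delta)] and
    [young_error_bound] apply. If not, the dual residual or [|x~ - z|] is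
    bounded below, so that the weaker bound of [slater_drift] suffices, by
    the third term in the minimum that defines the step size. *)
Lemma center_drift (N t : nat) (e th : R) (eps : nat -> R)
    (x z : nat -> 'cV[R]_n) (lam : nat -> 'cV[R]_m) :
  0 < cgamma P -> 1 <= cd P -> 0 < cR P -> R_property P (cR P) ->
  (forall s, 0 < eps s < 1) ->
  imela_run P N (fun=> tau) (fun=> th) eps x z lam -> (t < N)%N ->
  X (z t) -> enorm (lam t.+1) <= M -> nonneg_orthant (lam t.+1) ->
  0 < e -> 0 < th -> th <= theta_tilde P ->
  (cd P != 1 -> th <= (e ^+ 2 / (2 * cAd P)) `^ (cd P - 1)) ->
  p * th * enorm (xprox (z t) - xlag (z t) (lam t.+1)) ^+ 2 <=
    tau * enorm (dual_residual (z t) (lam t) (x t)) ^+ 2 / 12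
    + (p * th * enorm (x t.+1 - z t) ^+ 2 + p * th * (eps t ^+ 2 / mu ^+ 2)) / 72
    + th * e ^+ 2 / (288 * p).
Proof.
move=> ga d1 R0 Rp eps01 run tN Xz lM l0 e0 th0 th_tilde th_e.
have p0 := p_gt0; have mu0 := mu_gt0; have t0 := tau_gt0.
have M0 := Mlam_gt0.
move: th_tilde; rewrite /theta_tilde !le_min => /and4P[th1 th2 th3 th4].
have /andP[epst _] := eps01 t.
case: (run) => _ _ _ /(_ t tN) [lamE st _].
set xt := xlag (z t) (lam t.+1); set om := enorm (dual_residual _ _ _).
set xi := enorm (x t.+1 - z t).
have om0 : 0 <= om := enorm_ge0 _.
have rd : dist_to (gvec P xt) (NR (lam t.+1)) <= om.
  by rewrite /om /xt lamE; exact: residual_dual.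
have rd0 := dist_to_ge0 (gvec P xt) (NR (lam t.+1)).
have e2 : 0 <= th * e ^+ 2 / (288 * p).
  apply: divr_ge0; first exact: mulr_ge0 (ltW th0) (sqr_ge0 e).
  exact: mulr_ge0 (ler0n R 288) (ltW p0).
have pth : 0 < p * th by rewrite mulr_gt0.
have xi2 : 0 <= p * th * xi ^+ 2 + p * th * (eps t ^+ 2 / mu ^+ 2).
  by rewrite addr_ge0// mulr_ge0 ?divr_ge0 ?sqr_ge0 ?ltW.
have := Rp N t th eps x z lam xt (xprox (z t)) _ eps01 run tN
  (xlagP _ _) (xproxP _).
rewrite th0 th1 => /(_ isT).
set pd := dist_to _ (NX xt) ^+ 2 + _; have [small|large] := lerP pd (cR P ^+ 2).
  move=> /(_ isT) h; have h' := ler_wpM2l (ltW pth) h; apply: le_trans h' _.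
  have rr : 0 <= dist_to (gvec P xt) (NR (lam t.+1)) <= om by rewrite rd0 rd.
  have := young_error_bound ga d1 e0 th0 th4 th_e rr; lra.
move=> _.
have rp : dist_to (- grad f xt - jacg P xt *m lam t.+1) (NX xt) <= p * enorm (xt - z t).
  exact: residual_primal.
have rp0 := dist_to_ge0 (- grad f xt - jacg P xt *m lam t.+1) (NX xt).
have {large} large : cR P ^+ 2 <= p ^+ 2 * enorm (xt - z t) ^+ 2 + om ^+ 2.
  apply: le_trans (ltW large) _; rewrite -exprMn; apply: lerD.
    by rewrite lerXn2r ?nnegrE// (le_trans rp0).
  by rewrite lerXn2r ?nnegrE.
have near : enorm (xt - z t) ^+ 2 <= 2 * xi ^+ 2 + 2 * (eps t ^+ 2 / mu ^+ 2).
  have := eps_opt_near l0 (ltW epst) (approx_stationary_Lp l0 st).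
  rewrite mulrC -ler_pdivlMr// -/xt enormC => h.
  have h2 : enorm (xt - x t.+1) ^+ 2 <= eps t ^+ 2 / mu ^+ 2.
    by rewrite -expr_div_n lerXn2r ?nnegrE ?enorm_ge0// divr_ge0// ltW.
  have := enorm_triangle (x t.+1) xt (z t); rewrite -/xi => h3.
  have h4 : enorm (xt - z t) ^+ 2 <= (enorm (xt - x t.+1) + xi) ^+ 2.
    by rewrite lerXn2r ?nnegrE ?enorm_ge0// addr_ge0// enorm_ge0.
  have := sqr_ge0 (enorm (xt - x t.+1) - xi); lra.
have := @slater_drift _ (lam t) (x t) Xz; rewrite -lamE => /(_ lM).
rewrite -/xt -/om; set y2 := enorm (_ - xt) ^+ 2 => drift.
pose k := p * th * (2 * M / mu).
have ky : p * th * y2 <= k * om.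
  have -> : k * om = p * th * (2 * M * om / mu) by rewrite /k; ring.
  by rewrite ler_wpM2l ?(ltW pth)// ler_pdivlMr// mulrC.
have k24 : (0 : R) < 1 / 24 by lra.
have := young k om t0 k24.
have -> : 1 / 24 * (tau * om ^+ 2) + k ^+ 2 / tau / (4 * (1 / 24)) =
   tau * om ^+ 2 / 24 + th * (24 * p ^+ 2 * M ^+ 2 / (mu ^+ 2 * tau) * th).
  by rewrite /k; field; rewrite !gt_eqF.
move=> h1.
have c0 : 0 <= 24 * p ^+ 2 * M ^+ 2 / (mu ^+ 2 * tau).
  apply: divr_ge0; last by apply: mulr_ge0; [exact: sqr_ge0|exact: ltW].
  by apply: mulr_ge0; [apply: mulr_ge0 => //|]; exact: sqr_ge0.
have h2 := ler_wpM2l c0 th3.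
have E : 24 * p ^+ 2 * M ^+ 2 / (mu ^+ 2 * tau) * (cR P ^+ 2 * mu ^+ 2 * tau
   / (2 * 12 ^+ 3 * p ^+ 3 * M ^+ 2)) = cR P ^+ 2 / (144 * p).
  by field; rewrite !gt_eqF.
rewrite E in h2.
have h3 : cR P ^+ 2 / (144 * p) <= p * enorm (xt - z t) ^+ 2 / 144 + om ^+ 2 / (144 * p).
  have -> : p * enorm (xt - z t) ^+ 2 / 144 + om ^+ 2 / (144 * p) =
     (p ^+ 2 * enorm (xt - z t) ^+ 2 + om ^+ 2) / (144 * p) by field; rewrite gt_eqF.
  by rewrite ler_pM2r ?invr_gt0 ?mulr_gt0.
have h4 := ler_wpM2l (ltW th0) (le_trans h2 h3).
have h5 : th * (om ^+ 2 / (144 * p)) <= tau * om ^+ 2 / 24.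
  have -> : tau * om ^+ 2 / 24 = 6 * p * tau * (om ^+ 2 / (144 * p)) by field; rewrite gt_eqF.
  apply: ler_wpM2r th2; apply: divr_ge0 (sqr_ge0 _) _.
  by apply: mulr_ge0 => //; exact: ltW.
have h6 := ler_wpM2l (ltW pth) near.
lra.
Qed.

(** * Numerical constants of the algorithm *)

Lemma theta_hat_gt0 : 0 < cgamma P -> 0 < theta_hat P.
Proof.
move=> ga; have t0 := tau_gt0; have p0 := p_gt0.
have C0 := Cd_gt0 ga.
have p12 : 0 < 12 * p by rewrite mulr_gt0.
rewrite /theta_hat; apply: mulr_gt0; last by apply: powR_gt0; exact: divr_gt0.
by apply: divr_gt0 => //; exact: mulr_gt0.
Qed.

Lemma theta_tilde_gt0 : 0 < cgamma P -> 0 < cR P -> 0 < theta_tilde P.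
Proof.
move=> ga R0; have t0 := tau_gt0; have p0 := p_gt0; have mu0 := mu_gt0.
have M0 := Mlam_gt0.
rewrite /theta_tilde !lt_min theta_hat_gt0// andbT; apply/and3P; split.
- by rewrite divr_gt0// mulr_gt0.
- by apply: mulr_gt0 => //; rewrite mulr_gt0.
- apply: divr_gt0; last by rewrite !mulr_gt0// exprn_gt0.
  by apply: mulr_gt0 => //; rewrite mulr_gt0// exprn_gt0.
Qed.

Lemma cAd_gt0 : 0 < cgamma P -> 1 < cd P -> 0 < cAd P.
Proof.
move=> ga d1; have t0 := tau_gt0; have p0 := p_gt0.
have C0 := Cd_gt0 ga; have d0 : 0 < cd P by exact: lt_trans d1.
rewrite /cAd; apply: mulr_gt0; last by apply: powR_gt0; apply: mulr_gt0 => //; rewrite mulr_gt0.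
apply: mulr_gt0; last first.
  by apply: powR_gt0; apply: divr_gt0 => //; exact: mulr_gt0.
by rewrite !mulr_gt0// subr_gt0 invf_lt1.
Qed.

Lemma theta_eps_gt0 eps : 0 < cgamma P -> 0 < cR P -> 1 <= cd P -> 0 < eps ->
  0 < theta_eps P eps.
Proof.
move=> ga R0 d1 e0; have t0 := tau_gt0; have p0 := p_gt0.
have th0 : 0 < Num.min (theta_tilde P) (6 * p * tau / (M ^+ 2 + 1)).
  rewrite lt_min theta_tilde_gt0//; apply: divr_gt0.
    by apply: mulr_gt0 => //; rewrite mulr_gt0.
  by rewrite ltr_wpDl ?sqr_ge0.
rewrite /theta_eps; case: eqVneq => [//|dn]; rewrite lt_min th0; apply: powR_gt0.
rewrite divr_gt0 ?exprn_gt0// mulr_gt0// cAd_gt0//.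
by rewrite lt_neqAle eq_sym dn.
Qed.

Lemma theta_eps_le eps : [/\ theta_eps P eps <= theta_tilde P,
  theta_eps P eps <= 6 * p * tau / (M ^+ 2 + 1) &
  cd P != 1 -> theta_eps P eps <= (eps ^+ 2 / (2 * cAd P)) `^ (cd P - 1)].
Proof.
rewrite /theta_eps; set th := Num.min (theta_tilde P) _.
have h1 : th <= theta_tilde P by rewrite ge_min lexx.
have h2 : th <= 6 * p * tau / (M ^+ 2 + 1) by rewrite ge_min lexx orbT.
case: eqVneq => // dn; split=> [||_]; last by rewrite ge_min lexx orbT.
- by rewrite (le_trans _ h1)// ge_min lexx.
- by rewrite (le_trans _ h2)// ge_min lexx.
Qed.

(** * Existence of an approximate KKT iterate *)

Section Run.
Variables (T : nat) (th eps : R) (x z : nat -> 'cV[R]_n) (lam : nat -> 'cV[R]_m).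
Hypothesis c_range : 0 < cc P < 1.
Hypothesis th0 : 0 < th.
Hypothesis th_le : th <= mu / (18 * p).
Hypothesis run : imela_run P T (fun=> tau) (fun=> th) (tol P) x z lam.

Lemma tol_range s : 0 < tol P s < 1.
Proof.
move: c_range => /andP[c0 c1]; rewrite /tol divr_gt0//= ltr_pdivrMr// mul1r.
by apply: lt_le_trans c1 _; rewrite ler1n.
Qed.

Lemma th_le18 : 0 <= th <= 1 / 18.
Proof.
rewrite ltW//=; apply: le_trans th_le _.
have p0 := p_gt0; have := mu_le_p.
by rewrite ler_pdivrMr ?mulr_gt0//; lra.
Qed.

Lemma run_step t : (t < T)%N -> [/\ lam t.+1 = dstep (lam t) (x t),
  approx_stationary X (fun y => Lp P y (z t) (lam t.+1)) (tol P t) (x t.+1) &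
  z t.+1 = z t + th *: (x t.+1 - z t)].
Proof. by case: run => _ _ _; apply. Qed.

Lemma run_bounds t : (t <= T)%N ->
  [/\ X (x t), X (z t), nonneg_orthant (lam t) & enorm (lam t) <= M] /\
  enorm (dstep (lam t) (x t)) <= M.
Proof.
have M0 := Mlam_gt0; have /andP[th1 th2] := th_le18.
elim: t => [_|t IH tT].
  case: run => Xx -> -> _; split; last exact: multiplier_bound0.
  by split=> //; [exact: nonneg0|rewrite enorm0 ltW].
have [[Xx Xz l0 lM] l'M] := IH (ltnW tT).
have [lE st zE] := run_step tT.
have l'0 : nonneg_orthant (lam t.+1) by rewrite lE; exact: dual_step_ge0.
have Xx' : X (x t.+1) by case: st.
have l'M' : enorm (lam t.+1) <= M by rewrite lE.
split.
  split=> //; rewrite zE; apply: X_segment => //.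
  by rewrite th1 (le_trans th2)//; lra.
apply: (multiplier_bound l'0 Xz _ (approx_stationary_Lp l'0 st) l'M').
by have /andP[_ /ltW] := tol_range t.
Qed.

(** The inner problem was solved for the centre [z^t], the next multiplier
    step is analysed at [z^(t+1)]. *)
Lemma run_opt t : (t < T)%N ->
  eps_opt X (fun y => Lp P y (z t.+1) (lam t.+1)) mu
    (tol P t + p * (th * enorm (x t.+1 - z t))) (x t.+1).
Proof.
move=> tT; have [lE st zE] := run_step tT.
have [[_ _ l0 _] _] := run_bounds tT.
have := eps_opt_center (z t.+1) (approx_stationary_Lp l0 st).
rewrite (_ : z t.+1 - z t = th *: (x t.+1 - z t)).
  by rewrite enormZ gtr0_norm.
by rewrite zE addrC addrA addNr add0r.
Qed.

(** The triangle inequality, then Cauchy-Schwarz. *)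
Lemma center_travel t : (t <= T)%N ->
  p * enorm (z t - z 0%N) ^+ 2 <=
    th ^+ 2 * (t%:R * \sum_(0 <= j < t) (p * enorm (x j.+1 - z j) ^+ 2)).
Proof.
have p0 := p_gt0.
have tri k : (k <= T)%N -> enorm (z k - z 0%N) <=
    th * \sum_(0 <= j < k) enorm (x j.+1 - z j).
  elim: k => [_|k IH kT]; first by rewrite subrr enorm0 big_geq// mulr0.
  have [_ _ zE] := run_step kT; rewrite big_nat_recr//= mulrDr.
  apply: le_trans (enorm_triangle (z k) _ _) _; rewrite addrC.
  apply: lerD; first exact: IH (ltnW kT).
  by rewrite zE addrC addrA addNr add0r enormZ gtr0_norm.
have cs (e : nat -> R) k : (\sum_(0 <= j < k) e j) ^+ 2 <= k%:R * \sum_(0 <= j < k) e j ^+ 2.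
  elim: k => [|k IH]; first by rewrite !big_geq// expr0n mul0r.
  rewrite !big_nat_recr//= -(natr1 k); set S := \sum_(_ <= _ < _) _ in IH *.
  set Q := \sum_(_ <= _ < _) _ in IH *.
  have h : 2 * S * e k <= Q + k%:R * e k ^+ 2.
    have [k0|k0] := eqVneq k 0%N; last first.
      have kp : (0 : R) < k%:R by rewrite ltr0n lt0n.
      rewrite -(ler_pM2l kp); have := sqr_ge0 (S - k%:R * e k); lra.
    by rewrite /S /Q k0 !big_geq// mulr0 mul0r mul0r addr0.
  lra.
move=> tT; have := tri t tT; set S := \sum_(_ <= _ < _) _ => h.
have h1 : enorm (z t - z 0%N) ^+ 2 <= (th * S) ^+ 2.
  by rewrite lerXn2r ?nnegrE ?enorm_ge0// (le_trans _ h)// enorm_ge0.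
rewrite -mulr_sumr; have := cs (fun j => enorm (x j.+1 - z j)) t; rewrite -/S => h2.
have h3 : p * enorm (z t - z 0%N) ^+ 2 <= p * (th ^+ 2 * S ^+ 2).
  by rewrite -exprMn ler_pM2l.
apply: le_trans h3 _; rewrite mulrCA ler_pM2l ?exprn_gt0//.
by rewrite [leRHS]mulrCA ler_pM2l.
Qed.

End Run.

Section Run.
Variables (eps : R) (x z : nat -> 'cV[R]_n) (lam : nat -> 'cV[R]_m).
Let T := Titer P eps (x 0%N).
Let th := theta_eps P eps.
Hypothesis c_range : 0 < cc P < 1.
Hypothesis ga : 0 < cgamma P.
Hypothesis d1 : 1 <= cd P.
Hypothesis R0 : 0 < cR P.
Hypothesis R_prop : R_property P (cR P).
Hypothesis eps0 : 0 < eps.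
Hypothesis run : imela_run P T (fun=> tau) (fun=> th) (tol P) x z lam.

Let th0 : 0 < th. Proof. exact: theta_eps_gt0. Qed.

Let th_le : th <= mu / (18 * p).
Proof.
have [h _ _] := theta_eps_le eps; apply: le_trans h _.
by rewrite /theta_tilde ge_min lexx.
Qed.

Let DD := phi0 P (x 0%N) - flow P.
Let N := mu / (p * th).
Let q := p / mu.
Let u := cc P ^+ 2 / mu.
Let mm := (Mlam P ^+ 2 + 1) * B ^+ 2 / mu ^+ 2.
Let E := eps ^+ 2 / mu.

Let lam' t := dual_step P tau (lam t) (x t).
(** The multiplier [lam t] for [t <= T], but nonnegative for every [t]. *)
Let lamn t := if t is t'.+1 then lam' t' else 0.
Let xi t := enorm (x t.+1 - z t).
Let y t := enorm (xprox (z t) - xlag (z t) (lam' t)).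

Let mu0 : 0 < mu := mu_gt0.
Let p0 : 0 < p := p_gt0.
Let t0 : 0 < tau := tau_gt0.
Let c0 : 0 < cc P. Proof. by case/andP: c_range. Qed.

Lemma DD_ge0 : 0 <= DD.
Proof.
case: (run) => Xx _ _ _; have [_ h1 h2] := potential_start Xx.
exact: le_trans h2 h1.
Qed.

(** The terms of [C_0] in [pi^2] account for the inner errors; of [C_1],
    only the bound [24 p / theta] is kept. *)
Lemma C0_ge : 16 / 5 * (cc P * (1 + mm + q ^+ 2)) + 24 * (p / th) * DD <=
  C0 P th (x 0%N).
Proof.
have D0 := DD_ge0; have M0 := Mlam_gt0.
rewrite /C0 -/DD -/mm.
have h1 : 24 * p / th <= C1 P th by rewrite /C1 le_max lexx.
have pi0 : 0 <= pi ^+ 2 :> R by exact: sqr_ge0.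
have h2 : 0 <= cc P * p * th * pi ^+ 2 / (72 * mu ^+ 2).
  apply: divr_ge0; last by rewrite mulr_ge0// sqr_ge0.
  by apply: mulr_ge0 pi0; apply: mulr_ge0; [apply: mulr_ge0|]; exact: ltW.
have h3 := ler_wpM2r (addr_ge0 D0 h2) h1.
have mm0 : 0 <= mm.
  by rewrite divr_ge0 ?sqr_ge0// mulr_ge0 ?sqr_ge0// addr_ge0 ?sqr_ge0.
have cm : 0 <= cc P * (1 + mm + q ^+ 2).
  by rewrite mulr_ge0 ?(ltW c0)// !addr_ge0 ?sqr_ge0.
have h4 := ler_wpM2r cm pi_sqr_ge.
apply: le_trans (lerD (lexx _) h3).
have -> : 24 * p / th * (DD + cc P * p * th * pi ^+ 2 / (72 * mu ^+ 2)) =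
   24 * (p / th) * DD + cc P * q ^+ 2 * pi ^+ 2 / 3.
  by rewrite /q; field; rewrite !gt_eqF.
lra.
Qed.

Lemma T_budget : 2 * C0 P th (x 0%N) <= T%:R * eps ^+ 2 /\ (0 < T)%N.
Proof.
have e2 : 0 < eps ^+ 2 by rewrite exprn_gt0.
have C0p : 0 < C0 P th (x 0%N).
  apply: lt_le_trans C0_ge; apply: ltr_pwDl; last first.
    by rewrite mulr_ge0 ?DD_ge0// mulr_ge0// divr_ge0 ?(ltW p0) ?(ltW th0).
  rewrite mulr_gt0// ?mulr_gt0// -addrA ltr_pwDl// addr_ge0 ?sqr_ge0//.
  by rewrite divr_ge0 ?sqr_ge0// mulr_ge0 ?sqr_ge0// addr_ge0 ?sqr_ge0.
pose v := 2 * C0 P th (x 0%N) / eps ^+ 2.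
have v0 : 0 < v by rewrite divr_gt0// mulr_gt0.
have TE : T%:R = (Num.ceil v)%:~R :> R.
  have c00 : 0 <= Num.ceil v by rewrite ltW// ceil_gt0.
  by rewrite /T /Titer -/v -{2}(gez0_abs c00).
have vT : v <= T%:R by rewrite TE ceil_ge.
split; first by rewrite -ler_pdivrMr.
by rewrite -(ltr_nat R); apply: lt_le_trans v0 vT.
Qed.

Lemma lamn_ge0 t : nonneg_orthant (lamn t).
Proof. by case: t => [|t]; [exact: nonneg0|exact: dual_step_ge0]. Qed.

Lemma qN : q * N = th^-1.
Proof. by rewrite /q /N; field; rewrite !gt_eqF. Qed.

Lemma step_error t : (tol P t + p * (th * xi t)) ^+ 2 / mu <=
  6 / 5 * (u * isq t) + 6 / N * (p * xi t ^+ 2 / (q * N)).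
Proof.
have -> : 6 / 5 * (u * isq t) + 6 / N * (p * xi t ^+ 2 / (q * N)) =
   (6 / 5 * tol P t ^+ 2 + 6 * (p * (th * xi t)) ^+ 2) / mu.
  by rewrite qN /u /isq /N /tol; field; rewrite !gt_eqF.
rewrite ler_pM2r ?invr_gt0//.
have := sqr_ge0 (tol P t - 5 * (p * (th * xi t))); lra.
Qed.

(* As above: a linear goal is solved from its antecedents and the facts of the
   section. *)
Ltac drop_facts := repeat match goal with
  | H : is_true ?P |- _ => tryif first [constr_eq H mu0 | constr_eq H p0
      | constr_eq H t0 | constr_eq H c0 | constr_eq H th0 | constr_eq H th_le
      | constr_eq H c_range | constr_eq H ga | constr_eq H d1 | constr_eq H R0
      | constr_eq H eps0 | constr_eq H m_gt0 | constr_eq H L_ge0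
      | constr_eq H p_gtL] then fail else clear H
  end.
Ltac glra := drop_facts; lra.

Lemma imela_estimates : estimates T N q u mm E DD
  (fun t => p * xi t ^+ 2) (fun t => envv P (z t) - flow P)
  (fun t => envv P (z t) - dualf P (lamn t) (z t))
  (fun t => envv P (z t) - dualf P (lam' t) (z t))
  (fun t => enorm (lamn t) ^+ 2 / (2 * tau))
  (fun t => tau * enorm (dual_residual (z t) (lam t) (x t)) ^+ 2)
  (fun t => enorm (lam' t - lam t) ^+ 2 / tau)
  (fun t => p * th * y t ^+ 2)
  (fun t => p * th * xi t * y t) (fun t => p * th * xi t * (tol P t / mu)).
Proof.
have [bud T0] := T_budget; have D0 := DD_ge0.
have B0 := B_gt0; have M0 := Mlam_gt0.
have [Xx z0E lam0E _] := run.
have [G0le V0le V00] := potential_start Xx.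
have [thh1 thh2 thh3] := theta_eps_le eps.
have pth : 0 < p * th by rewrite mulr_gt0.
have N0 : 0 < N by rewrite divr_gt0.
have q0 : 0 < q by rewrite divr_gt0.
have M1 : 0 < Mlam P ^+ 2 + 1 by rewrite ltr_wpDl ?sqr_ge0.
have bnd t (tT : (t <= T)%N) := run_bounds c_range th0 th_le run tT.
have th18 := th_le18 th0 th_le.
have opt t (tT : (t < T)%N) := run_opt c_range th0 th_le run tT.
have sE (v : R) : v / (q * N) = th * v by rewrite qN invrK mulrC.
have tolp t : 0 < tol P t by have /andP[] := tol_range c_range t.
have xi0 t : 0 <= xi t := enorm_ge0 _.
have y0 t : 0 <= y t := enorm_ge0 _.
have err t : (t < T)%N ->
   eps_opt X (fun y => Lp P y (z t.+1) (lam t.+1)) mu (tol P t + p * (th * xi t)) (x t.+1) /\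
   0 <= tol P t + p * (th * xi t).
  move=> tT; split; first exact: opt.
  apply: addr_ge0; first exact: ltW.
  by apply: mulr_ge0; [exact: ltW|apply: mulr_ge0 => //; exact: ltW].
split=> //.
- rewrite /N ler_pdivlMr//; have := th_le; rewrite ler_pdivlMr; last by rewrite mulr_gt0.
  lra.
- by rewrite /q ler_pdivlMr// mul1r mu_le_p.
- by rewrite divr_gt0// exprn_gt0.
- split; first by rewrite divr_ge0 ?sqr_ge0// mulr_ge0 ?sqr_ge0// ltW.
  have h : th * (Mlam P ^+ 2 + 1) <= 6 * p * tau by rewrite -ler_pdivlMr.
  have h2 := ler_wpM2r (sqr_ge0 B) h; have tB := tau_B.
  rewrite /mm ler_pdivrMr ?exprn_gt0//.
  have -> : 3 / 2 * (q ^+ 2 * N) * mu ^+ 2 = 6 * p * (tau * B ^+ 2) / th.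
    by rewrite tB /q /N; field; rewrite !gt_eqF.
  by rewrite ler_pdivlMr//; lra.
- by rewrite divr_gt0// exprn_gt0.
- have h := C0_ge; have /andP[_ c1] := c_range.
  have -> : T%:R * E = T%:R * eps ^+ 2 / mu by rewrite /E mulrA.
  rewrite ler_pdivlMr//; apply: le_trans bud.
  have -> : (32 / 5 * (u + u * mm + u * q ^+ 2) + 48 * (q ^+ 2 * N * DD)) * mu =
     32 / 5 * (cc P ^+ 2 * (1 + mm + q ^+ 2)) + 48 * (p / th) * DD.
    by rewrite /u /N /q; field; rewrite !gt_eqF.
  have mm0 : 0 <= mm by rewrite divr_ge0 ?sqr_ge0// mulr_ge0 ?sqr_ge0// ltW.
  have cm : 0 <= cc P * (1 + mm + q ^+ 2).
    by rewrite mulr_ge0 ?(ltW c0)// !addr_ge0 ?sqr_ge0.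
  have := ler_wpM2r cm (ltW c1); lra.
- move=> t; split; split.
  + by rewrite mulr_ge0 ?sqr_ge0// ltW.
  + rewrite subr_ge0; apply: le_trans (envv_ge (z t)).
    by rewrite lerDl mulr_ge0 ?sqr_ge0// divr_ge0// ltW.
  + by rewrite subr_ge0 gap_ge0//; exact: lamn_ge0.
  + by rewrite subr_ge0 gap_ge0//; exact: dual_step_ge0.
  + by apply: divr_ge0; [exact: sqr_ge0|apply: mulr_ge0 => //; exact: ltW].
  + by apply: mulr_ge0 (sqr_ge0 _); exact: ltW.
  + by apply: divr_ge0 (sqr_ge0 _) _; exact: ltW.
  + by apply: mulr_ge0 (sqr_ge0 _); exact: ltW.
- by rewrite z0E.
- by rewrite /= /lam' lam0E z0E; exact: multiplier_start.
- move=> t tT /=; have [lE st _] := run_step run tT; have [[_ _ _ _] _] := bnd t (ltnW tT).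
  have l0 : nonneg_orthant (lam t.+1) by rewrite lE; exact: dual_step_ge0.
  have := multiplier_growth l0 (approx_stationary_Lp l0 st).
  rewrite -/(lam' t.+1) lE -/(lam' t) -/(xi t).
  have -> : tol P t ^+ 2 / mu = u * isq t.
    by rewrite /u /isq /tol; field; rewrite !gt_eqF.
  lra.
- move=> t eta tT eta0; rewrite qN invrK.
  have := envv_move (z 0%N) (z t) eta0.
  have := center_travel th0 run tT => h1.
  have eta2 : 0 <= (1 + eta) / 2 by rewrite divr_ge0// addr_ge0// ltW.
  have := ler_wpM2l eta2 h1; glra.
- move=> t tT /=; have [lE st _] := run_step run tT.
  have l0 : nonneg_orthant (lam t.+1) by rewrite lE; exact: dual_step_ge0.
  have [eo oe] := err t tT; have := gap_le l0 eo; rewrite -/(lam' t.+1).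
  have := step_error t; rewrite lE -/(lam' t); cbv zeta; glra.
- have := dual_gain0 Xx; rewrite /DD /lam' z0E lam0E /=; lra.
- move=> t tT /=; have [lE st _] := run_step run tT.
  have l0 : nonneg_orthant (lam t.+1) by rewrite lE; exact: dual_step_ge0.
  have [eo oe] := err t tT; have [gn _ _] := dual_gain l0 eo oe; move: gn.
  have := step_error t; rewrite -/(lam' t.+1) lE -/(lam' t); glra.
- move=> t tT /=; have [lE st _] := run_step run tT.
  have l0 : nonneg_orthant (lam t.+1) by rewrite lE; exact: dual_step_ge0.
  have [eo oe] := err t tT; have [_ gn _] := dual_gain l0 eo oe; move: gn.
  have := step_error t; rewrite -/(lam' t.+1) lE -/(lam' t); glra.
- move=> t tT /=; have [lE st _] := run_step run tT.
  have l0 : nonneg_orthant (lam t.+1) by rewrite lE; exact: dual_step_ge0.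
  have [eo oe] := err t tT; have [_ _ gn] := dual_gain l0 eo oe; move: gn.
  have := step_error t; rewrite -/(lam' t.+1) lE -/(lam' t); glra.
- move=> t tT /=; have [_ _ zE] := run_step run tT.
  have l0 : nonneg_orthant (lam' t) by exact: dual_step_ge0.
  have := gap_move (z t) (x t.+1 - z t) (ltW th0) l0.
  rewrite -zE -/(xi t) -/(y t) sE.
  have -> : th * (p * xi t ^+ 2) / N = 2 * (p ^+ 2 * th ^+ 2 / (2 * mu) * xi t ^+ 2).
    by rewrite /N; field; rewrite !gt_eqF.
  have : 0 <= p ^+ 2 * th ^+ 2 / (2 * mu) * xi t ^+ 2.
    apply: mulr_ge0 (sqr_ge0 _); apply: divr_ge0; last by rewrite mulr_ge0// ltW.
    by apply: mulr_ge0; exact: sqr_ge0.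
  glra.
- move=> t tT /=; have [lE st zE] := run_step run tT.
  have l0 : nonneg_orthant (lam t.+1) by rewrite lE; exact: dual_step_ge0.
  have := envv_step th18 l0 (ltW (tolp t)) (approx_stationary_Lp l0 st).
  rewrite -zE lE -/(lam' t) -/(xi t) -/(y t) sE; glra.
- move=> t tT /=; rewrite sE le_eqVlt; apply/orP; left; apply/eqP; ring.
- move=> t tT /=; rewrite sE /u /isq /N /tol le_eqVlt; apply/orP; left; apply/eqP.
  by field; rewrite !gt_eqF.
- move=> t tT /=; have [lE st zE] := run_step run tT; have [[_ Xz _ _] l'M] := bnd t (ltnW tT).
  have l0 : nonneg_orthant (lam t.+1) by rewrite lE; exact: dual_step_ge0.
  have lM : enorm (lam t.+1) <= Mlam P by rewrite lE.
  have := center_drift ga d1 R0 R_prop (tol_range c_range) run tT Xz lM l0 eps0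
    th0 thh1 thh3.
  rewrite lE -/(lam' t) -/(xi t) -/(y t) sE.
  have -> : E / (288 * (N * q ^+ 2)) = th * eps ^+ 2 / (288 * p).
    by rewrite /E /N /q; field; rewrite !gt_eqF.
  have -> : u * isq t / N = p * th * (tol P t ^+ 2 / mu ^+ 2).
    by rewrite /u /isq /N /tol; field; rewrite !gt_eqF.
  glra.
Qed.

Lemma imela_finds_KKT : exists2 t, (1 <= t <= T)%N & eps_KKT P eps (x t).
Proof.
apply: contrapT => noKKT.
apply: (estimates_absurd imela_estimates) => t w1 w2 w3 tT w10 w20 w30 hw.
have [lE st zE] := run_step run tT.
have l0 : nonneg_orthant (lam t.+1) by rewrite lE; exact: dual_step_ge0.
have [[_ _ _ lM] l'M] := run_bounds c_range th0 th_le run tT.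
have notK : ~ eps_KKT P eps (x t.+1).
  by move=> K; apply: noKKT; exists t.+1.
have B0 := B_gt0; have M0 := Mlam_gt0.
set a := enorm (lam' t.+1 - lam t.+1) ^+ 2 / tau.
have a0 : 0 <= a by apply: divr_ge0 (sqr_ge0 _) _; exact: ltW.
have mm0 : 0 <= mm.
  by rewrite divr_ge0 ?sqr_ge0// mulr_ge0 ?sqr_ge0// addr_ge0 ?sqr_ge0.
have K := KKT_of_step l0 st lM l'M.
have uE : tol P t ^+ 2 / mu = u * isq t.
  by rewrite /u /isq /tol; field; rewrite !gt_eqF.
have u0 : 0 <= u * isq t by rewrite -uE divr_ge0 ?sqr_ge0// ltW.
have X0 : 0 <= q * (p * xi t ^+ 2).
  apply: mulr_ge0; first by rewrite divr_ge0 ?(ltW p0) ?(ltW mu0).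
  by apply: mulr_ge0 (sqr_ge0 _); exact: ltW.
have [comp|comp] := lerP (17 / 16 * (Mlam P ^+ 2 + 1) * a / tau) (eps ^+ 2); last first.
  have -> : 17 / 4 * mm = 17 / 16 * (Mlam P ^+ 2 + 1) / tau / mu.
    by rewrite /mm /ctau; field; rewrite !gt_eqF.
  apply: (@lt_le_trans _ _ (17 / 16 * (Mlam P ^+ 2 + 1) / tau / mu * a)).
    rewrite /E (_ : 17 / 16 * _ / tau / mu * a = 17 / 16 * (Mlam P ^+ 2 + 1) * a / tau / mu).
      by rewrite ltr_pM2r ?invr_gt0.
    by ring.
  have := mulr_ge0 (ltW w10) u0; have := mulr_ge0 (ltW w20) X0.
  have := mulr_ge0 (ltW w30) a0; lra.
have [st_e|st_e] := lerP (tol P t + p * xi t + Num.sqrt (mu * a) / 4) eps.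
  by case: notK; apply: K => //.
have tol0 : 0 < tol P t by have /andP[] := tol_range c_range t.
have c3 := cauchy3 (tol P t) (p * xi t) (Num.sqrt (mu * a) / 4) w10 w20 w30 hw.
have lt2 : eps ^+ 2 < (tol P t + p * xi t + Num.sqrt (mu * a) / 4) ^+ 2.
  by rewrite ltrXn2r ?(ltW eps0).
have := lt_le_trans lt2 c3; rewrite -(ltr_pM2r (_ : 0 < mu^-1)) ?invr_gt0// -/E.
have -> : (w1 * tol P t ^+ 2 + w2 * (p * xi t) ^+ 2 + w3 * (Num.sqrt (mu * a) / 4) ^+ 2) / mu =
   w1 * (tol P t ^+ 2 / mu) + w2 * (q * (p * xi t ^+ 2)) + w3 / 16 * a.
  have -> : (Num.sqrt (mu * a) / 4) ^+ 2 = mu * a / 16.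
    by rewrite exprMn sqr_sqrtr ?(mulr_ge0 (ltW mu0) a0)//; field.
  by rewrite /q; field; rewrite gt_eqF.
rewrite uE => h; apply: lt_le_trans h _.
by have := mulr_ge0 mm0 a0; lra.
Qed.

End Run.

(** * Projection *)

Lemma grad_sqdist (z x : 'cV[R]_n) :
  grad (fun u => enorm (u - z) ^+ 2) x = 2 *: (x - z).
Proof.
apply: grad_unique => [u|v]; first exact: differentiable_sqdist.
by rewrite dotvZl; exact: is_derive_sqdist.
Qed.

Lemma eprojP (w : 'cV[R]_n) : X (eproj X w) /\
  forall y, X y -> dotv (w - eproj X w) (y - eproj X w) <= 0.
Proof.
have [x0 x0min] : exists x, is_argmin X (fun u => enorm (u - w) ^+ 2) x.
  apply: exists_argmin X_compact _; first by exists (xfeas P); exact: X_xfeas.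
  by move=> x; apply: differentiable_continuous; exact: differentiable_sqdist.
have sqE x : is_argmin X (fun u => enorm (u - w)) x <->
    is_argmin X (fun u => enorm (u - w) ^+ 2) x.
  by split=> -[Xx xmin]; split=> // y Xy; have := xmin y Xy;
    rewrite ler_pXn2r ?nnegrE ?enorm_ge0.
have : is_argmin X (fun u => enorm (u - w)) (eproj X w).
  rewrite /eproj; case: xgetP => [x _ //|h].
  by case: (h x0); apply/sqE.
move=> /sqE emin; have Xs : segment_closed X by exact: X_segment.
have [Xe] := argmin_normal (@differentiable_sqdist _ _ w (eproj X w)) Xs emin.
rewrite grad_sqdist => h; split=> // y Xy; have := h y Xy.
rewrite -scalerN opprB dotvZl; lra.
Qed.

(** * Smoothness of the subproblem *)

Local Notation K := (cK P).
Local Notation W := (apg_domain P).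

Let K_gt0 : 0 < K. Proof. exact: lt_le_trans p_gt0 cK_ge. Qed.

Lemma X_apg_domain x : X x -> W x.
Proof. by move=> Xx; exists x, x; rewrite subrr scaler0 addr0. Qed.

Lemma apg_domain_segment : segment_closed W.
Proof.
move=> _ _ s [u [v [Xu Xv ->]]] [u' [v' [Xu' Xv' ->]]] s01.
exists (u + s *: (u' - u)), (v + s *: (v' - v)).
split; [exact: X_segment|exact: X_segment|].
by apply/matrixP => i j; rewrite !mxE; ring.
Qed.

(** Cauchy-Schwarz with the all-ones vector; this is the factor [sqrt m] in
    [K]. *)
Lemma sum_le_enorm (lam : 'cV[R]_m) : nonneg_orthant lam ->
  \sum_i lam i 0 <= Num.sqrt m%:R * enorm lam.
Proof.
move=> l0; have := dotv_le_enorm (const_mx 1 : 'cV[R]_m) lam.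
have -> : enorm (const_mx 1 : 'cV[R]_m) = Num.sqrt m%:R.
  rewrite /enorm /dotv (eq_bigr (fun=> 1)) ?sumr_const ?card_ord//.
  by move=> i _; rewrite mxE mulr1.
by rewrite /dotv (eq_bigr (fun i => lam i 0))// => i _; rewrite mxE mul1r.
Qed.

(** Bounds the initial energy for every multiplier of norm at most [M],
    every centre and every starting point; the term 1 makes it positive. *)
Definition apg_energy : R :=
  (cBf P + p * D) * D + M * (B * D) + mu / 2 * D ^+ 2 + 1.

Lemma apg_energy_gt0 : 0 < apg_energy.
Proof.
have D0 := diameter_ge0; have p0 := p_gt0; have mu0 := mu_gt0.
have Bf0 : 0 <= cBf P.
  exact: le_trans (enorm_ge0 _) (f_grad_bound X_xfeas).
rewrite /apg_energy ltr_wpDl//; apply: addr_ge0; last first.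
  by apply: mulr_ge0 (sqr_ge0 _); rewrite divr_ge0// ltW.
apply: addr_ge0; first by rewrite mulr_ge0// addr_ge0// mulr_ge0// ltW.
by rewrite mulr_ge0 ?(ltW Mlam_gt0)// mulr_ge0// ltW// B_gt0.
Qed.

Section Smooth.
Hypothesis f_smoothW : grad_lipschitz_on W L f.
Hypothesis g_smoothW : forall i, grad_lipschitz_on W L (g i).
Variables (z : 'cV[R]_n) (lam : 'cV[R]_m).
Hypothesis lam0 : nonneg_orthant lam.
Hypothesis lamM : enorm lam <= M.

Let F y := Lp P y z lam.

Let L_lam : L * \sum_i lam i 0 <= L * Num.sqrt m%:R * M.
Proof.
rewrite -mulrA; apply: ler_wpM2l => //; apply: le_trans (sum_le_enorm lam0) _.
by apply: ler_wpM2l => //; exact: sqrtr_ge0.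
Qed.

Lemma F_upper x y : W x -> W y ->
  F y <= F x + dotv (Lgrad x z lam) (y - x) + K / 2 * enorm (y - x) ^+ 2.
Proof.
move=> Wx Wy; rewrite /F !LpE /proxf /Lgrad !dotvDl dotvZl.
have Ws := apg_domain_segment.
have := grad_lipschitz_le f_diff Ws f_smoothW Wx Wy.
have : dotv lam (gvec P y) <= dotv lam (gvec P x) + dotv (jacg P x *m lam) (y - x)
    + (\sum_i lam i 0) * (L / 2 * enorm (y - x) ^+ 2).
  have -> : dotv (jacg P x *m lam) (y - x) = \sum_i lam i 0 * dotv (grad (g i) x) (y - x).
    rewrite jacgE {1}/dotv.
    rewrite (eq_bigr (fun k => \sum_i lam i 0 * (grad (g i) x k 0 * (y - x) k 0))).
      by rewrite exchange_big /=; apply: eq_bigr => i _; rewrite -mulr_sumr.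
    move=> k _; rewrite summxE mulr_suml; apply: eq_bigr => i _.
    by rewrite !mxE mulrA.
  rewrite mulr_suml /dotv -!big_split /=; apply: ler_sum => i _.
  rewrite -!mulrDr !mxE; apply: ler_wpM2l => //.
  exact: (grad_lipschitz_le (g_diff i) Ws (g_smoothW i) Wx Wy).
have -> : enorm (y - z) ^+ 2 =
    enorm (x - z) ^+ 2 + 2 * dotv (x - z) (y - x) + enorm (y - x) ^+ 2.
  by rewrite -enormD_sqr (addrC (x - z)) addrA subrK.
have := ler_wpM2r (sqr_ge0 (enorm (y - x))) L_lam; rewrite /cK; lra.
Qed.

Lemma F_lower x y : W x -> W y ->
  F x + dotv (Lgrad x z lam) (y - x) + mu / 2 * enorm (y - x) ^+ 2 <= F y.
Proof.
have Ws : segment_closed W by exact: apg_domain_segment.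
move=> Wx Wy; exact: (Lp_lower z Ws f_smoothW lam0 Wx Wy).
Qed.

Lemma Lgrad_lip x y : W x -> W y ->
  enorm (Lgrad x z lam - Lgrad y z lam) <= K * enorm (x - y).
Proof.
move=> Wx Wy.
have -> : Lgrad x z lam - Lgrad y z lam =
    (grad f x - grad f y) + (\sum_i lam i 0 *: (grad (g i) x - grad (g i) y)) + p *: (x - y).
  have -> : \sum_i lam i 0 *: (grad (g i) x - grad (g i) y) =
      \sum_i lam i 0 *: grad (g i) x - \sum_i lam i 0 *: grad (g i) y.
    by rewrite -sumrB; apply: eq_bigr => i _; rewrite scalerBr.
  rewrite /Lgrad !jacgE; move: (\sum_i lam i 0 *: grad (g i) x) => s1.
  move: (\sum_i lam i 0 *: grad (g i) y) => s2.
  by apply/matrixP => i j; rewrite !mxE; ring.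
apply: le_trans (enormD _ _) _; rewrite enormZ (gtr0_norm p_gt0).
have : enorm (\sum_i lam i 0 *: (grad (g i) x - grad (g i) y)) <=
    \sum_i lam i 0 * (L * enorm (x - y)).
  elim/big_ind2: _ => [|a a' b b' h1 h2|i _]; first by rewrite enorm0.
    by apply: le_trans (enormD _ _) _; exact: lerD.
  by rewrite enormZ ger0_norm//; apply: ler_wpM2l => //; exact: g_smoothW.
rewrite -mulr_suml => h; have := f_smoothW Wx Wy.
have := enormD (grad f x - grad f y) (\sum_i lam i 0 *: (grad (g i) x - grad (g i) y)).
have := ler_wpM2r (enorm_ge0 (x - y)) L_lam; rewrite /cK; lra.
Qed.

Let step (w : 'cV[R]_n) := proj_grad_step X F K w.

Lemma stepE w : step w = eproj X (w - K^-1 *: Lgrad w z lam).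
Proof. by rewrite /step /proj_grad_step /F grad_Lp. Qed.

Lemma step_X w : X (step w).
Proof. by rewrite stepE; case: (eprojP (w - K^-1 *: Lgrad w z lam)). Qed.

Lemma step_normal w y : X y ->
  dotv (K *: (w - step w) - Lgrad w z lam) (y - step w) <= 0.
Proof.
move=> Xy; have [_ /(_ y Xy)] := eprojP (w - K^-1 *: Lgrad w z lam).
rewrite -stepE => h.
have -> : K *: (w - step w) - Lgrad w z lam = K *: (w - K^-1 *: Lgrad w z lam - step w).
  rewrite !scalerBr scalerA divff ?gt_eqF// scale1r.
  by rewrite addrAC.
by rewrite dotvZl pmulr_rle0.
Qed.

(** The upper model of curvature [K] and the lower model of curvature [mu]
    at [w] have the same tangent, and the step minimizes the upper one over
    [X]. *)
Lemma step_decrease w y : W w -> X y ->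
  F (step w) + K / 2 * enorm (y - step w) ^+ 2 <= F y + (K - mu) / 2 * enorm (y - w) ^+ 2.
Proof.
move=> Ww Xy; have Ws := X_apg_domain (step_X w); have Wy := X_apg_domain Xy.
have := step_normal w Xy; have := F_upper Ww Ws; have := F_lower Ww Wy.
have E : enorm (y - step w) ^+ 2 = enorm (y - w) ^+ 2 + 2 * dotv (w - step w) (y - step w)
    - enorm (step w - w) ^+ 2.
  rewrite !enorm_sqr !dotvE (dotvC y (step w)) (dotvC y w) (dotvC (step w) w); ring.
rewrite E !dotvE; lra.
Qed.

(** A step of length [d] decreases the objective by at least [K d^2 / 2],
    and its endpoint is stationary up to [2 K d]. *)
Lemma candidate_stationary u eps : X u -> 0 <= eps -> 8 * K * (F u - F (xlag z lam)) <= eps ^+ 2 ->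
  approx_stationary X F eps (step u).
Proof.
move=> Xu e0 hF; split; first exact: step_X.
have Nu : normal_cone X (step u) (K *: (u - step u) - Lgrad u z lam).
  by split; [exact: step_X|move=> y; exact: step_normal].
apply: le_trans (dist_to_le _ Nu) _; rewrite /F grad_Lp//.
have Wu := X_apg_domain Xu; have Ws := X_apg_domain (step_X u).
have h1 := Lgrad_lip Wu Ws.
have h2 := step_decrease Wu Xu; rewrite subrr enorm0 expr0n /= mulr0 addr0 in h2.
have h3 : F (xlag z lam) <= F (step u).
  by have [_ h] := xlagP z lam; apply: h; exact: step_X.
set d := enorm (u - step u) in h1 h2.
have -> : - Lgrad (step u) z lam - (K *: (u - step u) - Lgrad u z lam) =
   (Lgrad u z lam - Lgrad (step u) z lam) - K *: (u - step u).
  by rewrite opprB addrA [RHS]addrAC [RHS]addrC addrA addrAC.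
apply: le_trans (enormB _ _) _; rewrite enormZ gtr0_norm// -/d.
apply: (@le_trans _ _ (2 * K * d)); first lra.
have d0 : 0 <= d := enorm_ge0 _.
have Kd : 0 <= 2 * K * d by rewrite mulr_ge0// mulr_ge0// ltW.
rewrite -(@ler_pXn2r _ 2) ?nnegrE//; apply: le_trans hF.
have := ler_wpM2l (ltW K_gt0) h2; have := ler_wpM2l (ltW K_gt0) h3; lra.
Qed.

(** * Linear convergence *)

Let kap := Num.sqrt (cq P).
Let xs := xlag z lam.

Lemma cq_bounds : 0 < cq P <= 1.
Proof.
rewrite /cq divr_gt0 ?mu_gt0//= ler_pdivrMr// mul1r.
exact: le_trans mu_le_p cK_ge.
Qed.

Lemma kap_bounds : 0 < kap <= 1.
Proof.
have /andP[q0 q1] := cq_bounds; rewrite /kap sqrtr_gt0 q0 /=.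
by rewrite -(@ler_pXn2r _ 2) ?nnegrE ?sqrtr_ge0// sqr_sqrtr ?(ltW q0)// expr1n.
Qed.

Lemma kap_mu : K * kap ^+ 2 = mu.
Proof.
have /andP[q0 q1] := cq_bounds; rewrite sqr_sqrtr ?(ltW q0)// /cq.
by rewrite mulrC divfK// gt_eqF.
Qed.

Section Iterates.
Variable u0 : 'cV[R]_n.
Hypothesis Xu0 : X u0.

Let u k := (apg_iter X F K (cq P) u0 k).1.
Let w k := (apg_iter X F K (cq P) u0 k).2.

(** Nesterov's auxiliary sequence. *)
Let v k := u k + ((1 + kap) / kap) *: (w k - u k).

Lemma u_step k : u k.+1 = step (w k).
Proof. by rewrite /u /apg_iter iterS. Qed.

Lemma w_step k : w k.+1 = u k.+1 + apg_beta (cq P) *: (u k.+1 - u k).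
Proof. by rewrite /w /u /apg_iter iterS. Qed.

Lemma u_X k : X (u k).
Proof. by case: k => [//|k]; rewrite u_step; exact: step_X. Qed.

Lemma w_W k : W (w k).
Proof.
case: k => [|k]; first exact: X_apg_domain.
by rewrite w_step; exists (u k.+1), (u k); split=> //; exact: u_X.
Qed.

Lemma v_step k : kap *: v k.+1 = u k.+1 - (1 - kap) *: u k.
Proof.
have /andP[k0 k1] := kap_bounds; rewrite /v w_step /apg_beta -/kap.
apply/matrixP => i j; rewrite !mxE; field.
by rewrite !gt_eqF//; lra.
Qed.

Let energy k := F (u k) - F xs + mu / 2 * enorm (v k - xs) ^+ 2.

(** The competitor is [u + kap (xs - u)], with [xs] the minimizer. The
    definition of the auxiliary sequence makes its distances to the new
    iterate and to the extrapolated point multiples of [v' - xs] and of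
    [kap (xs - u) + (xs - v)], so that the coefficients match. *)
Lemma energy_step k : energy k.+1 <= (1 - kap) * energy k.
Proof.
have /andP[k0 k1] := kap_bounds; have mu0 := mu_gt0.
have kap0 : 0 <= kap <= 1 by rewrite ltW.
have Xs : X xs by exact: xlag_X.
pose y := u k + kap *: (xs - u k).
have Xy : X y by apply: X_segment => //; exact: u_X.
have h1 := step_decrease (w_W k) Xy; rewrite -u_step in h1.
have [_ /(_ _ _ _ (u_X k) Xs kap0)] := Lp_strongly_convex z lam0.
rewrite -/y -/(F _) -/(F _) -/(F _) => h2.
have y1 : y - u k.+1 = - kap *: (v k.+1 - xs).
  rewrite scaleNr scalerBr v_step /y; apply/matrixP => i j; rewrite !mxE; ring.
have y2 : y - w k = (kap / (1 + kap)) *: (kap *: (xs - u k) + (xs - v k)).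
  rewrite /y /v; apply/matrixP => i j; rewrite !mxE; field.
  by rewrite !gt_eqF//; lra.
rewrite y1 y2 !enormZ !exprMn !real_normK ?num_real// in h1.
set a := xs - u k in h1 y2; set b := xs - v k in h1 y2.
have h3 : enorm (kap *: a + b) ^+ 2 <= (1 + kap) * (kap * enorm a ^+ 2 + enorm b ^+ 2).
  rewrite enormD_sqr enormZ exprMn real_normK ?num_real// dotvZl.
  have := sqr_ge0 (enorm (a - b)); rewrite enormB_sqr => h.
  have := ler_wpM2l (ltW k0) h; lra.
have kk : 0 <= (K - mu) / 2 * (kap / (1 + kap)) ^+ 2.
  apply: mulr_ge0 (sqr_ge0 _); rewrite divr_ge0// subr_ge0.
  exact: le_trans mu_le_p cK_ge.
have h4 := ler_wpM2l kk h3.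
have E : (K - mu) / 2 * (kap / (1 + kap)) ^+ 2 * ((1 + kap) * (kap * enorm a ^+ 2 + enorm b ^+ 2))
   = (1 - kap) * (mu / 2) * (kap * enorm a ^+ 2 + enorm b ^+ 2).
  by rewrite -kap_mu; field; rewrite gt_eqF//; lra.
rewrite E in h4; rewrite /energy (enormC (v k)) -/b.
have hk s : K / 2 * ((- kap) ^+ 2 * s) = mu / 2 * s by rewrite -kap_mu; field.
rewrite hk in h1; move: h1 h2 h4; rewrite -/a; lra.
Qed.

Lemma energy_le k : F (u k) - F xs <= (1 - kap) ^+ k * energy 0%N.
Proof.
have /andP[k0 k1] := kap_bounds; have mu0 := mu_gt0.
have : energy k <= (1 - kap) ^+ k * energy 0%N.
  elim: k => [|k IH]; first by rewrite expr0 mul1r.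
  apply: le_trans (energy_step k) _; rewrite exprS -mulrA.
  by apply: ler_wpM2l => //; rewrite subr_ge0.
apply: le_trans; rewrite /energy lerDl; apply: mulr_ge0 (sqr_ge0 _).
by rewrite divr_ge0// ltW.
Qed.

Lemma energy0_le : X z -> energy 0%N <= apg_energy.
Proof.
move=> Xz; have mu0 := mu_gt0; have Xs : X xs by exact: xlag_X.
have v0 : v 0%N = u0 by rewrite /v /u /w /= subrr scaler0 addr0.
rewrite /energy v0 /= /F !LpE.
have h1 := prox_gap Xu0 Xs Xz.
have h2 : dotv lam (gvec P u0) - dotv lam (gvec P xs) <= M * (B * D).
  rewrite -dotvNr -dotvDr; apply: le_trans (dotv_le_enorm _ _) _.
  apply: ler_pM => //; try exact: enorm_ge0.
  apply: le_trans (gvec_lip Xs Xu0) _.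
  by apply: ler_wpM2l; [exact: ltW B_gt0|exact: diameter_le].
have h3 : enorm (u0 - xs) ^+ 2 <= D ^+ 2.
  by rewrite lerXn2r ?nnegrE ?enorm_ge0 ?diameter_ge0// diameter_le.
have := ler_wpM2l (ltW mu0) h3; rewrite /apg_energy /u /=; lra.
Qed.

Lemma unfinished_le eps j : X z -> 0 < eps ->
  ~ approx_stationary X F eps (apg_candidate X F K (cq P) u0 j) ->
  kap * j%:R <= ln (1 + 8 * K * apg_energy / eps ^+ 2).
Proof.
move=> Xz e0 hn; have /andP[k0 k1] := kap_bounds.
have e2 : 0 < eps ^+ 2 by rewrite exprn_gt0.
have {hn} : eps ^+ 2 < 8 * K * (F (u j) - F xs).
  rewrite ltNge; apply/negP => h; apply: hn.
  exact: (candidate_stationary (u_X j) (ltW e0) h).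
have K8 : 0 < 8 * K by rewrite mulr_gt0.
have kj : 0 <= (1 - kap) ^+ j by rewrite exprn_ge0// subr_ge0.
have h1 := le_trans (energy_le j) (ler_wpM2l kj (energy0_le Xz)).
have h2 : (1 - kap) ^+ j <= expR (- (kap * j%:R)).
  have -> : - (kap * j%:R) = j%:R * - kap by ring.
  rewrite expRM_natl.
  by rewrite lerXn2r ?nnegrE ?expR_ge0 ?subr_ge0// -[1 - kap]/(1 + - kap) expR_ge1Dx.
move=> h3; have h4 : eps ^+ 2 < 8 * K * ((1 - kap) ^+ j * apg_energy).
  by apply: lt_le_trans h3 _; rewrite ler_pM2l.
have E0 := apg_energy_gt0.
have h5 : eps ^+ 2 < 8 * K * (expR (- (kap * j%:R)) * apg_energy).
  by apply: lt_le_trans h4 _; rewrite ler_pM2l// ler_pM2r.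
rewrite expRN in h5.
have x0 := expR_gt0 (kap * j%:R).
rewrite -ler_expR lnK ?posrE; last first.
  by rewrite ltr_pwDl// divr_ge0 ?ltW// mulr_gt0.
have : expR (kap * j%:R) <= 8 * K * apg_energy / eps ^+ 2.
  rewrite ler_pdivlMr// mulrC -ler_pdivlMr//.
  by apply: ltW; move: h5; rewrite (mulrC _ apg_energy) mulrA.
lra.
Qed.

Lemma apg_stop_le eps kt : X z -> 0 < eps ->
  apg_stops_at X F K (cq P) eps u0 kt ->
  kap * kt%:R <= 1 + ln (1 + 8 * K * apg_energy / eps ^+ 2).
Proof.
move=> Xz e0 [_ hn]; have /andP[k0 k1] := kap_bounds.
case: kt hn => [|j] hn.
  rewrite mulr0 addr_ge0// ln_ge0// lerDl; apply: divr_ge0 (sqr_ge0 _).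
  by apply: mulr_ge0 (ltW apg_energy_gt0); apply: mulr_ge0 => //; exact: ltW.
have := unfinished_le Xz e0 (hn j (ltnSn j)); rewrite -(natr1 j); lra.
Qed.

Lemma apg_terminates eps : X z -> 0 < eps ->
  exists kt, apg_stops_at X F K (cq P) eps u0 kt.
Proof.
move=> Xz e0; have /andP[k0 k1] := kap_bounds.
pose S k := `[< approx_stationary X F eps (apg_candidate X F K (cq P) u0 k) >].
have [k Sk] : exists k, S k.
  set b := ln (1 + 8 * K * apg_energy / eps ^+ 2).
  exists (Num.truncn (b / kap)).+1; apply/asboolP; apply: contrapT => hn.
  have := unfinished_le Xz e0 hn; apply/negP; rewrite -ltNge -ltr_pdivrMl//.
  by rewrite mulrC truncnS_gt.
have [kt Skt kmin] := ex_minnP (ex_intro _ k Sk).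
exists kt; split; first exact/asboolP.
by move=> j jk /asboolP /kmin; rewrite leqNgt jk.
Qed.

End Iterates.

End Smooth.

Section Complexity.
Hypothesis c_range : 0 < cc P < 1.
Hypothesis ga : 0 < cgamma P.
Hypothesis d_range : 1 <= cd P <= 2.
Hypothesis R0 : 0 < cR P.

Let d1 : 1 <= cd P. Proof. by case/andP: d_range. Qed.

Lemma theta_eps_range eps : 0 < eps ->
  0 < theta_eps P eps <= mu / (18 * p).
Proof.
move=> e0; rewrite theta_eps_gt0//=; have [h _ _] := theta_eps_le eps.
by apply: le_trans h _; rewrite /theta_tilde ge_min lexx.
Qed.

(** The exponent [2 d] is that of [eps^(2 (d - 1)) eps^2]. *)
Lemma theta_eps_ge : exists2 a, 0 < a & forall eps, 0 < eps <= 1 ->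
  a * eps `^ (2 * cd P) <= theta_eps P eps * eps ^+ 2.
Proof.
have t0 := tau_gt0; have p0 := p_gt0.
pose th := Num.min (theta_tilde P) (6 * p * tau / (M ^+ 2 + 1)).
have th0 : 0 < th.
  rewrite /th lt_min theta_tilde_gt0//; apply: divr_gt0.
    by apply: mulr_gt0 => //; rewrite mulr_gt0.
  by rewrite ltr_wpDl ?sqr_ge0.
have [dE|dn] := eqVneq (cd P) 1.
  exists th => // eps /andP[e0 e1].
  by rewrite /theta_eps dE eqxx mulr1 -/th (powR_mulrn 2 (ltW e0)).
have dgt : 1 < cd P by rewrite lt_neqAle eq_sym dn.
have A0 := cAd_gt0 ga dgt.
pose k := (2 * cAd P)^-1 `^ (cd P - 1).
have k0 : 0 < k by apply: powR_gt0; rewrite invr_gt0 mulr_gt0.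
exists (Num.min th k); first by rewrite lt_min th0.
move=> eps /andP[e0 e1].
have eE : eps `^ (2 * cd P) = (eps ^+ 2) `^ (cd P - 1) * eps ^+ 2.
  rewrite -[in RHS](powR_mulrn 2 (ltW e0)) -powRrM -powRD; last by rewrite (gt_eqF e0) implybT.
  by congr (_ `^ _); ring.
rewrite eE mulrA; apply: ler_wpM2r; first exact: sqr_ge0.
have s0 : 0 < (eps ^+ 2) `^ (cd P - 1) by apply: powR_gt0; rewrite exprn_gt0.
have s1 : (eps ^+ 2) `^ (cd P - 1) <= 1.
  apply: powR_le1; first by rewrite subr_ge0.
  by rewrite sqr_ge0/= -(expr1n R 2) lerXn2r ?nnegrE ?(ltW e0).
rewrite /theta_eps (negbTE dn) -/th le_min; apply/andP; split.
  apply: (@le_trans _ _ (th * 1)); last by rewrite mulr1.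
  apply: ler_pM => //; [rewrite ltW// lt_min th0//|exact: ltW|by rewrite ge_min lexx].
have A2 : 0 <= (2 * cAd P)^-1 by rewrite invr_ge0 mulr_ge0// ltW.
rewrite (powRM _ (sqr_ge0 eps) A2) -/k mulrC.
by apply: ler_wpM2l; [exact: ltW|rewrite ge_min lexx orbT].
Qed.

Lemma phi0_le x0 : X x0 ->
  phi0 P x0 - flow P <= f (xfeas P) - flow P + 3 * ((cBf P + p * D) * D).
Proof.
move=> Xx; have Xs := X_xfeas.
have h1 := envv_le x0 feasible_nonempty.
have h2 : dualf P 0 x0 = proxf P x0 (xlag x0 0).
  by rewrite dualfE proxf_Lp.
have h3 := prox_gap Xs (xlag_X x0 0) Xx.
have h4 := objective_gap Xx Xs.
have h5 : 0 <= p * D * D.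
  by apply: mulr_ge0 diameter_ge0; rewrite mulr_ge0 ?diameter_ge0 ?ltW ?p_gt0.
have h6 : Lp P x0 x0 0 = f x0.
  by rewrite LpE dotv0l addr0 /proxf subrr enorm0 expr0n mulr0 addr0.
rewrite /phi0 h6 h2; lra.
Qed.

Lemma Titer_le : exists2 H, 1 <= H & forall eps x0, X x0 -> 0 < eps <= 1 ->
  (Titer P eps x0)%:R <= H * eps `^ (- (2 * cd P)).
Proof.
have t0 := tau_gt0; have p0 := p_gt0; have mu0 := mu_gt0.
have [a a0 thge] := theta_eps_ge; have /andP[c0 c1] := c_range.
pose Phi := f (xfeas P) - flow P + 3 * ((cBf P + p * D) * D).
pose b := cc P * p * pi ^+ 2 / (72 * mu ^+ 2).
pose a1 := (1 + (M ^+ 2 + 1) * B ^+ 2 / mu ^+ 2) * (cc P * pi ^+ 2 / 3).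
pose c2 := 24 * p + 4 * (M ^+ 2 + 1) / tau.
have Phi0 : 0 <= Phi.
  have [_ h1 h2] := potential_start X_xfeas.
  exact: le_trans (le_trans h2 h1) (phi0_le X_xfeas).
have b0 : 0 <= b.
  apply: divr_ge0; last by rewrite mulr_ge0// sqr_ge0.
  by apply: mulr_ge0 (sqr_ge0 _); apply: mulr_ge0; exact: ltW.
have a10 : 0 <= a1.
  apply: mulr_ge0; last by apply: divr_ge0 => //; apply: mulr_ge0 (sqr_ge0 _); exact: ltW.
  by rewrite addr_ge0// divr_ge0 ?sqr_ge0// mulr_ge0 ?sqr_ge0// addr_ge0 ?sqr_ge0.
have q0 : 0 <= 4 * (M ^+ 2 + 1) / tau.
  by apply: divr_ge0 (ltW t0); rewrite mulr_ge0// addr_ge0 ?sqr_ge0.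
have c20 : 0 <= c2 by rewrite addr_ge0// mulr_ge0// ltW.
pose G := a1 + c2 * (Phi + b).
have G0 : 0 <= G by rewrite addr_ge0// mulr_ge0// addr_ge0.
exists (2 * G / a + 1) => [|eps x0 Xx /andP[e0 e1]].
  by rewrite lerDr divr_ge0 ?(ltW a0)// mulr_ge0.
have /andP[th0 thle] := theta_eps_range e0; set th := theta_eps P eps in th0 thle *.
have th1 : th <= 1 by have /andP[_] := th_le18 th0 thle; lra.
have Ed0 : 0 < eps `^ (2 * cd P) by exact: powR_gt0.
have Ed1 : eps `^ (2 * cd P) <= 1.
  by apply: powR_le1; rewrite ?(ltW e0)// mulr_ge0// (le_trans ler01).
have C0_le : C0 P th x0 <= G / th.
  rewrite ler_pdivlMr// /C0 -/a1 /G mulrDl; apply: lerD; first by rewrite ler_piMr.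
  have C1le : C1 P th * th <= c2.
    rewrite -ler_pdivlMr// /C1 ge_max; apply/andP; split.
      by rewrite ler_pM2r ?invr_gt0// lerDl.
    rewrite ler_pdivlMr//; apply: (@le_trans _ _ (4 * (M ^+ 2 + 1) / tau)).
      by rewrite ler_piMr.
    by rewrite lerDr mulr_ge0// ltW.
  have C1ge : 0 <= C1 P th * th.
    by apply: mulr_ge0 (ltW th0); rewrite /C1 le_max q0 orbT.
  rewrite mulrAC; apply: (@le_trans _ _ (C1 P th * th * (Phi + b))).
    apply: ler_wpM2l => //; apply: lerD; first exact: phi0_le.
    rewrite (_ : cc P * p * th * pi ^+ 2 / (72 * mu ^+ 2) = b * th); last by rewrite /b; ring.
    by rewrite ler_piMr.
  by apply: ler_wpM2r => //; rewrite addr_ge0.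
pose v := 2 * C0 P th x0 / eps ^+ 2.
have C1p : 0 <= C1 P th by rewrite /C1 le_max q0 orbT.
have v0 : 0 <= v.
  apply: divr_ge0 (sqr_ge0 _); apply: mulr_ge0 => //; rewrite /C0 -/a1 addr_ge0//.
  have [_ h1 h2] := potential_start Xx.
  apply: mulr_ge0 => //; apply: addr_ge0; first exact: le_trans h2 h1.
  rewrite (_ : _ / _ = b * th); first by rewrite mulr_ge0// ltW.
  by rewrite /b; ring.
have T_v : (Titer P eps x0)%:R <= v + 1.
  have c00 : 0 <= Num.ceil v by rewrite ceil_ge0 (lt_le_trans _ v0)// ltrN10.
  have -> : (Titer P eps x0)%:R = (Num.ceil v)%:~R :> R.
    by rewrite /Titer -/th -/v -{2}(gez0_abs c00).
  by rewrite -lerBlDr ltW//; have := ceilB1_lt v; rewrite intrB.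
rewrite powRN; apply: le_trans T_v _; rewrite ler_pdivlMr// mulrDl mul1r.
apply: lerD => //.
have : v * eps `^ (2 * cd P) <= 2 * G / a.
  rewrite -ler_pdivlMr//; have e2 : 0 < eps ^+ 2 by rewrite exprn_gt0.
  have := thge eps; rewrite e0 e1 -/th => /(_ isT) h.
  apply: (@le_trans _ _ (2 * G / (th * eps ^+ 2))).
    rewrite /v ler_pdivrMr//; have -> : 2 * G / (th * eps ^+ 2) * eps ^+ 2 = 2 * (G / th).
      by field; rewrite !gt_eqF.
    by rewrite ler_pM2l.
  rewrite -[leRHS]mulrA -invfM; apply: ler_wpM2l; first by rewrite mulr_ge0.
  by rewrite lef_pV2 ?posrE ?mulr_gt0.
lra.
Qed.

Section Oracle.
Hypothesis f_smoothW : grad_lipschitz_on W L f.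
Hypothesis g_smoothW : forall i, grad_lipschitz_on W L (g i).

Lemma apg_call_terminates eps (x z : nat -> 'cV[R]_n) (lam : nat -> 'cV[R]_m) u0 k t u :
  0 < eps -> imela_apg_run P t (theta_eps P eps) x z lam u0 k -> X u ->
  exists kt, apg_stops_at X
    (fun y => Lp P y (z t) (dual_step P tau (lam t) (x t)))
    K (cq P) (tol P t) u kt.
Proof.
move=> e0 [run _] Xu; have /andP[th0 thle] := theta_eps_range e0.
have [[_ Xz l0 _] l'M] := run_bounds c_range th0 thle run (leqnn t).
have /andP[tol0 _] := tol_range c_range t.
by apply: apg_terminates => //; exact: dual_step_ge0.
Qed.

(** Taking [eps < 1 / e] makes [ln (1 / eps)] at least 1, so that it absorbs
    the constants. *)
Lemma oracle_calls_le : exists C eps0 : R, [/\ 0 < C, 0 < eps0 &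
  forall (eps : R) (x z : nat -> 'cV[R]_n) (lam : nat -> 'cV[R]_m)
         (u0 : nat -> 'cV[R]_n) (k : nat -> nat),
    0 < eps < eps0 ->
    imela_apg_run P (Titer P eps (x 0%N)) (theta_eps P eps) x z lam u0 k ->
    (total_oracle_calls m (Titer P eps (x 0%N)) k)%:R
      <= C * eps `^ (- (2 * cd P)) * ln eps^-1].
Proof.
have [H H1 T_le] := Titer_le; have /andP[c0 c1] := c_range.
have /andP[_ d2] := d_range.
have /andP[k0 k1] := kap_bounds; set kap := Num.sqrt (cq P) in k0 k1.
have E0 := apg_energy_gt0; set E := apg_energy in E0.
have K0 : 0 < K by exact: lt_le_trans p_gt0 cK_ge.
pose G := 1 + 8 * K * E / cc P ^+ 2.
have G1 : 1 <= G.
  by rewrite lerDl divr_ge0 ?sqr_ge0// mulr_ge0 ?(ltW E0)// mulr_ge0// ltW.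
have H0 : 0 < H by exact: lt_le_trans H1.
pose a := 1 + ln G + 2 * ln H + 8; pose b := a / kap.
have a0 : 0 <= a.
  by have := ln_ge0 G1; have := ln_ge0 H1; rewrite /a; lra.
have b0 : 0 <= b by rewrite divr_ge0// ltW.
pose C := H * (m.+1%:R * (3 * b + 2)).
exists C, (expR (-1)); split=> [||eps x z lam u0 k /andP[e0 e1] [run apg]].
- by rewrite !mulr_gt0 ?ltr0n//; lra.
- exact: expR_gt0.
set T := Titer P eps (x 0%N) in run apg *; set ell := ln eps^-1.
have l1 : 1 <= ell.
  rewrite /ell lnV ?posrE// lerNr -(expRK (-1)) ler_ln ?posrE ?expR_gt0//.
  exact: ltW.
have eps1 : 0 < eps <= 1.
  by rewrite e0/=; apply: le_trans (ltW e1) _; rewrite -[leRHS]expR0 ler_expR lerN10.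
have /andP[th0 thle] := theta_eps_range e0.
have Xx0 : X (x 0%N) by case: run.
have TH := T_le eps (x 0%N) Xx0 eps1; rewrite -/T in TH.
have k_le t : (t < T)%N -> (k t)%:R <= b * ell.
  move=> tT; have [Xu stop _] := apg t tT.
  have [lE _ _] := run_step run tT.
  have [[_ Xz l0 _] l'M] := run_bounds c_range th0 thle run (ltnW tT).
  rewrite -lE in l'M.
  have l'0 : nonneg_orthant (lam t.+1) by rewrite lE; exact: dual_step_ge0.
  have /andP[tol0 _] := tol_range c_range t.
  have := apg_stop_le f_smoothW g_smoothW l'0 l'M Xu Xz tol0 stop.
  rewrite -/kap -/E => h.
  have T0 : (0 : R) < T%:R by rewrite ltr0n (leq_ltn_trans _ tT).
  have T1 : (1 : R) <= T%:R by rewrite ler1n (leq_ltn_trans _ tT).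
  have arg : 1 + 8 * K * E / tol P t ^+ 2 <= G * T%:R ^+ 2.
    rewrite /G [leRHS]mulrDl mul1r; apply: lerD; first exact: exprn_ege1.
    have -> : 8 * K * E / tol P t ^+ 2 = 8 * K * E / cc P ^+ 2 * t.+1%:R ^+ 2.
      rewrite /tol; move: (ltr0Sn R t); move: (t.+1%:R : R) => s s0.
      by field; rewrite !gt_eqF.
    apply: ler_wpM2l; first by rewrite divr_ge0 ?sqr_ge0// mulr_ge0 ?(ltW E0)// mulr_ge0// ltW.
    by rewrite lerXn2r ?nnegrE// ler_nat.
  have lnT : ln (T%:R : R) <= ln H + 4 * ell.
    apply: (@le_trans _ _ (ln (H * eps `^ (- (2 * cd P))))).
      by rewrite ler_ln ?posrE// mulr_gt0// powR_gt0.
    rewrite lnM ?posrE ?powR_gt0// lerD2l ln_powR /ell lnV ?posrE//.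
    rewrite mulNr -mulrN; apply: ler_wpM2r; last by lra.
    by rewrite -lnV ?posrE//; apply: le_trans l1.
  have arg0 : 0 < 1 + 8 * K * E / tol P t ^+ 2.
    by rewrite ltr_pwDl// divr_ge0 ?sqr_ge0// mulr_ge0 ?(ltW E0)// mulr_ge0// ltW.
  have lnarg : ln (1 + 8 * K * E / tol P t ^+ 2) <= ln G + 2 * (ln H + 4 * ell).
    apply: (@le_trans _ _ (ln (G * T%:R ^+ 2))).
      rewrite ler_ln ?posrE//; apply: lt_le_trans arg0 arg.
    have G0 : 0 < G by exact: lt_le_trans G1.
    rewrite lnM ?posrE ?exprn_gt0// lnXn// lerD2l -[ln _ *+ 2]mulr_natl.
    by rewrite ler_pM2l.
  rewrite /b mulrAC ler_pdivlMr// mulrC; apply: le_trans h _.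
  have := ler_wpM2r (ln_ge0 G1) l1; have := ler_wpM2r (ln_ge0 H1) l1.
  rewrite /a; lra.
have call_le t : (t < T)%N -> (apg_oracle_calls m (k t))%:R <= m.+1%:R * (3 * b + 2) * ell.
  move=> tT; rewrite /apg_oracle_calls natrM -mulrA; apply: ler_wpM2l => //.
  rewrite !natrD -!(natr1 (k t)); have := k_le t tT; lra.
rewrite /total_oracle_calls natr_sum.
apply: (@le_trans _ _ (\sum_(t < T) (m.+1%:R * (3 * b + 2) * ell))).
  by apply: ler_sum => t _; exact: call_le.
rewrite sumr_const card_ord -[_ *+ T]mulr_natl.
apply: (@le_trans _ _ (H * eps `^ (- (2 * cd P)) * (m.+1%:R * (3 * b + 2) * ell))).
  apply: ler_wpM2r TH; apply: mulr_ge0; last exact: le_trans l1.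
  by apply: mulr_ge0 => //; lra.
by rewrite le_eqVlt; apply/orP; left; apply/eqP; rewrite /C; ring.
Qed.

End Oracle.
End Complexity.

End Problem.

Theorem theorem5p6 (R : realType) (n m l : nat) (P : setting R n m l)
  (m_gt0 : (0 < m)%N)
  (f_diff : forall x, differentiable (fobj P) x)
  (g_diff : forall i x, differentiable (gcon P i) x)
  (X_compact : compact (Xset P))
  (f_lower : forall x, Xset P x -> flow P <= fobj P x)
  (L_ge0 : 0 <= cL P)
  (f_smooth : grad_lipschitz_on (Xset P) (cL P) (fobj P))
  (g_smooth : forall i, grad_lipschitz_on (Xset P) (cL P) (gcon P i))
  (g_convex : forall i, convex_function [set: convex_lmodType 'cV[R]_n] (gcon P i))
  (f_grad_bound : forall x, Xset P x -> enorm (grad (fobj P) x) <= cBf P)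
  (g_bound : forall x, Xset P x ->
     Num.max (enorm (gvec P x)) (spectral_norm (jacg P x)) <= cBg P)
  (slater : Xset P (xfeas P) /\ forall i, gcon P i (xfeas P) < 0)
  (p_gtL : cL P < cp P)
  (delta_gt0 : 0 < cdelta P)
  (gamma_gt0 : 0 < cgamma P)
  (d_range : 1 <= cd P <= 2)
  (ebc : EBC P (cdelta P) (cgamma P) (cd P))
  (R_gt0 : 0 < cR P)
  (R_prop : R_property P (cR P))
  (c_range : 0 < cc P < 1) :
  (* at least one of x^(1), ..., x^(T) is an eps-KKT point *)
  (forall (eps : R) (x z : nat -> 'cV[R]_n) (lam : nat -> 'cV[R]_m)
          (u0 : nat -> 'cV[R]_n) (k : nat -> nat),
     0 < eps ->
     imela_apg_run P (Titer P eps (x 0%N)) (theta_eps P eps) x z lam u0 k ->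
     exists2 t, (1 <= t <= Titer P eps (x 0%N))%N & eps_KKT P eps (x t))
  /\
  (grad_lipschitz_on (apg_domain P) (cL P) (fobj P) ->
   (forall i, grad_lipschitz_on (apg_domain P) (cL P) (gcon P i)) ->
   (* every call of APG stops, whatever its starting point *)
   (forall (eps : R) (x z : nat -> 'cV[R]_n) (lam : nat -> 'cV[R]_m)
           (u0 : nat -> 'cV[R]_n) (k : nat -> nat) (t : nat) (u : 'cV[R]_n),
      0 < eps ->
      (t < Titer P eps (x 0%N))%N ->
      imela_apg_run P t (theta_eps P eps) x z lam u0 k ->
      Xset P u ->
      exists kt, apg_stops_at (Xset P)
        (fun y => Lp P y (z t) (dual_step P (ctau P) (lam t) (x t)))
        (cK P) (cq P) (tol P t) u kt)
   /\
   (* the oracle complexity is O(eps^(-2d) ln(1/eps)) *)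
   (exists C eps0 : R, [/\ 0 < C, 0 < eps0 &
      forall (eps : R) (x z : nat -> 'cV[R]_n) (lam : nat -> 'cV[R]_m)
             (u0 : nat -> 'cV[R]_n) (k : nat -> nat),
        0 < eps < eps0 ->
        imela_apg_run P (Titer P eps (x 0%N)) (theta_eps P eps) x z lam u0 k ->
        (total_oracle_calls m (Titer P eps (x 0%N)) k)%:R
          <= C * eps `^ (- (2 * cd P)) * ln eps^-1])).
Proof.
have P_reg : assumptions P by split.
have /andP[d1 _] := d_range.
split=> [eps x z lam u0 k e0 [run _]|f_smoothW g_smoothW].
  exact: (imela_finds_KKT P_reg c_range gamma_gt0 d1 R_gt0 R_prop e0 run).
split=> [eps x z lam u0 k t u e0 _ run Xu|].
  exact: (apg_call_terminates P_reg c_range gamma_gt0 d_range R_gt0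
            f_smoothW g_smoothW e0 run Xu).
exact: (oracle_calls_le P_reg c_range gamma_gt0 d_range R_gt0 f_smoothW g_smoothW).
Qed.
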